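(* Let $h>0$, $\sigma>0$ and $c\in\mathbb{R}$, and let $S=\mathbb{R}\times(-h,0)$. Let $W_\alpha:\mathbb{R}\to\mathbb{C}$ be a function with $W_\alpha\in B^{1/2}_{2,1}(\mathbb{R})$. Suppose that: (i) $W_\alpha$ is holomorphic, in the sense that it is the trace on the upper boundary $\beta=0$ of a holomorphic function on the strip $S$ which is real on the lower boundary $\beta=-h$ (equivalently, $\operatorname{Im}(W_\alpha)=-\mathcal{T}_h\operatorname{Re}(W_\alpha)$); (ii) $W_\alpha$ solves on $\mathbb{R}$ the equation $$-\frac{c^2}{2}\,\frac{W_\alpha+\overline{W_\alpha}+W_\alpha\overline{W_\alpha}}{|1+W_\alpha|^2}+\frac{i\sigma}{1+W_\alpha}\,\partial_\alpha\!\left(\frac{1+W_\alpha}{|1+W_\alpha|}\right)=0;$$ (iii) there is a constant $\delta>0$ such that $|1+W_\alpha(\alpha)|>\delta$ for all $\alpha\in\mathbb{R}$; (iv) the holomorphic extension of $1+W_\alpha$ to the strip does not vanish at any point of the closed strip $\overline{S}=\mathbb{R}\times[-h,0]$. Then $W_\alpha=0$ identically on $\mathbb{R}$.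
   Context: Points of the strip $S=\mathbb{R}\times(-h,0)$ are written $\alpha+i\beta$; the ''top'' is $\beta=0$ (identified with $\mathbb{R}$) and the ''bottom'' is $\beta=-h$. The subscript $\alpha$ denotes differentiation in $\alpha\in\mathbb{R}$, but only the function $W_\alpha$ (not a primitive $W$) enters the statement. Tilbert transform: $\mathcal{T}_h$ is the Fourier multiplier on $\mathbb{R}$ with symbol $-i\tanh(h\xi)$, with the convention that $\partial_\alpha$ has symbol $i\xi$. It maps real-valued functions to real-valued functions. Holomorphic functions: a function $u:\mathbb{R}\to\mathbb{C}$ is called holomorphic if it is the trace on $\beta=0$ of a holomorphic function in $S$ which is purely real on $\beta=-h$; such functions are characterized by $\operatorname{Im}(u)=-\mathcal{T}_h\operatorname{Re}(u)$. For $u\in L^2(\mathbb{R})$ satisfying this relation, the corresponding extension to $\overline{S}$ is the function whose restriction to height $\beta\in[-h,0]$ is obtained by applying to $\operatorname{Re}(u)$ the Fourier multiplier in $\alpha$ with symbol $e^{-(\beta+h)\xi}/\cosh(h\xi)$. The extension of $1+W_\alpha$ is $1$ plus the extension of $W_\alpha$. Besov space: let $1=\sum_{k\in\mathbb{Z}}P_k$ be a standard dyadic Littlewood--Paley decomposition on $\mathbb{R}$, where $P_k$ selects frequencies of size $\approx 2^k$, and let $P_{\le 0}=\sum_{k\le 0}P_k$. Then $B^{1/2}_{2,1}=B^{1/2}_{2,1}(\mathbb{R})$ is the space of functions with finite norm $$\|u\|_{B^{1/2}_{2,1}}=\sum_{k\ge 1}2^{k/2}\|P_ku\|_{L^2}+\|P_{\le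 0}u\|_{L^2}.$$ It embeds into $L^\infty$ (its elements are identified with their continuous representatives, which tend to $0$ at infinity). The derivative in the equation is taken in the sense of distributions; since $|1+W_\alpha|$ is bounded below, the equation is understood equivalently in the form obtained by multiplying through by $1+W_\alpha$, namely $$i\sigma\,\partial_\alpha\!\left(\frac{1+W_\alpha}{|1+W_\alpha|}\right)=\frac{c^2}{2}\,\frac{W_\alpha+\overline{W_\alpha}+W_\alpha\overline{W_\alpha}}{1+\overline{W_\alpha}}.$$ Physical meaning: this is the equation for solitary waves of speed $c$ (pure capillary, gravity $g=0$, surface tension coefficient $\sigma$, irrotational, asymptotic depth $h$) of the two-dimensional water wave system in holomorphic (conformal) coordinates. *)

(* Defs.v *)
From HB Require Import structures.
From mathcomp Require Import all_boot all_order all_algebra.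
From mathcomp Require Import complex.
From mathcomp Require Import all_classical all_reals all_analysis.

Set Implicit Arguments.
Unset Strict Implicit.
Unset Printing Implicit Defensive.

Import Order.TTheory GRing.Theory Num.Theory numFieldNormedType.Exports.

Local Open Scope classical_set_scope.
Local Open Scope ring_scope.
Local Open Scope complex_scope.

(* [R[i]^o] is [R[i]] seen as a normed space over itself; it carries the
   topology of the complex plane, and [derivable] over it is complex
   differentiability. *)

Definition cosh {R : realType} (x : R) : R := (expR x + expR (- x)) / 2.

Definition sinh {R : realType} (x : R) : R := (expR x - expR (- x)) / 2.

Definition tanh {R : realType} (x : R) : R := sinh x / cosh x.

Definition smooth {R : realType} (f : R -> R) : Prop :=
  forall (n : nat) (x : R), derivable (derive1n n f) x 1.

Definition cintegral {R : realType} (D : set R) (u : R -> R[i]) : R[i] :=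
  Rintegral (@lebesgue_measure R) D (fun x => complex.Re (u x)) +i*
  Rintegral (@lebesgue_measure R) D (fun x => complex.Im (u x)).

Definition L2norm {R : realType} (u : R -> R[i]) : \bar R :=
  Lnorm (@lebesgue_measure R) 2%:E (fun x => (Normc.normc (u x))%:E).

Definition in_L2 {R : realType} (u : R -> R[i]) : Prop :=
  [/\ measurable_fun setT (fun x => complex.Re (u x)),
      measurable_fun setT (fun x => complex.Im (u x)) &
      (L2norm u < +oo)%E].

Definition fourier_trunc {R : realType} (u : R -> R[i]) (N : R) (xi : R) : R[i] :=
  cintegral `[- N, N] (fun x => u x * (cos (x * xi) -i* sin (x * xi))).

(* [U] is the Fourier transform of [u] in L^2: the limit in L^2 of the truncated
   integrals of u(x) e^{-i x xi}, so that the derivative has symbol [i xi]. *)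
Definition is_fourier {R : realType} (u U : R -> R[i]) : Prop :=
  [/\ in_L2 u, in_L2 U &
      L2norm (fun xi => U xi - fourier_trunc u n%:R xi) @[n --> \oo] --> 0%E].

(* [v = m(D) u] in L^2, hence up to equality almost everywhere. *)
Definition is_multiplier {R : realType} (m : R -> R[i]) (u v : R -> R[i]) : Prop :=
  exists2 U : R -> R[i], is_fourier u U & is_fourier v (fun xi => m xi * U xi).

Definition is_tilbert {R : realType} (h : R) (f g : R -> R) : Prop :=
  is_multiplier (fun xi => - 'i%C * (tanh (h * xi))%:C)
    (fun a => (f a)%:C) (fun a => (g a)%:C).

(* Im u = - T_h (Re u) *)
Definition tilbert_holomorphic {R : realType} (h : R) (u : R -> R[i]) : Prop :=
  is_tilbert h (fun a => complex.Re (u a)) (fun a => - complex.Im (u a)).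

Definition strip {R : realType} (h : R) : set R[i] :=
  [set z | - h < complex.Im z < 0].

Definition closed_strip {R : realType} (h : R) : set R[i] :=
  [set z | - h <= complex.Im z <= 0].

(* [E] is the holomorphic extension of [u] to the closed strip; its values
   outside the closed strip are irrelevant.  The multiplier clause selects the
   extension within L^2: without it the trace condition alone also admits
   functions growing at infinity inside the strip. *)
Record holomorphic_extension {R : realType} (h : R) (u : R -> R[i])
    (E : R[i] -> R[i]) : Prop := {
  extension_holomorphic : forall z, strip h z ->
    derivable (E : R[i]^o -> R[i]^o) z 1;
  extension_continuous :
    {within (closed_strip h : set R[i]^o), continuous (E : R[i]^o -> R[i]^o)};
  extension_bottom : forall a : R, complex.Im (E (a -i* h)) = 0;
  extension_trace : forall a : R, E a%:C = u a;
  extension_multiplier : forall b : R, - h <= b <= 0 ->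
    is_multiplier (fun xi => (expR (- ((b + h) * xi)) / cosh (h * xi))%:C)
      (fun a => (complex.Re (u a))%:C) (fun a => E (a +i* b))
}.

(* A smooth low-pass cutoff [chi] generates the dyadic decomposition: P_k has
   symbol [lp_symbol chi k], and summing over k <= 0 telescopes, so that P_{<=0}
   has symbol [chi] (away from the null set xi = 0). *)
Definition lp_cutoff {R : realType} (chi : R -> R) : Prop :=
  [/\ smooth chi,
      forall xi, 0 <= chi xi <= 1,
      forall xi, `|xi| <= 1 -> chi xi = 1 &
      forall xi, 2 <= `|xi| -> chi xi = 0].

Definition lp_symbol {R : realType} (chi : R -> R) (k : int) (xi : R) : R :=
  chi (xi / 2 ^ k) - chi (xi / 2 ^ (k - 1)).

(* Membership in B^{1/2}_{2,1}; [u] is the continuous representative,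
   [Plow] is P_{<=0} u and [P k] is P_k u. *)
Definition besov_half {R : realType} (chi : R -> R) (u : R -> R[i]) : Prop :=
  continuous (u : R -> R[i]^o) /\
  exists (Plow : R -> R[i]) (P : nat -> R -> R[i]),
    [/\ is_multiplier (fun xi => (chi xi)%:C) u Plow,
        forall k : nat, (1 <= k)%N ->
          is_multiplier (fun xi => (lp_symbol chi k%:Z xi)%:C) u (P k) &
        (\sum_(1 <= k <oo) (2 `^ (k%:R / 2))%:E * L2norm (P k)
           + L2norm Plow < +oo)%E].

Definition test_function {R : realType} (phi : R -> R) : Prop :=
  smooth phi /\ exists M : R, forall x, M <= `|x| -> phi x = 0.

(* [< u', phi >] for the distributional derivative of a locally integrable [u] *)
Definition dist_derive {R : realType} (u : R -> R[i]) (phi : R -> R) : R[i] :=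
  - cintegral setT (fun a => u a * (derive1 phi a)%:C).

(* The solitary wave equation multiplied by [1 + W]:
   i sigma ((1 + W) / |1 + W|)' = c^2/2 (W + W^* + W W^* ) / (1 + W^* )
   in the sense of distributions. *)
Definition solitary_wave_eq {R : realType} (sigma c : R) (W : R -> R[i]) : Prop :=
  forall phi : R -> R, test_function phi ->
    'i%C * sigma%:C *
      dist_derive (fun a => (1 + W a) / (Normc.normc (1 + W a))%:C) phi
    = cintegral setT (fun a =>
        (c ^+ 2 / 2)%:C *
        ((W a + conjc (W a) + W a * conjc (W a)) / (1 + conjc (W a))) *
        (phi a)%:C).

(* Main.v *)
(** Write [F] for the extension of [1 + W], [r = |F|] and [T = F / |F|] on the
    top, [k = c^2 / (2 sigma)] and [p = r - 1/r], so that the equation becomes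
    [T' = - i k p T].  For a real shift [s] the function
    [Q(z) = (F(z+s) - F(z))^2 / (F(z+s) F(z))] is holomorphic in the strip and
    non-negative on the bottom, where [F] is real without zeros.  Cauchy's
    theorem for [Q], with the bound [O(s^2)] of its integral on the bottom,
    gives that the increments of [r] are [O(s)] in L^2.  Cauchy's theorem for
    [weight * Q], where [weight] is real and increasing on the top and has
    negative imaginary part on the bottom, gives that the integral of
    [weight * Im Q] on the top is non-positive; as [s -> 0] this integral is
    [2 k s^2] times the integral of [(r + 1/r - 2) * weight'], up to [O(s^3)].
    Hence [r = 1] if [k > 0], so [T] is constant and [W = 0].  If [k = 0], then
    [T] is constant, so [Im Q = 0] on the top, which forces [Q = 0] on the
    bottom and then [r] is constant.  Working with difference quotients instead
    of [F' / F] avoids any regularity theory. *)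
Require Import Defs.
From HB Require Import structures.
From mathcomp Require Import all_boot all_order all_algebra.
From mathcomp Require Import complex.
From mathcomp Require Import all_classical all_reals all_analysis.
From mathcomp Require Import measurable_realfun lebesgue_integral.
From mathcomp Require Import ring lra.

Set Implicit Arguments.
Unset Strict Implicit.
Unset Printing Implicit Defensive.

Import Order.TTheory GRing.Theory Num.Theory numFieldNormedType.Exports.
Local Open Scope classical_set_scope.
Local Open Scope ring_scope.

(** * Integrable and square integrable functions on the line *)

Section RealIntegrals.
Variable R : realType.
Local Notation mu := (@lebesgue_measure R).
Implicit Types f g h : R -> R.

(** Formally, with log F = log r + i theta on the top, the equation says theta' = - k p, and Q is
    s^2 (F'/F)^2 to leading order. Then Re (F'/F)^2 = (r'/r)^2 - k^2 p^2 with p in L^2, so a bound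
    for the integral of Re Q bounds the increments of r. Moreover Im (F'/F)^2 = - 2 k p r'/r = - 2 k
    (r + 1/r)' is an exact derivative, which integration by parts moves to the weight; what remains
    is r + 1/r - 2 = (r - 1)^2 / r, non-negative, against weight' > 0. The error O(s^3) is the
    product of an increment of r, O(s) in L^2, and a defect of the phase, O(s^2) in L^2.

    The obstacle is that Cauchy's theorem on an unbounded strip needs the extension to be bounded
    and uniformly small at infinity, while it is given through multipliers in L^2. The critical
    Besov norm makes the Fourier transform integrable, so the extension is an absolutely convergent
    integral at each height; on the bottom the symbol 1 / cosh (h xi) absorbs one derivative, whence
    the bound O(s^2) there. Bessel's inequality does the work of Plancherel's theorem. *)

Definition summable1 f := mu.-integrable setT (EFin \o f).
Definition integ f : R := Rintegral mu setT f.

Lemma summable1_mfun f : summable1 f -> measurable_fun setT f.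
Proof. by move=> /measurable_int/measurable_EFinP. Qed.

Lemma summable1D f g : summable1 f -> summable1 g -> summable1 (fun x => f x + g x).
Proof.
by move=> sf sg; have := integrableD measurableT sf sg; apply: eq_integrable.
Qed.

Lemma summable1Z c f : summable1 f -> summable1 (fun x => c * f x).
Proof.
by move=> sf; have := integrableZl measurableT c sf; apply: eq_integrable.
Qed.

Lemma summable1N f : summable1 f -> summable1 (fun x => - f x).
Proof.
by move=> sf; have := integrableN sf; apply: eq_integrable.
Qed.

Lemma summable1B f g : summable1 f -> summable1 g -> summable1 (fun x => f x - g x).
Proof. by move=> sf sg; apply: summable1D => //; exact: summable1N. Qed.

Lemma summable1_norm f : summable1 f -> summable1 (fun x => `|f x|).
Proof. by move=> /integrable_norm. Qed.

Lemma summable1_le f g : measurable_fun setT f -> summable1 g ->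
  (forall x, `|f x| <= g x) -> summable1 f.
Proof.
move=> mf sg fg; apply: (le_integrable measurableT _ _ sg).
  exact/measurable_EFinP.
by move=> x _ /=; rewrite lee_fin (le_trans (fg x))// ler_norm.
Qed.

Lemma summable1M f h (M : R) : measurable_fun setT h -> (forall x, `|h x| <= M) ->
  summable1 f -> summable1 (fun x => f x * h x).
Proof.
move=> mh hM sf.
apply: (@summable1_le _ (fun x => M * `|f x|)).
- by apply: measurable_funM => //; exact: summable1_mfun.
- exact/summable1Z/summable1_norm.
- by move=> x; rewrite normrM mulrC ler_wpM2r.
Qed.

Lemma summable1_cst0 : summable1 (fun=> 0).
Proof. exact: integrable0. Qed.

Lemma eq_integ f g : f =1 g -> integ f = integ g.
Proof. by move=> fg; congr integ; apply/funext. Qed.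

Lemma eq_summable1 f g : f =1 g -> summable1 f -> summable1 g.
Proof. by move=> /funext ->. Qed.

Lemma integD f g : summable1 f -> summable1 g ->
  integ (fun x => f x + g x) = integ f + integ g.
Proof. by move=> sf sg; rewrite /integ RintegralD. Qed.

Lemma integB f g : summable1 f -> summable1 g ->
  integ (fun x => f x - g x) = integ f - integ g.
Proof. by move=> sf sg; rewrite /integ RintegralB. Qed.

Lemma integZ c f : summable1 f -> integ (fun x => c * f x) = c * integ f.
Proof. by move=> sf; rewrite /integ RintegralZl. Qed.

Lemma integN f : summable1 f -> integ (fun x => - f x) = - integ f.
Proof.
move=> sf; rewrite -mulN1r -integZ//; apply: eq_integ => x.
by rewrite mulN1r.
Qed.

Lemma integ_le f g : summable1 f -> summable1 g -> (forall x, f x <= g x) ->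
  integ f <= integ g.
Proof. by move=> sf sg fg; apply: le_Rintegral. Qed.

Lemma integ_ge0 f : (forall x, 0 <= f x) -> 0 <= integ f.
Proof. by move=> f0; apply: Rintegral_ge0. Qed.

Lemma integ_norm f : summable1 f -> `|integ f| <= integ (fun x => `|f x|).
Proof. by move=> sf; apply: le_normr_Rintegral. Qed.

Lemma integ_norm_le f g : summable1 f -> summable1 g -> (forall x, `|f x| <= g x) ->
  `|integ f| <= integ g.
Proof.
move=> sf sg fg; apply: le_trans (integ_norm sf) _; apply: integ_le => //.
exact: summable1_norm.
Qed.

Lemma integ0 : integ (fun=> 0) = 0.
Proof. by rewrite /integ Rintegral_cst// mul0r. Qed.

Lemma integE f : summable1 f -> (\int[mu]_x (f x)%:E)%E = (integ f)%:E.
Proof. by move=> sf; rewrite /integ /Rintegral fineK//; exact: integrable_fin_num. Qed.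

Lemma summable1_ge0P f : measurable_fun setT f -> (forall x, 0 <= f x) ->
  (\int[mu]_x (f x)%:E < +oo)%E -> summable1 f.
Proof.
move=> mf f0 foo; apply/integrableP; split; first exact/measurable_EFinP.
by under eq_integral do rewrite /= ger0_norm//.
Qed.

Lemma summable1_lty f : summable1 f -> (\int[mu]_x (f x)%:E < +oo)%E.
Proof. by move=> sf; rewrite integE// ltry. Qed.

Definition square_summable f := measurable_fun setT f /\ summable1 (fun x => f x ^+ 2).

Lemma square_summableM f g : square_summable f -> square_summable g ->
  summable1 (fun x => f x * g x).
Proof.
move=> [mf sf] [mg sg].
apply: (summable1_le _ (summable1D sf sg)); first exact: measurable_funM.
move=> x; have := sqr_ge0 (f x - g x); have := sqr_ge0 (f x + g x).
by rewrite ler_norml => ? ?; apply/andP; split; nra.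
Qed.

Lemma square_summableZ c f : square_summable f -> square_summable (fun x => c * f x).
Proof.
move=> [mf sf]; split; first exact: measurable_funM.
by apply: eq_summable1 (summable1Z (c ^+ 2) sf) => x; rewrite exprMn.
Qed.

Lemma square_summableD f g : square_summable f -> square_summable g ->
  square_summable (fun x => f x + g x).
Proof.
move=> Lf Lg; have sfg := square_summableM Lf Lg.
case: Lf Lg => [mf sf] [mg sg]; split; first exact: measurable_funD.
apply: eq_summable1 (summable1D (summable1D sf sg) (summable1Z 2 sfg)) => x.
ring.
Qed.

Lemma square_summableB f g : square_summable f -> square_summable g ->
  square_summable (fun x => f x - g x).
Proof.
move=> Lf Lg; have : square_summable (fun x => f x + -1 * g x).
  by apply: square_summableD => //; exact: square_summableZ.
by under eq_fun do rewrite mulN1r.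
Qed.

Lemma square_summable_le f g : measurable_fun setT f -> square_summable g ->
  (forall x, `|f x| <= `|g x|) -> square_summable f.
Proof.
move=> mf [mg sg] fg; split => //; apply: (summable1_le _ sg).
  exact: measurable_funX.
by move=> x; rewrite normrX -[g x ^+ 2]real_normK ?num_real// lerXn2r ?nnegrE.
Qed.

Lemma integ_sqrD f g : square_summable f -> square_summable g ->
  integ (fun x => (f x + g x) ^+ 2)
    <= 2 * integ (fun x => f x ^+ 2) + 2 * integ (fun x => g x ^+ 2).
Proof.
move=> Lf Lg; have [_ sfg] := square_summableD Lf Lg.
case: Lf Lg => [mf sf] [mg sg].
rewrite -!integZ// -integD; try exact: summable1Z.
apply: integ_le => //; first by apply: summable1D; exact: summable1Z.
by move=> x; have := sqr_ge0 (f x - g x); nra.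
Qed.

(* AM-GM, playing the role of Cauchy-Schwarz *)
Lemma integ_mul_le (t : R) f g : 0 < t -> square_summable f -> square_summable g ->
  integ (fun x => `|f x * g x|)
    <= t * integ (fun x => f x ^+ 2) + t^-1 * integ (fun x => g x ^+ 2).
Proof.
move=> t0 Lf Lg; have sfg := square_summableM Lf Lg.
case: Lf Lg => [mf sf] [mg sg].
rewrite -!integZ// -integD; try exact: summable1Z.
apply: integ_le => //; first exact: summable1_norm.
  by apply: summable1D; exact: summable1Z.
move=> x; rewrite normrM -[f x ^+ 2]real_normK ?num_real// -[g x ^+ 2]real_normK ?num_real//.
move: (normr_ge0 (f x)) (normr_ge0 (g x)); move: `|f x| `|g x| => a b a0 b0.
have -> : t * a ^+ 2 + t^-1 * b ^+ 2 = t^-1 * ((t * a - b) ^+ 2 + 2 * (t * a * b)).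
  by field; rewrite gt_eqF.
have -> : a * b = t^-1 * (t * a * b) by field; rewrite gt_eqF.
rewrite ler_pM2l ?invr_gt0//; have := sqr_ge0 (t * a - b).
have : 0 <= t * a * b by rewrite !mulr_ge0// ltW.
lra.
Qed.

Lemma contD f g : continuous (f : R -> R) -> continuous (g : R -> R) ->
  continuous (fun x => f x + g x : R).
Proof. by move=> cf cg x; apply: (@cvgD _ _ _ _ _ f g); [exact: cf|exact: cg]. Qed.

Lemma contB f g : continuous (f : R -> R) -> continuous (g : R -> R) ->
  continuous (fun x => f x - g x : R).
Proof. by move=> cf cg x; apply: (@cvgB _ _ _ _ _ f g); [exact: cf|exact: cg]. Qed.

Lemma contN f : continuous (f : R -> R) -> continuous (fun x => - f x : R).
Proof. by move=> cf x; apply: (@cvgN _ _ _ _ _ f); exact: cf. Qed.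

Lemma contM f g : continuous (f : R -> R) -> continuous (g : R -> R) ->
  continuous (fun x => f x * g x : R).
Proof. by move=> cf cg x; apply: (@cvgM _ _ _ _ f g); [exact: cf|exact: cg]. Qed.

Lemma contX n f : continuous (f : R -> R) -> continuous (fun x => f x ^+ n : R).
Proof.
move=> cf; elim: n => [|n IH].
  by under eq_fun do rewrite expr0; move=> x; exact: cvg_cst.
by under eq_fun do rewrite exprS; exact: contM.
Qed.

Lemma contV f : continuous (f : R -> R) -> (forall x, f x != 0) ->
  continuous (fun x => (f x)^-1 : R).
Proof. by move=> cf f0 x; apply: (@cvgV _ _ _ _ f) => //; exact: cf. Qed.

Lemma contnorm f : continuous (f : R -> R) -> continuous (fun x => `|f x| : R).
Proof. by move=> cf x; apply: (@cvg_norm _ _ _ _ _ f); exact: cf. Qed.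

Lemma contcst (c : R) : continuous (fun _ : R => c : R).
Proof. by move=> x; exact: cvg_cst. Qed.

Lemma contid : continuous (fun x : R => x : R).
Proof. by move=> x; exact: cvg_id. Qed.

Lemma contcomp f g : continuous (f : R -> R) -> continuous (g : R -> R) ->
  continuous (fun x => g (f x) : R).
Proof. by move=> cf cg x; apply: (@continuous_comp _ _ _ f g); [exact: cf|exact: cg]. Qed.

Lemma measurable_contR f : continuous (f : R -> R) -> measurable_fun setT f.
Proof. exact: continuous_measurable_fun. Qed.

Lemma ge0_integ_shift f (s : R) : continuous (f : R -> R) -> (forall x, 0 <= f x) ->
  (\int[mu]_x (f (x + s))%:E = \int[mu]_x (f x)%:E)%E.
Proof.
move=> cf f0; pose F x : R := x + s.
have dF : (F^`())%classic = cst 1.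
  apply/funext => x; rewrite derive1E.
  by rewrite deriveD// derive_id derive_cst addr0.
rewrite [RHS](@increasing_ge0_integration_by_substitutionT _ F f)//.
- by apply: eq_integral => x _; rewrite dF /= mulr1.
- by move=> x y xy; rewrite /F ltrD2r.
- by rewrite dF => x; exact: cvg_cst.
- by rewrite dF; exact: is_cvg_cst.
- by rewrite dF; exact: is_cvg_cst.
- by apply: cvg_addrr_Ny.
- by apply: cvg_addrr.
Qed.

Lemma continuous_shiftR f (s : R) : continuous (f : R -> R) ->
  continuous (fun x => f (x + s) : R).
Proof.
move=> cf x; apply: (@continuous_comp _ _ _ (fun x => x + s) f); last exact: cf.
by apply: cvgD; [exact: cvg_id|exact: cvg_cst].
Qed.

Lemma summable1_shift f s : continuous (f : R -> R) -> summable1 f ->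
  summable1 (fun x => f (x + s)).
Proof.
move=> cf sf; apply/integrableP; split.
  by apply/measurable_EFinP; apply: measurable_contR; exact: continuous_shiftR.
rewrite (@ge0_integ_shift (fun x => `|f x|))//.
  by have /integrableP[] := sf.
exact: contnorm.
Qed.

Lemma square_summable_shift f s : continuous (f : R -> R) -> square_summable f ->
  square_summable (fun x => f (x + s)).
Proof.
move=> cf [mf sf]; split.
  by apply: measurable_contR; exact: continuous_shiftR.
apply: (@summable1_shift (fun x => f x ^+ 2)) => //; exact: contX.
Qed.

(** The change of variables is applied to [|f|] and [|f| - f], which are continuous and non-negative
    and have [f] as their difference. *)
Lemma integ_shift f s : continuous (f : R -> R) -> summable1 f ->
  integ (fun x => f (x + s)) = integ f.
Proof.
move=> cf sf.
have H g : continuous (g : R -> R) -> (forall x, 0 <= g x) ->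
    integ (fun x => g (x + s)) = integ g.
  by move=> cg g0; rewrite /integ /Rintegral (@ge0_integ_shift g).
have cn : continuous (fun x => `|f x| : R).
  exact: contnorm.
have cnf : continuous (fun x => `|f x| - f x : R) by exact: contB.
have E g : (forall x, g x = `|f x| - (`|f x| - f x)) -> g = f.
  by move=> e; apply/funext => x; rewrite e; ring.
have sn := summable1_norm sf; have snf := summable1B sn sf.
have -> : integ f = integ (fun x => `|f x|) - integ (fun x => `|f x| - f x).
  by rewrite -integB//; apply: eq_integ => x; ring.
rewrite -[X in X - _]H// -[X in _ - X]H//; last first.
  by move=> x; rewrite subr_ge0 ler_norm.
rewrite -integB//.
- by apply: eq_integ => x; ring.
- exact: (@summable1_shift (fun x => `|f x|)).
- exact: (@summable1_shift (fun x => `|f x| - f x)).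
Qed.

(** A positive value [f x] keeps [f] above [f x / 2] on an interval of length [e], which contributes
    at least [e * f x / 2] to the integral. *)
Lemma integ_eq0_continuous f : continuous (f : R -> R) -> summable1 f ->
  (forall x, 0 <= f x) -> integ f <= 0 -> forall x, f x = 0.
Proof.
move=> cf sf f0 If x; apply/eqP; rewrite eq_le f0 andbT leNgt; apply/negP => fx.
have [e /= e0 He] : \forall y \near nbhs x, f x / 2 < f y.
  by move: (cf x) => /cvgr_gt; apply; rewrite gtr_pMr// invf_lt1// ltr1n.
pose A := `[x - e / 2, x + e / 2]%classic.
have mA : measurable A by exact: measurable_itv.
have : integ (fun y => f x / 2 * \1_A y) <= integ f.
  apply: integ_le => //.
    by apply: summable1Z; exact: integrable_indic_itv.
  move=> y; rewrite indicE; case: (boolP (y \in A)) => [|_]; last by rewrite mulr0.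
  rewrite inE /A/= in_itv/= => /andP[y1 y2]; rewrite mulr1 ltW//; apply: He.
  rewrite /ball/= ltr_distlC; apply/andP; split; lra.
rewrite integZ; last exact: integrable_indic_itv.
have -> : integ \1_A = e.
  rewrite /integ /Rintegral integral_indic//= setIT lebesgue_measure_itv/= lte_fin.
  by rewrite ifT/=; [field|lra].
move=> H; have := le_trans H If; apply/negP; rewrite -ltNge.
by rewrite !mulr_gt0.
Qed.

End RealIntegrals.
(** * The Abel kernel and Bessel's inequality *)

Section AbelKernel.
Variable R : realType.
Local Notation mu := (@lebesgue_measure R).
Implicit Types (f g : R -> R) (e t x y : R).

(** Folds the line onto a half-line, where explicit primitives evaluate the integrals. *)
Lemma ge0_integral_split0 f : continuous (f : R -> R) -> (forall x, 0 <= f x) ->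
  (\int[mu]_x (f x)%:E =
   \int[mu]_(x in `[0%R, +oo[) (f x)%:E + \int[mu]_(x in `[0%R, +oo[) (f (- x))%:E)%E.
Proof.
move=> cf f0.
have mf : measurable_fun [set: R] f by exact: measurable_contR.
rewrite -(setUv (`[0, +oo[%classic : set R)) ge0_integral_setU//= ; last 4 first.
- exact: measurableC.
- by apply/measurable_EFinP; rewrite setUv.
- by move=> x _; rewrite lee_fin.
- exact/disj_setPCl.
congr +%E.
rewrite setCitvr integral_itv_bndo_bndc; last exact/measurable_EFinP/measurable_funTS.
rewrite -{1}oppr0 ge0_integration_by_substitutionNy//.
exact: continuous_subspaceT.
Qed.

Lemma integ_reflect f : continuous (f : R -> R) -> (forall x, 0 <= f x) ->
  integ (fun x => f (- x)) = integ f.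
Proof.
move=> cf f0; rewrite /integ /Rintegral.
rewrite (@ge0_integral_split0 (fun x => f (- x)))//; last first.
  by apply: (contcomp (contN (@contid R)) cf).
rewrite ge0_integral_split0//; congr fine; rewrite addeC; congr +%E.
by apply: eq_integral => x _; rewrite opprK.
Qed.

Definition abel_weight e x : R := expR (- (e * `|x|)).
(** This is [2 * pi] times the Poisson kernel of the half-plane; [integ_abel_cos] exhibits it as the
    Fourier transform of [abel_weight e]. Abel summation with this pair regularises the Fourier
    integrals below. *)
Definition abel_kernel e t : R := 2 * e / (e ^+ 2 + t ^+ 2).

Lemma is_derive_expRN e x :
  is_derive x 1 (fun x => expR (- (e * x))) (- e * expR (- (e * x))).
Proof.
have d : is_derive x (1 : R) (fun x : R => - (e * x)) (- e).
  by apply: is_derive_eq; rewrite /GRing.scale/=; ring.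
by apply: is_derive_eq; rewrite /GRing.scale/=; ring.
Qed.

Lemma is_derive_cosM t x :
  is_derive x 1 (fun x => cos (t * x)) (- t * sin (t * x)).
Proof.
have d : is_derive x (1 : R) (fun x : R => t * x) t.
  by apply: is_derive_eq; rewrite /GRing.scale/=; ring.
by apply: is_derive_eq; rewrite /GRing.scale/=; ring.
Qed.

Lemma is_derive_sinM t x :
  is_derive x 1 (fun x => sin (t * x)) (t * cos (t * x)).
Proof.
have d : is_derive x (1 : R) (fun x : R => t * x) t.
  by apply: is_derive_eq; rewrite /GRing.scale/=; ring.
by apply: is_derive_eq; rewrite /GRing.scale/=; ring.
Qed.

Lemma cont_cosM t : continuous (fun x => cos (t * x) : R).
Proof.
by apply: contcomp; [apply: contM; [exact: contcst|exact: contid]|exact: continuous_cos].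
Qed.

Lemma cont_sinM t : continuous (fun x => sin (t * x) : R).
Proof.
by apply: contcomp; [apply: contM; [exact: contcst|exact: contid]|exact: continuous_sin].
Qed.

Lemma cont_abel_weight e : continuous (abel_weight e : R -> R).
Proof.
apply: (@contcomp _ (fun x => - (e * `|x|)) expR); last exact: continuous_expR.
by apply: contN; apply: contM; [exact: contcst|apply: contnorm; exact: contid].
Qed.

Lemma abel_weight_ge0 e x : 0 <= abel_weight e x.
Proof. exact: expR_ge0. Qed.

Lemma abel_weight_le1 e x : 0 <= e -> abel_weight e x <= 1.
Proof.
move=> e0; rewrite /abel_weight -expR0 ler_expR oppr_le0.
by rewrite mulr_ge0.
Qed.

Lemma abel_denom_gt0 e t : 0 < e -> 0 < e ^+ 2 + t ^+ 2.
Proof. by move=> e0; rewrite ltr_wpDr ?sqr_ge0// exprn_gt0. Qed.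

Lemma cvg_expRNM e : 0 < e -> expR (- (e * x)) @[x --> +oo] --> (0 : R).
Proof.
move=> e0; apply: (@cvg_comp _ _ _ (fun x => e * x) (fun x => expR (- x)) _ (+oo)).
  exact: (gt0_cvgMry e0 (@cvg_id _ _)).
exact: cvgr_expR.
Qed.

(** The summand 1 makes the integrand non-negative, as the fundamental theorem of calculus on a
    half-line requires; it is subtracted again in [integ_abel_cos]. *)
Lemma integral_abel_half e t : 0 < e ->
  (\int[mu]_(x in `[0%R, +oo[) (abel_weight e x * (1 + cos (t * x)))%:E
   = (e^-1 + e / (e ^+ 2 + t ^+ 2))%:E)%E.
Proof.
move=> e0; have d0 := abel_denom_gt0 t e0.
pose c := (e ^+ 2 + t ^+ 2)^-1.
(* A primitive of [expR (- e x) * cos (t x)] is the real part of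
   [- exp (- (e - i t) x) / (e - i t)], whose denominator becomes [e ^+ 2 + t ^+ 2]; hence the
   constant [c]. *)
pose F x := expR (- (e * x)) * (- e^-1 + (c * t) * sin (t * x) - (c * e) * cos (t * x)).
have dF x : is_derive x 1 F (expR (- (e * x)) * (1 + cos (t * x))).
  have d2 : is_derive x 1
     (fun x => - e^-1 + (c * t) * sin (t * x) - (c * e) * cos (t * x))
     ((c * t) * (t * cos (t * x)) - (c * e) * (- t * sin (t * x))).
    apply: is_deriveB; last by apply: is_deriveZ; exact: is_derive_cosM.
    rewrite -[X in is_derive _ _ _ X]add0r; apply: is_deriveD.
    by apply: is_deriveZ; exact: is_derive_sinM.
  have d1 := is_derive_expRN e x; rewrite /F; apply: is_derive_eq.
  rewrite /GRing.scale/= /c; field.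
  by rewrite (gt_eqF d0) (gt_eqF e0).
rewrite (@ge0_continuous_FTC2y _ _ F 0 0).
- rewrite /F !mulr0 oppr0 expR0 sin0 cos0 !mulr0 !mulr1 mul1r addr0 sub0e -EFinN.
  by congr EFin; rewrite /c; ring.
- move=> x _; rewrite mulr_ge0 ?abel_weight_ge0//.
- apply: continuous_subspaceT; apply: contM; first exact: cont_abel_weight.
  by apply: contD; [exact: contcst|exact: cont_cosM].
- apply: (@squeeze_cvgr _ _ _ _ (fun x => - ((e^-1 + `|c * t| + `|c * e|) * expR (- (e * x))))
      (fun x => (e^-1 + `|c * t| + `|c * e|) * expR (- (e * x)))).
  + near=> x; rewrite -ler_norml /F normrM mulrC [`|expR _|]ger0_norm ?expR_ge0//.
    rewrite ler_wpM2r ?expR_ge0// (le_trans (ler_normB _ _))//.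
    rewrite (le_trans (lerD (ler_normD _ _) (lexx _)))//.
    rewrite !normrN (@ger0_norm _ e^-1) ?invr_ge0 ?(ltW e0)// !lerD//.
      by rewrite normrM ler_piMr// ler_norml sin_geN1 sin_le1.
    by rewrite normrM ler_piMr// ler_norml cos_geN1 cos_le1.
  + rewrite -oppr0; apply: cvgN; rewrite -(mulr0 (e^-1 + `|c * t| + `|c * e|)).
    apply: cvgM; first exact: cvg_cst.
    exact: cvg_expRNM.
  + rewrite -(mulr0 (e^-1 + `|c * t| + `|c * e|)).
    apply: cvgM; first exact: cvg_cst.
    exact: cvg_expRNM.
- by move=> x _; case: (dF x).
- apply: cvg_at_right_filter; apply: differentiable_continuous.
  by apply/derivable1_diffP; case: (dF 0).
- move=> x; rewrite in_itv/= andbT => x0; rewrite derive1E.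
  by case: (dF x) => _ ->; rewrite /abel_weight ger0_norm// ltW.
Unshelve. all: end_near. Qed.

Let integral_abel e t : 0 < e ->
  (\int[mu]_x (abel_weight e x * (1 + cos (t * x)))%:E
   = (2 * (e^-1 + e / (e ^+ 2 + t ^+ 2)))%:E)%E.
Proof.
move=> e0; rewrite ge0_integral_split0.
- under [X in (_ + X)%E]eq_integral do
    rewrite /abel_weight normrN mulrN cosN -/(abel_weight e _).
  by rewrite integral_abel_half// -EFinD; congr EFin; ring.
- apply: contM; first exact: cont_abel_weight.
  by apply: contD; [exact: contcst|exact: cont_cosM].
- by move=> x; rewrite mulr_ge0 ?abel_weight_ge0//; have := cos_geN1 (t * x); lra.
Qed.

Let summable1_abel e t : 0 < e ->
  summable1 (fun x => abel_weight e x * (1 + cos (t * x))).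
Proof.
move=> e0; apply: summable1_ge0P.
- apply: measurable_contR; apply: contM; first exact: cont_abel_weight.
  by apply: contD; [exact: contcst|exact: cont_cosM].
- by move=> x; rewrite mulr_ge0 ?abel_weight_ge0//; have := cos_geN1 (t * x); lra.
- by rewrite integral_abel// ltry.
Qed.

Lemma summable1_abel_weight e : 0 < e -> summable1 (abel_weight e).
Proof.
move=> e0; apply: eq_summable1 (summable1Z 2^-1 (summable1_abel 0 e0)) => x.
by rewrite mul0r cos0; field.
Qed.

Lemma summable1_abel_sin e t : 0 < e -> summable1 (fun x => abel_weight e x * sin (t * x)).
Proof.
move=> e0; apply: (@summable1M _ _ _ 1); last exact: summable1_abel_weight.
  by apply: measurable_contR; exact: cont_sinM.
by move=> x; rewrite ler_norml sin_geN1 sin_le1.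
Qed.

Lemma integ_abel_weight e : 0 < e -> integ (abel_weight e) = 2 / e.
Proof.
move=> e0; have -> : abel_weight e = fun x => 2^-1 * (abel_weight e x * (1 + cos (0 * x))).
  by apply/funext => x; rewrite mul0r cos0; field.
rewrite integZ; last exact: summable1_abel.
rewrite /integ /Rintegral integral_abel//= expr0n/= addr0.
by field; rewrite gt_eqF.
Qed.

Lemma integ_abel_cos e t : 0 < e ->
  integ (fun x => abel_weight e x * cos (t * x)) = abel_kernel e t.
Proof.
move=> e0; have d0 := abel_denom_gt0 t e0.
have -> : (fun x => abel_weight e x * cos (t * x)) =
    (fun x => abel_weight e x * (1 + cos (t * x)) - abel_weight e x).
  by apply/funext => x; ring.
rewrite integB; [|exact: summable1_abel|exact: summable1_abel_weight].
rewrite integ_abel_weight// {1}/integ /Rintegral integral_abel//= /abel_kernel.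
by field; rewrite !gt_eqF.
Qed.

(** The integrand is odd. The reflection is carried out on [abel_weight e x * (1 + sin (t * x))],
    because [integ_reflect] takes non-negative functions; it changes only the sign of the sine. *)
Lemma integ_abel_sin e t : 0 < e ->
  integ (fun x => abel_weight e x * sin (t * x)) = 0.
Proof.
move=> e0; have sw := summable1_abel_weight e0; have ss := summable1_abel_sin t e0.
have := @integ_reflect (fun x => abel_weight e x * (1 + sin (t * x))).
have -> : (fun x => abel_weight e (- x) * (1 + sin (t * (- x)))) =
    (fun x => abel_weight e x - abel_weight e x * sin (t * x)).
  by apply/funext => x; rewrite mulrN sinN /abel_weight normrN; ring.
have -> : (fun x => abel_weight e x * (1 + sin (t * x))) =
    (fun x => abel_weight e x + abel_weight e x * sin (t * x)).
  by apply/funext => x; ring.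
rewrite integB// integD// => H; suff : integ (abel_weight e) -
   integ (fun x => abel_weight e x * sin (t * x)) = integ (abel_weight e) +
   integ (fun x => abel_weight e x * sin (t * x)) by lra.
apply: H.
  apply: contD; first exact: cont_abel_weight.
  by apply: contM; [exact: cont_abel_weight|exact: cont_sinM].
by move=> x; rewrite mulr_ge0 ?abel_weight_ge0//; have := sin_geN1 (t * x); lra.
Qed.

Lemma abel_kernel_ge0 e t : 0 < e -> 0 <= abel_kernel e t.
Proof.
move=> e0; rewrite /abel_kernel divr_ge0 ?mulr_ge0 ?(ltW e0)//.
by rewrite ltW// abel_denom_gt0.
Qed.

Lemma cont_abel_kernel e : 0 < e -> continuous (abel_kernel e : R -> R).
Proof.
move=> e0; apply: contM; first exact: contcst.
apply: contV; last by move=> x; rewrite gt_eqF// abel_denom_gt0.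
by apply: contD; [exact: contcst|apply: contX; exact: contid].
Qed.

(** [2 * atan (t / e)] is a primitive with limit [pi] at infinity, so each half-line contributes
    [pi]. *)
Lemma integral_abel_kernel e : 0 < e -> (\int[mu]_t (abel_kernel e t)%:E = (2 * pi)%:E)%E.
Proof.
move=> e0; have ck := cont_abel_kernel e0.
have k0 t := abel_kernel_ge0 t e0.
rewrite ge0_integral_split0//.
under [X in (_ + X)%E]eq_integral do rewrite /abel_kernel sqrrN -/(abel_kernel e _).
have dF x : is_derive x 1 (fun x => 2 * atan (e^-1 * x)) (abel_kernel e x).
  have d : is_derive x (1 : R) (fun x : R => e^-1 * x) e^-1.
    by apply: is_derive_eq; rewrite /GRing.scale/=; ring.
  apply: is_derive_eq; rewrite /GRing.scale/= /abel_kernel.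
  have d0 := abel_denom_gt0 x e0; field.
  by rewrite (gt_eqF d0) (gt_eqF e0).
rewrite (@ge0_continuous_FTC2y _ (abel_kernel e) (fun x => 2 * atan (e^-1 * x)) 0 pi).
- by rewrite mulr0 atan0 mulr0 sube0 -EFinD; congr EFin; ring.
- by [].
- exact: continuous_subspaceT.
- rewrite -[X in _ --> X](_ : 2 * (pi / 2) = pi); last by field.
  apply: cvgM; first exact: cvg_cst.
  apply: (@cvg_comp _ _ _ (fun x => e^-1 * x) atan _ (+oo)); last exact: cvgy_atan.
  by apply: (gt0_cvgMry _ (@cvg_id _ _)); rewrite invr_gt0.
- by move=> x _; case: (dF x).
- apply: cvg_at_right_filter.
  apply: (@differentiable_continuous _ _ _ 0 (fun x => 2 * atan (e^-1 * x))).
  by apply/derivable1_diffP; case: (dF 0).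
- move=> x; rewrite in_itv/= andbT => x0; rewrite derive1E.
  by case: (dF x) => _ ->.
Qed.

Lemma summable1_abel_kernel e : 0 < e -> summable1 (abel_kernel e).
Proof.
move=> e0; apply: summable1_ge0P.
- by apply: measurable_contR; exact: cont_abel_kernel.
- by move=> x; exact: abel_kernel_ge0.
- by rewrite integral_abel_kernel// ltry.
Qed.

Lemma integ_abel_kernel e : 0 < e -> integ (abel_kernel e) = 2 * pi.
Proof. by move=> e0; rewrite /integ /Rintegral integral_abel_kernel. Qed.

End AbelKernel.

(** * Fubini's theorem for bounded kernels *)

Section FubiniKernel.
Variable R : realType.
Local Notation mu := (@lebesgue_measure R).
Implicit Types (f g a : R -> R) (K : R * R -> R).

Lemma summable1_prod f g K (M : R) : summable1 f -> summable1 g ->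
  measurable_fun setT K -> (forall z, `|K z| <= M) ->
  (mu \x mu)%E.-integrable setT (EFin \o (fun z => f z.1 * g z.2 * K z)).
Proof.
move=> sf sg mK KM.
have mf := summable1_mfun sf; have mg := summable1_mfun sg.
have mF : measurable_fun setT (EFin \o (fun z : R * R => f z.1 * g z.2 * K z)).
  apply/measurable_EFinP; apply: measurable_funM => //; apply: measurable_funM.
    by apply: (measurableT_comp mf); exact: measurable_fst.
  by apply: (measurableT_comp mg); exact: measurable_snd.
apply/integrable12ltyP => //.
have sng := summable1_norm sg.
have sF : summable1 (fun x => (M * integ (fun y => `|g y|)) * `|f x|).
  by apply: summable1Z; exact: summable1_norm.
apply: (@le_lt_trans _ _ (\int[mu]_x ((M * integ (fun y => `|g y|)) * `|f x|)%:E)%E); last first.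
  exact: summable1_lty.
apply: ge0_le_integral => //.
- by move=> x _; apply: integral_ge0.
- apply: (@measurable_fun_fubini_tonelli_F _ _ _ _ _ mu
    (fun z => (`|(f z.1 * g z.2 * K z)%:E|)%E)) => //.
  exact: (measurableT_comp (f := abse)).
- by apply/measurable_EFinP; exact: summable1_mfun.
move=> x _.
have -> : ((M * integ (fun y => `|g y|) * `|f x|)%:E =
    \int[mu]_y ((M * `|f x|) * `|g y|)%:E)%E.
  rewrite integE; last exact: summable1Z.
  by rewrite integZ//; congr EFin; ring.
apply: ge0_le_integral => //.
- apply: (measurableT_comp (f := abse)) => //.
  by apply: (measurableT_comp mF); exact: measurable_pair1.
- by apply/measurable_EFinP; exact: summable1_mfun (summable1Z _ sng).
- move=> y _ /=; rewrite lee_fin !normrM [leLHS]mulrC mulrA ler_wpM2r// ler_wpM2r//.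
Qed.

Lemma measurable_kernel_sec1 K : measurable_fun setT K ->
  forall x, measurable_fun setT (fun y => K (x, y)).
Proof. by move=> mK x; apply: (measurableT_comp mK); exact: measurable_pair1. Qed.

Lemma measurable_kernel_sec2 K : measurable_fun setT K ->
  forall y, measurable_fun setT (fun x => K (x, y)).
Proof. by move=> mK x; apply: (measurableT_comp mK); exact: measurable_pair2. Qed.

Lemma integ_kernel_le g K (M : R) : summable1 g ->
  measurable_fun setT K -> (forall z, `|K z| <= M) ->
  forall x, `|integ (fun y => g y * K (x, y))| <= M * integ (fun y => `|g y|).
Proof.
move=> sg mK KM x; rewrite -integZ; last exact: summable1_norm.
apply: integ_norm_le.
- apply: (@summable1M _ _ _ M) => //; exact: measurable_kernel_sec1.
- exact/summable1Z/summable1_norm.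
- by move=> y; rewrite normrM mulrC ler_wpM2r.
Qed.

(** Fubini needs integrability in both variables, while the inner integral is merely bounded in [x].
    A strictly positive integrable weight in [x] is inserted and then divided out. *)
Lemma measurable_integ_kernel g K (M : R) : summable1 g ->
  measurable_fun setT K -> (forall z, `|K z| <= M) ->
  measurable_fun setT (fun x => integ (fun y => g y * K (x, y))).
Proof.
move=> sg mK KM; pose w : R -> R := abel_weight 1.
have sw : summable1 w by exact: summable1_abel_weight.
have w0 x : w x != 0 by rewrite gt_eqF ?expR_gt0.
have H := measurable_fubini_F (summable1_prod sw sg mK KM).
have -> : (fun x => integ (fun y => g y * K (x, y))) =
    (fun x => (w x)^-1 * integ (fun y => w x * (g y * K (x, y)))).
  apply/funext => x; rewrite integZ ?mulKf//.
  apply: (@summable1M _ _ _ M) => //; exact: measurable_kernel_sec1.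
apply: measurable_funM.
  by apply: measurable_contR; apply: contV => //; exact: cont_abel_weight.
apply/measurable_EFinP; apply: eq_measurable_fun H => x _.
rewrite /fubini_F /= -integE; last first.
  apply: summable1Z; apply: (@summable1M _ _ _ M) => //; exact: measurable_kernel_sec1.
by apply: eq_integral => y _; rewrite mulrA.
Qed.

Lemma fubini_kernel f g K (M : R) : summable1 f -> summable1 g ->
  measurable_fun setT K -> (forall z, `|K z| <= M) ->
  integ (fun x => f x * integ (fun y => g y * K (x, y))) =
  integ (fun y => g y * integ (fun x => f x * K (x, y))).
Proof.
move=> sf sg mK KM.
have := Fubini (summable1_prod sf sg mK KM).
have sgK x : summable1 (fun y => g y * K (x, y)).
  apply: (@summable1M _ _ _ M) => //; exact: measurable_kernel_sec1.
have sfK y : summable1 (fun x => f x * K (x, y)).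
  apply: (@summable1M _ _ _ M) => //; exact: measurable_kernel_sec2.
have E1 : (\int[mu]_x \int[mu]_y (f x * g y * K (x, y))%:E =
    \int[mu]_x (f x * integ (fun y => g y * K (x, y)))%:E)%E.
  apply: eq_integral => x _; rewrite -integZ// -integE; last exact: summable1Z.
  by apply: eq_integral => y _; rewrite mulrA.
have E2 : (\int[mu]_y \int[mu]_x (f x * g y * K (x, y))%:E =
    \int[mu]_y (g y * integ (fun x => f x * K (x, y)))%:E)%E.
  apply: eq_integral => y _; rewrite -integZ// -integE; last exact: summable1Z.
  by apply: eq_integral => x _; congr EFin; ring.
by rewrite /= E1 E2 => /(congr1 fine).
Qed.

End FubiniKernel.

(** * Bessel's inequality with an Abel weight *)

Section Bessel.
Variable R : realType.
Local Notation mu := (@lebesgue_measure R).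
Implicit Types (a q : R -> R) (e x y xi : R).

Lemma abel_kernel_le e t : 0 < e -> abel_kernel e t <= 2 / e.
Proof.
move=> e0; rewrite /abel_kernel ler_pdivrMr ?abel_denom_gt0//.
have -> : 2 / e * (e ^+ 2 + t ^+ 2) = 2 * e + 2 / e * t ^+ 2.
  by field; rewrite gt_eqF.
by rewrite lerDl mulr_ge0 ?sqr_ge0// divr_ge0// ltW.
Qed.

Lemma abel_kernelC e x y : abel_kernel e (x - y) = abel_kernel e (y - x).
Proof. by rewrite /abel_kernel -(sqrrN (x - y)) opprB. Qed.

Lemma measurable_abel_diff e : 0 < e ->
  measurable_fun setT (fun z : R * R => abel_kernel e (z.1 - z.2)).
Proof.
move=> e0; apply: (measurableT_comp (measurable_contR (cont_abel_kernel e0))).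
by apply: measurable_funB; [exact: measurable_fst|exact: measurable_snd].
Qed.

Lemma abel_diff_bounded e : 0 < e ->
  forall z : R * R, `|abel_kernel e (z.1 - z.2)| <= 2 / e.
Proof. by move=> e0 z; rewrite ger0_norm ?abel_kernel_ge0// abel_kernel_le. Qed.

Lemma measurable_cos_mul : measurable_fun setT (fun z : R * R => cos (z.1 * z.2)).
Proof.
apply: (measurableT_comp (measurable_contR (@continuous_cos R))).
by apply: measurable_funM; [exact: measurable_fst|exact: measurable_snd].
Qed.

Lemma measurable_sin_mul : measurable_fun setT (fun z : R * R => sin (z.1 * z.2)).
Proof.
apply: (measurableT_comp (measurable_contR (@continuous_sin R))).
by apply: measurable_funM; [exact: measurable_fst|exact: measurable_snd].
Qed.

Lemma cos_bounded1 x : `|cos x| <= 1.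
Proof. by rewrite ler_norml cos_geN1 cos_le1. Qed.

Lemma sin_bounded1 x : `|sin x| <= 1.
Proof. by rewrite ler_norml sin_geN1 sin_le1. Qed.

(** Tonelli, with the total mass [2 * pi] of every translate of the kernel. *)
Lemma abel_convolution q e : 0 < e -> (forall y, 0 <= q y) -> summable1 q ->
  let S x := integ (fun y => q y * abel_kernel e (x - y)) in
  summable1 S /\ integ S = 2 * pi * integ q.
Proof.
move=> e0 q0 sq S.
have mS : measurable_fun setT S.
  exact: (measurable_integ_kernel sq (measurable_abel_diff e0) (abel_diff_bounded e0)).
have sqk x : summable1 (fun y => q y * abel_kernel e (x - y)).
  apply: (@summable1M _ _ _ (2 / e)) => //.
    exact: (measurable_kernel_sec1 (measurable_abel_diff e0)).
  by move=> y; exact: (abel_diff_bounded e0 (x, y)).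
have S0 x : 0 <= S x by apply: integ_ge0 => y; rewrite mulr_ge0// abel_kernel_ge0.
have kE y : (\int[mu]_x (abel_kernel e (x - y))%:E = (2 * pi)%:E)%E.
  rewrite (@ge0_integ_shift _ (abel_kernel e) (- y)) ?integral_abel_kernel//.
    exact: cont_abel_kernel.
  by move=> x; exact: abel_kernel_ge0.
have IS : (\int[mu]_x (S x)%:E = (2 * pi * integ q)%:E)%E.
  transitivity (\int[mu]_x \int[mu]_y (q y * abel_kernel e (x - y))%:E)%E.
    by apply: eq_integral => x _; rewrite integE.
  rewrite (@fubini_tonelli _ _ _ _ _ mu mu (fun z => (q z.2 * abel_kernel e (z.1 - z.2))%:E)).
  - transitivity (\int[mu]_y ((2 * pi) * q y)%:E)%E.
      apply: eq_integral => y _; rewrite EFinM -(kE y) muleC -ge0_integralZl//.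
      + apply/measurable_EFinP; apply: (measurable_kernel_sec2 (measurable_abel_diff e0)).
      + by move=> x _; rewrite lee_fin abel_kernel_ge0.
      + by rewrite lee_fin.
    by rewrite integE ?integZ//; exact: summable1Z.
  - apply/measurable_EFinP; apply: measurable_funM; last exact: measurable_abel_diff.
    by apply: (measurableT_comp (summable1_mfun sq)); exact: measurable_snd.
  - by move=> z; rewrite lee_fin mulr_ge0// abel_kernel_ge0.
split; last by rewrite /integ /Rintegral IS.
by apply: summable1_ge0P => //; rewrite IS ltry.
Qed.

(** The transform of a real [a] is [fourier_cos a - i * fourier_sin a]; keeping the two parts apart
    keeps every integral real. *)
Definition fourier_cos a xi := integ (fun x => a x * cos (xi * x)).
Definition fourier_sin a xi := integ (fun x => a x * sin (xi * x)).

Lemma measurable_fourier_cos a : summable1 a -> measurable_fun setT (fourier_cos a).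
Proof.
move=> sa; apply: (measurable_integ_kernel sa measurable_cos_mul (M := 1)) => z.
exact: cos_bounded1.
Qed.

Lemma measurable_fourier_sin a : summable1 a -> measurable_fun setT (fourier_sin a).
Proof.
move=> sa; apply: (measurable_integ_kernel sa measurable_sin_mul (M := 1)) => z.
exact: sin_bounded1.
Qed.

Lemma fourier_cos_le a xi : summable1 a -> `|fourier_cos a xi| <= integ (fun y => `|a y|).
Proof.
move=> sa; rewrite -[leRHS]mul1r.
apply: (integ_kernel_le sa measurable_cos_mul (M := 1)) => z; exact: cos_bounded1.
Qed.

Lemma fourier_sin_le a xi : summable1 a -> `|fourier_sin a xi| <= integ (fun y => `|a y|).
Proof.
move=> sa; rewrite -[leRHS]mul1r.
apply: (integ_kernel_le sa measurable_sin_mul (M := 1)) => z; exact: sin_bounded1.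
Qed.

Lemma summable1_cosM a xi : summable1 a -> summable1 (fun x => a x * cos (xi * x)).
Proof.
move=> sa; apply: (@summable1M _ _ _ 1) => // [|x]; last exact: cos_bounded1.
by apply: measurable_contR; exact: cont_cosM.
Qed.

Lemma summable1_sinM a xi : summable1 a -> summable1 (fun x => a x * sin (xi * x)).
Proof.
move=> sa; apply: (@summable1M _ _ _ 1) => // [|x]; last exact: sin_bounded1.
by apply: measurable_contR; exact: cont_sinM.
Qed.

(* Fubini, then [integ_abel_cos] for the product-to-sum formulas *)
Lemma abel_mean_fourier a e x : 0 < e -> summable1 a ->
  integ (fun xi => abel_weight e xi * fourier_cos a xi * cos (x * xi)
                 + abel_weight e xi * fourier_sin a xi * sin (x * xi))
  = integ (fun y => a y * abel_kernel e (x - y)).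
Proof.
move=> e0 sa; have sw := summable1_abel_weight e0.
have sc := summable1_cosM x sw; have ss := summable1_sinM x sw.
have swc : summable1 (fun xi => abel_weight e xi * fourier_cos a xi).
  apply: (summable1M (measurable_fourier_cos sa) _ sw) => xi.
  exact: fourier_cos_le.
have sws : summable1 (fun xi => abel_weight e xi * fourier_sin a xi).
  apply: (summable1M (measurable_fourier_sin sa) _ sw) => xi.
  exact: fourier_sin_le.
rewrite integD; [|exact: summable1_cosM|exact: summable1_sinM].
have -> : integ (fun xi => abel_weight e xi * fourier_cos a xi * cos (x * xi)) =
    integ (fun y => a y * integ (fun xi => abel_weight e xi * cos (x * xi) * cos (xi * y))).
  rewrite -(@fubini_kernel _ (fun xi => abel_weight e xi * cos (x * xi)) a
    (fun z => cos (z.1 * z.2)) 1) => //; last by move=> z; exact: cos_bounded1.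
    by apply: eq_integ => xi; rewrite /fourier_cos; ring.
  exact: measurable_cos_mul.
have -> : integ (fun xi => abel_weight e xi * fourier_sin a xi * sin (x * xi)) =
    integ (fun y => a y * integ (fun xi => abel_weight e xi * sin (x * xi) * sin (xi * y))).
  rewrite -(@fubini_kernel _ (fun xi => abel_weight e xi * sin (x * xi)) a
    (fun z => sin (z.1 * z.2)) 1) => //; last by move=> z; exact: sin_bounded1.
    by apply: eq_integ => xi; rewrite /fourier_sin; ring.
  exact: measurable_sin_mul.
have h1 : summable1 (fun y => a y * integ (fun xi => abel_weight e xi * cos (x * xi) * cos (xi * y))).
  have [mm bb] : measurable_fun setT (fun y => integ (fun xi => abel_weight e xi * cos (x * xi) * cos (y * xi)))
    /\ forall y, `|integ (fun xi => abel_weight e xi * cos (x * xi) * cos (y * xi))| <=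
         integ (fun xi => `|abel_weight e xi * cos (x * xi)|).
    by split=> [|y]; [exact: (measurable_fourier_cos sc)|exact: (fourier_cos_le y sc)].
  apply: eq_summable1 (summable1M mm bb sa) => y; congr (_ * _).
  by apply: eq_integ => xi; rewrite (mulrC y).
have h2 : summable1 (fun y => a y * integ (fun xi => abel_weight e xi * sin (x * xi) * sin (xi * y))).
  have [mm bb] : measurable_fun setT (fun y => integ (fun xi => abel_weight e xi * sin (x * xi) * sin (y * xi)))
    /\ forall y, `|integ (fun xi => abel_weight e xi * sin (x * xi) * sin (y * xi))| <=
         integ (fun xi => `|abel_weight e xi * sin (x * xi)|).
    by split=> [|y]; [exact: (measurable_fourier_sin ss)|exact: (fourier_sin_le y ss)].
  apply: eq_summable1 (summable1M mm bb sa) => y; congr (_ * _).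
  by apply: eq_integ => xi; rewrite (mulrC y).
rewrite -integD//; apply: eq_integ => y; rewrite -mulrDr; congr (_ * _).
rewrite -integD; last 2 first.
- by under eq_fun do rewrite (mulrC _ y); exact: summable1_cosM.
- by under eq_fun do rewrite (mulrC _ y); exact: summable1_sinM.
rewrite -integ_abel_cos//; apply: eq_integ => xi.
by rewrite mulrBl cosB (mulrC xi); ring.
Qed.

(** Expanding the squares and exchanging integrals turns the left side into the quadratic form with
    kernel [abel_kernel e (x - y)]. Schur's test bounds it: [a x * a y] is at most half the sum of
    the squares, and the kernel is symmetric with mass [2 * pi]. *)
Lemma bessel_abel a e : 0 < e -> summable1 a -> square_summable a ->
  integ (fun xi => abel_weight e xi * (fourier_cos a xi ^+ 2 + fourier_sin a xi ^+ 2))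
  <= 2 * pi * integ (fun x => a x ^+ 2).
Proof.
move=> e0 sa [ma sa2]; have sw := summable1_abel_weight e0.
have swc : summable1 (fun xi => abel_weight e xi * fourier_cos a xi).
  apply: (summable1M (measurable_fourier_cos sa) _ sw) => xi.
  exact: fourier_cos_le.
have sws : summable1 (fun xi => abel_weight e xi * fourier_sin a xi).
  apply: (summable1M (measurable_fourier_sin sa) _ sw) => xi.
  exact: fourier_sin_le.
have h1 : summable1 (fun x => a x * integ (fun xi => abel_weight e xi * fourier_cos a xi * cos (x * xi))).
  exact: (summable1M (measurable_fourier_cos swc) (fun y => fourier_cos_le y swc) sa).
have h2 : summable1 (fun x => a x * integ (fun xi => abel_weight e xi * fourier_sin a xi * sin (x * xi))).
  exact: (summable1M (measurable_fourier_sin sws) (fun y => fourier_sin_le y sws) sa).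
have -> : integ (fun xi => abel_weight e xi * (fourier_cos a xi ^+ 2 + fourier_sin a xi ^+ 2))
    = integ (fun x => a x * integ (fun y => a y * abel_kernel e (x - y))).
  under [RHS]eq_integ => x.
    rewrite -abel_mean_fourier// integD;
      [|exact: summable1_cosM|exact: summable1_sinM].
    rewrite mulrDr.
    over.
  rewrite integD//.
  rewrite -(@fubini_kernel _ _ a (fun z => cos (z.2 * z.1)) 1) => //; last 2 first.
  - by under eq_fun do rewrite mulrC; exact: measurable_cos_mul.
  - by move=> z; exact: cos_bounded1.
  rewrite -(@fubini_kernel _ _ a (fun z => sin (z.2 * z.1)) 1) => //; last 2 first.
  - by under eq_fun do rewrite mulrC; exact: measurable_sin_mul.
  - by move=> z; exact: sin_bounded1.
  rewrite -integD.
  - apply: eq_integ => xi; rewrite mulrDr !expr2 !mulrA; congr (_ + _).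
      by congr (_ * _); apply: eq_integ => x; rewrite /= (mulrC x).
    by congr (_ * _); apply: eq_integ => x; rewrite /= (mulrC x).
  - under eq_fun => xi do under eq_integ do rewrite /= (mulrC _ xi).
    by apply: (summable1M (measurable_fourier_cos sa) _ swc) => y; exact: fourier_cos_le.
  - under eq_fun => xi do under eq_integ do rewrite /= (mulrC _ xi).
    by apply: (summable1M (measurable_fourier_sin sa) _ sws) => y; exact: fourier_sin_le.
have [sS IS] := abel_convolution e0 (fun y => sqr_ge0 (a y)) sa2.
(* The right side is written as the integral of half of [a x ^+ 2 + a y ^+ 2] against the kernel, so
   that the comparison becomes pointwise. *)
have -> : 2 * pi * integ (fun x => a x ^+ 2) =
    integ (fun x => 2^-1 * (2 * pi * a x ^+ 2 +
      integ (fun y => a y ^+ 2 * abel_kernel e (x - y)))).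
  rewrite integZ; last by apply: summable1D => //; exact: summable1Z.
  rewrite integD ?integZ ?IS//; last exact: summable1Z.
  by field.
have ak0 x : summable1 (fun y => a y * abel_kernel e (x - y)).
  apply: (@summable1M _ _ _ (2 / e)) => //.
    exact: (measurable_kernel_sec1 (measurable_abel_diff e0)).
  by move=> y; exact: (abel_diff_bounded e0 (x, y)).
have ak2 x : summable1 (fun y => a y ^+ 2 * abel_kernel e (x - y)).
  apply: (@summable1M _ _ _ (2 / e)) => //.
    exact: (measurable_kernel_sec1 (measurable_abel_diff e0)).
  by move=> y; exact: (abel_diff_bounded e0 (x, y)).
have sk x : summable1 (fun y => abel_kernel e (x - y)).
  under eq_fun do rewrite abel_kernelC.
  by apply: summable1_shift; [exact: cont_abel_kernel|exact: summable1_abel_kernel].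
have Ik x : integ (fun y => abel_kernel e (x - y)) = 2 * pi.
  under eq_integ do rewrite abel_kernelC.
  rewrite integ_shift ?integ_abel_kernel//; first exact: cont_abel_kernel.
  exact: summable1_abel_kernel.
apply: integ_le.
- apply: (summable1M _ _ sa).
    exact: (measurable_integ_kernel sa (measurable_abel_diff e0) (abel_diff_bounded e0)).
  exact: (integ_kernel_le sa (measurable_abel_diff e0) (abel_diff_bounded e0)).
- by apply: summable1Z; apply: summable1D => //; exact: summable1Z.
move=> x; rewrite -integZ// -(Ik x) [X in 2^-1 * (X + _)]mulrC -integZ//.
rewrite -integD//; last exact: summable1Z.
rewrite -integZ; last by apply: summable1D => //; exact: summable1Z.
apply: integ_le => //; first exact: summable1Z.
  by apply: summable1Z; apply: summable1D => //; exact: summable1Z.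
move=> y; rewrite [a x * _]mulrA -mulrDl mulrA ler_wpM2r ?abel_kernel_ge0//.
by have := sqr_ge0 (a x - a y); lra.
Qed.

End Bessel.

(** * Limits under the integral sign and Bessel's inequality *)

Section FatouReal.
Variable R : realType.
Local Notation mu := (@lebesgue_measure R).

Lemma fatou_bounded (f_ : nat -> R -> R) (f : R -> R) (C : R) :
  (forall n, summable1 (f_ n)) -> (forall n x, 0 <= f_ n x) ->
  measurable_fun setT f ->
  (forall x, f_ n x @[n --> \oo] --> f x) ->
  (forall n, integ (f_ n) <= C) ->
  summable1 f /\ integ f <= C.
Proof.
move=> sf f0 mf ff fC.
have fge0 x : 0 <= f x.
  rewrite -(cvg_lim _ (ff x))//; apply: limr_ge; first exact: cvgP (ff x).
  by apply: nearW => n; exact: f0.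
have If : (\int[mu]_x (f x)%:E <= C%:E)%E.
  have mf_ n : measurable_fun setT (EFin \o f_ n).
    by apply/measurable_EFinP; exact: summable1_mfun.
  have := @fatou _ _ _ mu setT measurableT (fun n => EFin \o f_ n) mf_.
  have -> : (\int[mu]_x limn_einf (fun n => (EFin \o f_ n) x) = \int[mu]_x (f x)%:E)%E.
    apply: eq_integral => x _.
    have H : (EFin \o f_ n) x @[n --> \oo] --> (f x)%:E.
      by apply: cvg_EFin; [exact: nearW|exact: ff].
    by rewrite is_cvg_limn_einfE; [exact/cvg_lim|exact: cvgP H].
  move=> H; apply: le_trans (H _) _ => [n x _|]; first by rewrite lee_fin.
  rewrite limn_einf_lim; apply: lime_le; first exact: is_cvg_einfs.
  apply: nearW => n; apply: (@le_trans _ _ (\int[mu]_x (EFin \o f_ n) x)%E).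
    by apply: ereal_inf_lbound; exists n => /=.
  by rewrite integE// lee_fin.
have sf1 : summable1 f by apply: summable1_ge0P => //; apply: le_lt_trans If (ltry _).
by split => //; rewrite -lee_fin -integE.
Qed.

Lemma dominated_integ (f_ : nat -> R -> R) (f g : R -> R) :
  (forall n, measurable_fun setT (f_ n)) -> measurable_fun setT f -> summable1 g ->
  (forall n x, `|f_ n x| <= g x) -> (forall x, f_ n x @[n --> \oo] --> f x) ->
  summable1 f /\ integ (f_ n) @[n --> \oo] --> integ f.
Proof.
move=> mf_ mf sg fg ff.
have sf_ n : summable1 (f_ n) by exact: summable1_le (mf_ n) sg (fg n).
have [|||||] := @dominated_convergence _ _ _ mu setT measurableT
   (fun n => EFin \o f_ n) (EFin \o f) (EFin \o g).
- by move=> n; apply/measurable_EFinP; exact: mf_.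
- by apply/measurable_EFinP; exact: mf.
- by apply: aeW => x _; apply: cvg_EFin; [exact: nearW|exact: ff].
- by [].
- by apply: aeW => x n _ /=; rewrite lee_fin.
move=> sf _ H; split => //.
rewrite /integ /Rintegral; apply: fine_cvg.
by rewrite fineK; [exact: H|exact: integrable_fin_num].
Qed.

End FatouReal.

Section BesselInequality.
Variable R : realType.
Local Notation mu := (@lebesgue_measure R).
Implicit Types (a : R -> R).

(** Fatou's lemma in [bessel_abel] as [e] tends to 0; it yields square summability of the transforms
    together with the bound. *)
Theorem bessel_fourier a : summable1 a -> square_summable a ->
  [/\ square_summable (fourier_cos a), square_summable (fourier_sin a) &
  integ (fun xi => fourier_cos a xi ^+ 2) + integ (fun xi => fourier_sin a xi ^+ 2)
  <= 2 * pi * integ (fun x => a x ^+ 2)].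
Proof.
move=> sa La.
have mc := measurable_fourier_cos sa; have ms := measurable_fourier_sin sa.
pose e n : R := n.+1%:R^-1.
have e0 n : 0 < e n by rewrite invr_gt0.
pose q xi := fourier_cos a xi ^+ 2 + fourier_sin a xi ^+ 2.
have q0 xi : 0 <= q xi by rewrite addr_ge0 ?sqr_ge0.
have mq : measurable_fun setT q by apply: measurable_funD; exact: measurable_funX.
have [sq Iq] : summable1 q /\ integ q <= 2 * pi * integ (fun x => a x ^+ 2).
  apply: (@fatou_bounded _ (fun n xi => abel_weight (e n) xi * q xi)) => //.
  - move=> n; apply: (summable1M (M := 2 * integ (fun y => `|a y|) ^+ 2) mq _ (summable1_abel_weight (e0 n))).
    move=> xi; rewrite ger0_norm// /q.
    have := fourier_cos_le xi sa; have := fourier_sin_le xi sa.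
    rewrite -[fourier_cos a xi ^+ 2]real_normK ?num_real//.
    rewrite -[fourier_sin a xi ^+ 2]real_normK ?num_real//.
    move: (normr_ge0 (fourier_cos a xi)) (normr_ge0 (fourier_sin a xi)).
    move: `|fourier_cos a xi| `|fourier_sin a xi| => u v; nra.
  - by move=> n x; rewrite mulr_ge0 ?abel_weight_ge0.
  - move=> x; rewrite -[X in _ --> X]mul1r; apply: cvgM; last exact: cvg_cst.
    rewrite -expR0 -oppr0 -(mul0r `|x|).
    apply: (@cvg_comp _ _ _ (fun n => - (e n * `|x|)) expR _ (nbhs (- (0 * `|x|)))).
      by apply: cvgN; apply: cvgM; [exact: cvg_harmonic|exact: cvg_cst].
    exact: continuous_expR.
  - by move=> n; exact: bessel_abel.
have sc2 : summable1 (fun xi => fourier_cos a xi ^+ 2).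
  apply: (summable1_le _ sq); first exact: measurable_funX.
  by move=> xi; rewrite ger0_norm ?sqr_ge0// lerDl sqr_ge0.
have ss2 : summable1 (fun xi => fourier_sin a xi ^+ 2).
  apply: (summable1_le _ sq); first exact: measurable_funX.
  by move=> xi; rewrite ger0_norm ?sqr_ge0// lerDr sqr_ge0.
by split => //; rewrite -integD.
Qed.

End BesselInequality.

Local Open Scope complex_scope.

(** * The Fourier transform in L^2 *)

Section L2Components.
Variable R : realType.
Local Notation mu := (@lebesgue_measure R).
Implicit Types (u v U V : R -> R[i]) (f g : R -> R).
Local Notation Re := complex.Re.
Local Notation Im := complex.Im.

Lemma normc_sqr (z : R[i]) : Normc.normc z ^+ 2 = Re z ^+ 2 + Im z ^+ 2.
Proof. by case: z => a b /=; rewrite sqr_sqrtr// addr_ge0 ?sqr_ge0. Qed.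

Lemma normc_ge0 (z : R[i]) : 0 <= Normc.normc z.
Proof. by case: z => a b /=; exact: sqrtr_ge0. Qed.

Lemma L2norm_sqr u : (L2norm u `^ 2 = \int[mu]_x (Re (u x) ^+ 2 + Im (u x) ^+ 2)%:E)%E.
Proof.
rewrite /L2norm poweR_Lnorm//; apply: eq_integral => x _ /=.
by rewrite ger0_norm ?normc_ge0// powR_mulrn ?normc_ge0// normc_sqr.
Qed.

Lemma square_summable_sqrD f g : square_summable f -> square_summable g ->
  summable1 (fun x => f x ^+ 2 + g x ^+ 2).
Proof. by move=> [_ sf] [_ sg]; exact: summable1D. Qed.

Lemma in_L2P u : in_L2 u <->
  square_summable (fun x => Re (u x)) /\ square_summable (fun x => Im (u x)).
Proof.
split=> [[mr mi uoo]|[Lr Li]]; last first.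
  case: (Lr) (Li) => [mr _] [mi _]; split => //.
  have : (L2norm u `^ 2 < +oo)%E.
    by rewrite L2norm_sqr; apply: summable1_lty; exact: square_summable_sqrD.
  by apply: contraTT; rewrite -!leNgt !leye_eq => /eqP ->; rewrite poweRyr.
have s : summable1 (fun x => Re (u x) ^+ 2 + Im (u x) ^+ 2).
  apply: summable1_ge0P.
  - by apply: measurable_funD; exact: measurable_funX.
  - by move=> x; rewrite addr_ge0 ?sqr_ge0.
  - by rewrite -L2norm_sqr; exact: poweR_lty.
split; split => //; apply: (summable1_le _ s); try exact: measurable_funX.
  by move=> x; rewrite ger0_norm ?sqr_ge0// lerDl sqr_ge0.
by move=> x; rewrite ger0_norm ?sqr_ge0// lerDr sqr_ge0.
Qed.

Lemma L2normE u : square_summable (fun x => Re (u x)) ->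
  square_summable (fun x => Im (u x)) ->
  L2norm u = (Num.sqrt (integ (fun x => Re (u x) ^+ 2)
                       + integ (fun x => Im (u x) ^+ 2)))%:E.
Proof.
move=> Lr Li; have s := square_summable_sqrD Lr Li.
case: Lr Li => [mr sr] [mi si].
rewrite -integD// -powR12_sqrt; last first.
  by apply: integ_ge0 => x; rewrite addr_ge0 ?sqr_ge0.
rewrite /L2norm unlock /Lnorm -poweR_EFin -integE//; congr (_ `^ _)%E.
apply: eq_integral => x _ /=.
by rewrite ger0_norm ?normc_ge0// powR_mulrn ?normc_ge0// normc_sqr.
Qed.

Lemma L2norm_cvg0 (u_ : nat -> R -> R[i]) :
  (forall n, square_summable (fun x => Re (u_ n x))) ->
  (forall n, square_summable (fun x => Im (u_ n x))) ->
  L2norm (u_ n) @[n --> \oo] --> 0%E ->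
  integ (fun x => Re (u_ n x) ^+ 2) @[n --> \oo] --> (0 : R) /\
  integ (fun x => Im (u_ n x) ^+ 2) @[n --> \oo] --> (0 : R).
Proof.
move=> Lr Li H.
have {}H : integ (fun x => Re (u_ n x) ^+ 2) + integ (fun x => Im (u_ n x) ^+ 2)
    @[n --> \oo] --> (0 : R).
  have -> : (fun n => integ (fun x => Re (u_ n x) ^+ 2) + integ (fun x => Im (u_ n x) ^+ 2))
     = (fun n => fine (L2norm (u_ n)) * fine (L2norm (u_ n))).
    apply/funext => n; rewrite L2normE// -expr2 sqr_sqrtr//.
    by rewrite addr_ge0 ?integ_ge0// => x; exact: sqr_ge0.
  rewrite -[X in _ --> X](mulr0 0); apply: cvgM; exact: (fine_cvg H).
by split; apply: (squeeze_cvgr _ (cvg_cst 0) H); apply: nearW => n;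
  rewrite integ_ge0/= ?lerDl ?lerDr ?integ_ge0// => x; rewrite sqr_ge0.
Qed.

(** The shape of the hypothesis comes from [(a + b) ^+ 2 <= 2 * a ^+ 2 + 2 * b ^+ 2], applied to a
    limit in L^2 and its approximations. *)
Lemma le_cvg0 (s t : R^nat) (x c : R) : s @ \oo --> (0 : R) -> t @ \oo --> (0 : R) ->
  (forall n, x <= 2 * s n + 2 * t n + c) -> x <= c.
Proof.
move=> s0 t0 H; rewrite leNgt; apply/negP => cx.
pose e := (x - c) / 4; have e0 : 0 < e by rewrite divr_gt0// subr_gt0.
have [n [sn tn]] : exists n, `|0 - s n| < e /\ `|0 - t n| < e.
  have : \forall n \near \oo, `|0 - s n| < e /\ `|0 - t n| < e.
    by apply: filterI; [move/cvgrPdist_lt: s0; exact|move/cvgrPdist_lt: t0; exact].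
  by move=> [N _ HN]; exists N; apply: HN => /=.
move: sn tn; rewrite !sub0r !normrN => /(le_lt_trans (ler_norm _)) sn /(le_lt_trans (ler_norm _)) tn.
by have := H n; move: sn tn; rewrite /e; lra.
Qed.

Lemma integ_cvg0_mul (f_ : nat -> R -> R) g : (forall n, square_summable (f_ n)) ->
  square_summable g -> integ (fun x => f_ n x ^+ 2) @[n --> \oo] --> (0 : R) ->
  integ (fun x => f_ n x * g x) @[n --> \oo] --> (0 : R).
Proof.
move=> Lf Lg H; apply/cvgrPdist_lt => e e0.
pose G := integ (fun x => g x ^+ 2).
have G0 : 0 <= G by apply: integ_ge0 => x; exact: sqr_ge0.
(* With this parameter the fixed factor contributes less than [e / 2] whatever [n] is; the [+ 1]
   covers [G = 0]. *)
pose t := 2 * (G + 1) / e; have t0 : 0 < t.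
  by rewrite divr_gt0// mulr_gt0// ltr_wpDl.
have e2 : 0 < e / 2 / t by rewrite divr_gt0// divr_gt0.
move/cvgrPdist_lt : H => /(_ _ e2); apply: filterS => n.
rewrite !sub0r !normrN ger0_norm; last by apply: integ_ge0 => x; exact: sqr_ge0.
move=> Hn; apply: (le_lt_trans (integ_norm (square_summableM (Lf n) Lg))).
apply: (le_lt_trans (integ_mul_le t0 (Lf n) Lg)).
have h1 : t * integ (fun x => f_ n x ^+ 2) < e / 2.
  by move: Hn; rewrite ltr_pdivlMr// mulrC.
have h2 : t^-1 * G < e / 2.
  rewrite mulrC ltr_pdivrMr// /t.
  have -> : e / 2 * (2 * (G + 1) / e) = G + 1 by field; rewrite gt_eqF.
  lra.
by rewrite -/G; lra.
Qed.

End L2Components.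

(** * Truncated Fourier integrals, Plancherel bound and uniqueness *)

Section FourierComponents.
Variable R : realType.
Local Notation mu := (@lebesgue_measure R).
Implicit Types (u v U V : R -> R[i]) (a b f g : R -> R).
Local Notation Re := complex.Re.
Local Notation Im := complex.Im.

(** Truncation makes a square summable function integrable, so that its Fourier integral converges;
    [fourier_trunc] is expressed through such truncations in [fourier_truncE]. *)
Definition cut a (N : R) x : R := a x * \1_(`[- N, N]%classic) x.

Lemma cut_le a N x : `|cut a N x| <= `|a x|.
Proof. by rewrite /cut indicE normrM ler_piMr// normr_nat; case: (_ \in _). Qed.

Lemma measurable_cut a N : measurable_fun setT a -> measurable_fun setT (cut a N).
Proof.
move=> ma; exact: measurable_funM.
Qed.

Lemma square_summable_cut a N : square_summable a -> square_summable (cut a N).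
Proof.
move=> La; apply: (square_summable_le _ La); last exact: cut_le.
by apply: measurable_cut; case: La.
Qed.

Lemma summable1_cut a N : square_summable a -> summable1 (cut a N).
Proof.
move=> La; apply: square_summableM => //; split.
  exact: measurable_indic.
have : summable1 (\1_(`[- N, N]%classic) : R -> R) by exact: integrable_indic_itv.
by apply: eq_summable1 => x; rewrite indicE; case: (_ \in _); rewrite ?expr1n// expr0n.
Qed.

Lemma integ_cut_sqr a N : square_summable a ->
  integ (fun x => cut a N x ^+ 2) <= integ (fun x => a x ^+ 2).
Proof.
move=> La; have [_ s] := square_summable_cut N La; case: La => [_ sa].
apply: integ_le => // x; rewrite -[leLHS]real_normK ?num_real//.
by rewrite -[leRHS]real_normK ?num_real// lerXn2r ?nnegrE// cut_le.
Qed.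

Lemma cut_cvg a x : cut a n%:R x @[n --> \oo] --> a x.
Proof.
apply: cvg_near_cst; near=> n; rewrite /cut indicE mem_set ?mulr1//=.
rewrite in_itv/= -ler_norml.
by near: n; exact: nbhs_infty_ger.
Unshelve. all: by end_near. Qed.

Lemma Rintegral_cut a (N : R) : Rintegral mu `[- N, N] a = integ (cut a N).
Proof.
rewrite Rintegral_mkcond; apply: eq_integ => x.
by rewrite /cut patchE indicE; case: ifP; rewrite ?mulr1 ?mulr0.
Qed.

Lemma fourier_truncE u N xi : square_summable (fun x => Re (u x)) ->
  square_summable (fun x => Im (u x)) ->
  fourier_trunc u N xi =
   (fourier_cos (cut (fun x => Re (u x)) N) xi + fourier_sin (cut (fun x => Im (u x)) N) xi)
   +i* (fourier_cos (cut (fun x => Im (u x)) N) xi - fourier_sin (cut (fun x => Re (u x)) N) xi).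
Proof.
move=> Lr Li; rewrite /fourier_trunc /cintegral !Rintegral_cut.
have sr := summable1_cut N Lr; have si := summable1_cut N Li.
congr Complex.
- rewrite -integD; [|exact: summable1_cosM|exact: summable1_sinM].
  apply: eq_integ => x; rewrite /cut (mulrC xi); case: (u x) => a b /=; ring.
- rewrite -integB; [|exact: summable1_cosM|exact: summable1_sinM].
  apply: eq_integ => x; rewrite /cut (mulrC xi); case: (u x) => a b /=; ring.
Qed.

Lemma square_summable_trunc u N : in_L2 u ->
  square_summable (fun xi => Re (fourier_trunc u N xi)) /\
  square_summable (fun xi => Im (fourier_trunc u N xi)).
Proof.
move=> /in_L2P[Lr Li].
have [cr sr _] := bessel_fourier (summable1_cut N Lr) (square_summable_cut N Lr).
have [ci si _] := bessel_fourier (summable1_cut N Li) (square_summable_cut N Li).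
split; (under eq_fun do rewrite fourier_truncE//=).
  exact: square_summableD.
exact: square_summableB.
Qed.

Lemma is_fourier_cvg u U : is_fourier u U ->
  integ (fun xi => (Re (U xi) - Re (fourier_trunc u n%:R xi)) ^+ 2) @[n --> \oo] --> (0 : R) /\
  integ (fun xi => (Im (U xi) - Im (fourier_trunc u n%:R xi)) ^+ 2) @[n --> \oo] --> (0 : R).
Proof.
move=> [Lu LU H].
have [LUr LUi] := (in_L2P U).1 LU.
have LT n := square_summable_trunc n%:R Lu.
have ReB (x y : R[i]) : Re (x - y) = Re x - Re y by case: x y => ? ? [].
have ImB (x y : R[i]) : Im (x - y) = Im x - Im y by case: x y => ? ? [].
have [] := @L2norm_cvg0 _ (fun n xi => U xi - fourier_trunc u n%:R xi) _ _ H.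
- move=> n; under eq_fun do rewrite ReB; apply: square_summableB => //.
  by case: (LT n).
- move=> n; under eq_fun do rewrite ImB; apply: square_summableB => //.
  by case: (LT n).
by split; [under eq_fun do under eq_integ do rewrite -ReB|
           under eq_fun do under eq_integ do rewrite -ImB].
Qed.

Let plancherel_arith (A B dA dB tA tB c1 s1 c2 s2 k1 k2 I1 I2 p : R) :
  A <= 2 * dA + 2 * tA -> B <= 2 * dB + 2 * tB ->
  tA <= 2 * c1 + 2 * s2 -> tB <= 2 * c2 + 2 * s1 ->
  c1 + s1 <= 2 * p * k1 -> c2 + s2 <= 2 * p * k2 ->
  2 * p * k1 <= 2 * p * I1 -> 2 * p * k2 <= 2 * p * I2 ->
  0 <= p * I1 -> 0 <= p * I2 ->
  A + B <= 2 * dA + 2 * dB + 16 * p * (I1 + I2).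
Proof. lra. Qed.

(** Bessel's inequality for the truncations, passed to the limit in L^2. The constant exceeds the
    sharp [2 * pi] because squares of sums are split twice; later only its finiteness matters. *)
Lemma plancherel_le u U : is_fourier u U ->
  integ (fun xi => Re (U xi) ^+ 2) + integ (fun xi => Im (U xi) ^+ 2)
  <= 16 * pi * (integ (fun x => Re (u x) ^+ 2) + integ (fun x => Im (u x) ^+ 2)).
Proof.
move=> uU; have [cr ci] := is_fourier_cvg uU.
have [Lu LU _] := uU.
have [Lr Li] := (in_L2P u).1 Lu.
have [LUr LUi] := (in_L2P U).1 LU.
set C := (X in _ <= X).
suff : forall n, integ (fun xi => Re (U xi) ^+ 2) + integ (fun xi => Im (U xi) ^+ 2) <=
   2 * integ (fun xi => (Re (U xi) - Re (fourier_trunc u n%:R xi)) ^+ 2)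
   + 2 * integ (fun xi => (Im (U xi) - Im (fourier_trunc u n%:R xi)) ^+ 2) + C.
  exact: le_cvg0 cr ci.
move=> n; have [LTr LTi] := square_summable_trunc n%:R Lu.
have sqr_split f g : square_summable f -> square_summable g ->
    integ (fun x => f x ^+ 2) <=
      2 * integ (fun x => (f x - g x) ^+ 2) + 2 * integ (fun x => g x ^+ 2).
  move=> Lf Lg; apply: le_trans (integ_sqrD (square_summableB Lf Lg) Lg).
  by under [leRHS]eq_integ do rewrite subrK.
have h1 := sqr_split _ _ LUr LTr; have h2 := sqr_split _ _ LUi LTi.
have [cr2 sr2 Br] := bessel_fourier (summable1_cut n%:R Lr) (square_summable_cut n%:R Lr).
have [ci2 si2 Bi] := bessel_fourier (summable1_cut n%:R Li) (square_summable_cut n%:R Li).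
have h3 : integ (fun xi => Re (fourier_trunc u n%:R xi) ^+ 2) <= 
   2 * integ (fun xi => fourier_cos (cut (fun x => Re (u x)) n%:R) xi ^+ 2) +
   2 * integ (fun xi => fourier_sin (cut (fun x => Im (u x)) n%:R) xi ^+ 2).
  under eq_integ do rewrite fourier_truncE//=.
  exact: integ_sqrD.
have h4 : integ (fun xi => Im (fourier_trunc u n%:R xi) ^+ 2) <= 
   2 * integ (fun xi => fourier_cos (cut (fun x => Im (u x)) n%:R) xi ^+ 2) +
   2 * integ (fun xi => fourier_sin (cut (fun x => Re (u x)) n%:R) xi ^+ 2).
  under eq_integ do rewrite fourier_truncE//=.
  have := integ_sqrD ci2 (square_summableZ (-1) sr2).
  under eq_integ do rewrite mulN1r.
  have -> : integ (fun x => (-1 * fourier_sin (cut (fun x => Re (u x)) n%:R) x) ^+ 2) =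
      integ (fun x => fourier_sin (cut (fun x => Re (u x)) n%:R) x ^+ 2).
    by apply: eq_integ => x; rewrite mulN1r sqrrN.
  by [].
have cutr := integ_cut_sqr n%:R Lr; have cuti := integ_cut_sqr n%:R Li.
have p0 : 0 <= pi :> R by exact: pi_ge0.
have q1 : 2 * pi * integ (fun x => cut (fun x => Re (u x)) n%:R x ^+ 2) <=
   2 * pi * integ (fun x => Re (u x) ^+ 2) by rewrite ler_wpM2l// mulr_ge0.
have q2 : 2 * pi * integ (fun x => cut (fun x => Im (u x)) n%:R x ^+ 2) <=
   2 * pi * integ (fun x => Im (u x) ^+ 2) by rewrite ler_wpM2l// mulr_ge0.
have e0 : 0 <= pi * integ (fun x => Re (u x) ^+ 2).
  by rewrite mulr_ge0// integ_ge0// => x; exact: sqr_ge0.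
have e1 : 0 <= pi * integ (fun x => Im (u x) ^+ 2).
  by rewrite mulr_ge0// integ_ge0// => x; exact: sqr_ge0.
exact: (plancherel_arith h1 h2 h3 h4 Br Bi q1 q2 e0 e1).
Qed.

Lemma integ_sqr_eq0_ae f : square_summable f -> integ (fun x => f x ^+ 2) <= 0 ->
  {ae mu, forall x, f x = 0}.
Proof.
move=> [mf sf] If.
have H0 : (\int[mu]_x `|(f x ^+ 2)%:E| = 0)%E.
  under eq_integral do rewrite gee0_abs ?lee_fin ?sqr_ge0//.
  rewrite integE//; congr EFin; apply/eqP; rewrite eq_le If/=.
  by apply: integ_ge0 => x; exact: sqr_ge0.
have mf2 : measurable_fun setT (fun x => (f x ^+ 2)%:E).
  by apply/measurable_EFinP; exact: measurable_funX.
have := (ae_eq_integral_abs mu measurableT mf2).1 H0.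
apply: filterS => x /(_ I) [] /eqP.
by rewrite sqrf_eq0 => /eqP.
Qed.

(** Both are limits in L^2 of the same truncated integrals. *)
Lemma fourier_unique u U V : is_fourier u U -> is_fourier u V ->
  {ae mu, forall xi, U xi = V xi}.
Proof.
move=> uU uV; have [cr ci] := is_fourier_cvg uU; have [dr di] := is_fourier_cvg uV.
have [Lu LU _] := uU; have [_ LV _] := uV.
have [LUr LUi] := (in_L2P U).1 LU.
have [LVr LVi] := (in_L2P V).1 LV.
have key (f g : R -> R) (T : nat -> R -> R) : square_summable f -> square_summable g ->
    (forall n, square_summable (T n)) ->
    integ (fun xi => (f xi - T n xi) ^+ 2) @[n --> \oo] --> (0 : R) ->
    integ (fun xi => (g xi - T n xi) ^+ 2) @[n --> \oo] --> (0 : R) ->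
    {ae mu, forall xi, f xi - g xi = 0}.
  move=> Lf Lg LT Tf Tg; apply: integ_sqr_eq0_ae; first exact: square_summableB.
  apply: (le_cvg0 Tf Tg) => n; rewrite addr0.
  have := integ_sqrD (square_summableB Lf (LT n)) (square_summableZ (-1) (square_summableB Lg (LT n))).
  have -> : integ (fun x => (f x - T n x + -1 * (g x - T n x)) ^+ 2) =
            integ (fun x => (f x - g x) ^+ 2).
    by apply: eq_integ => x; congr (_ ^+ 2); ring.
  have E0 : integ (fun x => (-1 * (g x - T n x)) ^+ 2) = integ (fun x => (g x - T n x) ^+ 2).
    by apply: eq_integ => x; rewrite mulN1r sqrrN.
  by rewrite E0.
have H1 := key _ _ _ LUr LVr (fun n => (square_summable_trunc n%:R Lu).1) cr dr.
have H2 := key _ _ _ LUi LVi (fun n => (square_summable_trunc n%:R Lu).2) ci di.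
apply: (@filterS2 _ _ (ae_filter_ringOfSetsType mu) _ _ _ _ H1 H2) => xi.
by case: (U xi) (V xi) => a b [c d] /= /subr0_eq -> /subr0_eq ->.
Qed.

End FourierComponents.

(** * Fourier inversion by Abel means *)

Section FourierInversion.
Variable R : realType.
Local Notation mu := (@lebesgue_measure R).
Implicit Types (u v U V : R -> R[i]) (a b f g : R -> R) (e x : R).
Local Notation Re := complex.Re.
Local Notation Im := complex.Im.

(** Up to sign, the imaginary part of the Abel mean of the inverse transform of a real function:
    after Fubini it pairs [b] with the sine transform of the even weight, which is zero. *)
Lemma abel_mean_fourier_conj b e x : 0 < e -> summable1 b ->
  integ (fun xi => abel_weight e xi * fourier_sin b xi * cos (x * xi)
                 - abel_weight e xi * fourier_cos b xi * sin (x * xi)) = 0.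
Proof.
move=> e0 sb; have sw := summable1_abel_weight e0.
have sc := summable1_cosM x sw; have ss := summable1_sinM x sw.
have swc : summable1 (fun xi => abel_weight e xi * fourier_cos b xi).
  apply: (summable1M (measurable_fourier_cos sb) _ sw) => xi.
  exact: fourier_cos_le.
have sws : summable1 (fun xi => abel_weight e xi * fourier_sin b xi).
  apply: (summable1M (measurable_fourier_sin sb) _ sw) => xi.
  exact: fourier_sin_le.
rewrite integB; [|exact: summable1_cosM|exact: summable1_sinM].
have -> : integ (fun xi => abel_weight e xi * fourier_sin b xi * cos (x * xi)) =
    integ (fun y => b y * integ (fun xi => abel_weight e xi * cos (x * xi) * sin (xi * y))).
  rewrite -(@fubini_kernel _ (fun xi => abel_weight e xi * cos (x * xi)) b
    (fun z => sin (z.1 * z.2)) 1) => //; last by move=> z; exact: sin_bounded1.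
    by apply: eq_integ => xi; rewrite /fourier_sin; ring.
  exact: measurable_sin_mul.
have -> : integ (fun xi => abel_weight e xi * fourier_cos b xi * sin (x * xi)) =
    integ (fun y => b y * integ (fun xi => abel_weight e xi * sin (x * xi) * cos (xi * y))).
  rewrite -(@fubini_kernel _ (fun xi => abel_weight e xi * sin (x * xi)) b
    (fun z => cos (z.1 * z.2)) 1) => //; last by move=> z; exact: cos_bounded1.
    by apply: eq_integ => xi; rewrite /fourier_cos; ring.
  exact: measurable_cos_mul.
have E y : integ (fun xi => abel_weight e xi * cos (x * xi) * sin (xi * y)) =
           integ (fun xi => abel_weight e xi * sin (x * xi) * cos (xi * y)).
  apply/eqP; rewrite -subr_eq0; apply/eqP; rewrite -integB; last 2 first.
  - by under eq_fun do rewrite (mulrC _ y); exact: summable1_sinM.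
  - by under eq_fun do rewrite (mulrC _ y); exact: summable1_cosM.
  rewrite -(integ_abel_sin (y - x) e0); apply: eq_integ => xi.
  by rewrite mulrBl sinB (mulrC xi); ring.
by apply/eqP; rewrite subr_eq0; apply/eqP; apply: eq_integ => y; rewrite E.
Qed.

Lemma square_summable_abel_weight e : 0 < e -> square_summable (abel_weight e : R -> R).
Proof.
move=> e0; split; first by apply: measurable_contR; exact: cont_abel_weight.
have : summable1 (abel_weight (2 * e) : R -> R) by apply: summable1_abel_weight; rewrite mulr_gt0.
apply: eq_summable1 => x; rewrite /abel_weight expr2 -expRD; congr expR; ring.
Qed.

Lemma square_summable_abel_cos e x : 0 < e ->
  square_summable (fun xi => abel_weight e xi * cos (x * xi)).
Proof.
move=> e0; apply: (square_summable_le _ (square_summable_abel_weight e0)).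
  by apply: measurable_contR; apply: contM; [exact: cont_abel_weight|exact: cont_cosM].
by move=> xi; rewrite normrM ler_piMr// cos_bounded1.
Qed.

Lemma square_summable_abel_sin e x : 0 < e ->
  square_summable (fun xi => abel_weight e xi * sin (x * xi)).
Proof.
move=> e0; apply: (square_summable_le _ (square_summable_abel_weight e0)).
  by apply: measurable_contR; apply: contM; [exact: cont_abel_weight|exact: cont_sinM].
by move=> xi; rewrite normrM ler_piMr// sin_bounded1.
Qed.

Lemma summable1_abel_diff e x : 0 < e -> summable1 (fun y => abel_kernel e (x - y)).
Proof.
move=> e0; under eq_fun do rewrite abel_kernelC.
by apply: summable1_shift; [exact: cont_abel_kernel|exact: summable1_abel_kernel].
Qed.

Lemma integ_abel_diff e x : 0 < e -> integ (fun y => abel_kernel e (x - y)) = 2 * pi.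
Proof.
move=> e0; under eq_integ do rewrite abel_kernelC.
rewrite integ_shift ?integ_abel_kernel//; first exact: cont_abel_kernel.
exact: summable1_abel_kernel.
Qed.

Lemma square_summable_abel_diff e x : 0 < e ->
  square_summable (fun y => abel_kernel e (x - y)).
Proof.
move=> e0; have mk := measurable_kernel_sec1 (measurable_abel_diff e0) x.
split => //; have := summable1M mk _ (summable1_abel_diff x e0).
move=> /(_ (2 / e)) H; apply: eq_summable1 (H _) => [y|y]; first by rewrite expr2.
exact: (abel_diff_bounded e0 (x, y)).
Qed.

Lemma integ_cut_cvg a e x : 0 < e -> square_summable a ->
  integ (fun y => cut a n%:R y * abel_kernel e (x - y)) @[n --> \oo]
  --> integ (fun y => a y * abel_kernel e (x - y)).
Proof.
move=> e0 La; have mk := measurable_kernel_sec1 (measurable_abel_diff e0) x.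
have sk := square_summableM La (square_summable_abel_diff x e0).
have [ma _] := La.
have [] // := @dominated_integ _ (fun n y => cut a n%:R y * abel_kernel e (x - y))
  (fun y => a y * abel_kernel e (x - y)) (fun y => `|a y * abel_kernel e (x - y)|).
- by move=> n; apply: measurable_funM => //; exact: measurable_cut.
- exact: measurable_funM.
- exact: summable1_norm.
- by move=> n y; rewrite [leLHS]normrM [leRHS]normrM ler_wpM2r// cut_le.
- by move=> y; apply: cvgM; [exact: cut_cvg|exact: cvg_cst].
Qed.

Lemma integ_trunc_cvg u U g : is_fourier u U -> square_summable g ->
  integ (fun xi => Re (fourier_trunc u n%:R xi) * g xi) @[n --> \oo]
    --> integ (fun xi => Re (U xi) * g xi) /\
  integ (fun xi => Im (fourier_trunc u n%:R xi) * g xi) @[n --> \oo]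
    --> integ (fun xi => Im (U xi) * g xi).
Proof.
move=> uU Lg; have [cr ci] := is_fourier_cvg uU.
have [Lu LU _] := uU.
have [LUr LUi] := (in_L2P U).1 LU.
have LT n := square_summable_trunc n%:R Lu.
have key (f : R -> R) (T : nat -> R -> R) : square_summable f ->
    (forall n, square_summable (T n)) ->
    integ (fun xi => (f xi - T n xi) ^+ 2) @[n --> \oo] --> (0 : R) ->
    integ (fun xi => T n xi * g xi) @[n --> \oo] --> integ (fun xi => f xi * g xi).
  move=> Lf LTn H.
  have := integ_cvg0_mul (fun n => square_summableB Lf (LTn n)) Lg H.
  have -> : (fun n => integ (fun x => (f x - T n x) * g x)) =
     (fun n => integ (fun x => f x * g x) - integ (fun x => T n x * g x)).
    apply/funext => n; rewrite -integB; try exact: square_summableM.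
    by apply: eq_integ => x; rewrite mulrBl.
  move=> /cvgrPdist_lt K; apply/cvgrPdist_lt => e /K; apply: filterS => n.
  by rewrite sub0r normrN.
split.
  exact: (key _ (fun n xi => Re (fourier_trunc u n%:R xi)) LUr (fun n => (LT n).1) cr).
exact: (key _ (fun n xi => Im (fourier_trunc u n%:R xi)) LUi (fun n => (LT n).2) ci).
Qed.

(** For truncations of [u] both identities follow from Fubini. When the truncation is removed, the
    left side converges because the truncated transforms converge in L^2 and are paired with a
    function of L^2, and the right side by dominated convergence. *)
Lemma abel_mean_is_fourier u U e x : 0 < e -> is_fourier u U ->
  integ (fun xi => abel_weight e xi * (Re (U xi) * cos (x * xi) - Im (U xi) * sin (x * xi)))
    = integ (fun y => Re (u y) * abel_kernel e (x - y)) /\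
  integ (fun xi => abel_weight e xi * (Re (U xi) * sin (x * xi) + Im (U xi) * cos (x * xi)))
    = integ (fun y => Im (u y) * abel_kernel e (x - y)).
Proof.
move=> e0 uU; have Lc := square_summable_abel_cos x e0; have Ls := square_summable_abel_sin x e0.
have [cr ci] := integ_trunc_cvg uU Lc; have [sr si] := integ_trunc_cvg uU Ls.
have [Lu LU _] := uU.
have [Lr Li] := (in_L2P u).1 Lu.
have [LUr LUi] := (in_L2P U).1 LU.
have kr := integ_cut_cvg (x := x) e0 Lr; have ki := integ_cut_cvg (x := x) e0 Li.
have LT n := square_summable_trunc n%:R Lu.
have wc f : square_summable f -> summable1 (fun xi => abel_weight e xi * f xi).
  by move=> Lf; apply: square_summableM => //; exact: square_summable_abel_weight.
have sw := summable1_abel_weight e0.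
split.
- have := cvgB cr si; rewrite -[X in _ --> X]integB; try exact: square_summableM.
  have -> : (fun n => integ (fun xi => Re (fourier_trunc u n%:R xi) * (abel_weight e xi * cos (x * xi))))
     - (fun n => integ (fun xi => Im (fourier_trunc u n%:R xi) * (abel_weight e xi * sin (x * xi))))
     = (fun n => integ (fun y => cut (fun y => Re (u y)) n%:R y * abel_kernel e (x - y))).
    apply/funext => n; rewrite fctE -integB; last 2 first.
    - by apply: square_summableM => //; case: (LT n).
    - by apply: square_summableM => //; case: (LT n).
    have sr' := summable1_cut n%:R Lr; have si' := summable1_cut n%:R Li.
    rewrite -abel_mean_fourier// -[LHS]addr0 -(abel_mean_fourier_conj x e0 si').
    have [fc fs _] := bessel_fourier sr' (square_summable_cut n%:R Lr).
    have [gc gs _] := bessel_fourier si' (square_summable_cut n%:R Li).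
    rewrite -[LHS]subr0 -[RHS]subr0; congr (_ - _).
    rewrite (abel_mean_fourier_conj x e0 si') addr0.
    (* The part of the transform that comes from [Im u] enters as an integral which vanishes by
       [abel_mean_fourier_conj]. *)
    rewrite -[RHS]addr0 -(abel_mean_fourier_conj x e0 si') -integD.
    - by apply: eq_integ => xi; rewrite fourier_truncE//=; ring.
    - by apply: summable1D; [exact: summable1_cosM (wc _ fc)|exact: summable1_sinM (wc _ fs)].
    - by apply: summable1B; [exact: summable1_cosM (wc _ gs)|exact: summable1_sinM (wc _ gc)].
  move=> /(_ _) K; rewrite -(cvg_unique _ K kr)//.
  by apply: eq_integ => xi; ring.
- have := cvgD sr ci; rewrite -[X in _ --> X]integD; try exact: square_summableM.
  have -> : (fun n => integ (fun xi => Re (fourier_trunc u n%:R xi) * (abel_weight e xi * sin (x * xi))))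
     + (fun n => integ (fun xi => Im (fourier_trunc u n%:R xi) * (abel_weight e xi * cos (x * xi))))
     = (fun n => integ (fun y => cut (fun y => Im (u y)) n%:R y * abel_kernel e (x - y))).
    apply/funext => n; rewrite fctE -integD; last 2 first.
    - by apply: square_summableM => //; case: (LT n).
    - by apply: square_summableM => //; case: (LT n).
    have sr' := summable1_cut n%:R Lr; have si' := summable1_cut n%:R Li.
    have [fc fs _] := bessel_fourier sr' (square_summable_cut n%:R Lr).
    have [gc gs _] := bessel_fourier si' (square_summable_cut n%:R Li).
    rewrite -abel_mean_fourier// -[RHS]subr0 -(abel_mean_fourier_conj x e0 sr') -integB.
    - by apply: eq_integ => xi; rewrite fourier_truncE//=; ring.
    - by apply: summable1D; [exact: summable1_cosM (wc _ gc)|exact: summable1_sinM (wc _ gs)].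
    - by apply: summable1B; [exact: summable1_cosM (wc _ fs)|exact: summable1_sinM (wc _ fc)].
  move=> /(_ _) K; rewrite -(cvg_unique _ K ki)//.
  by apply: eq_integ => xi; ring.
Qed.

Let en n : R := n.+1%:R^-1.
Let en0 n : 0 < en n. Proof. by rewrite invr_gt0. Qed.

(** Away from the diagonal the kernel of scale [e] is [O(e)] times the kernel of scale 1, so the far
    part of a convolution is [e] times an integral that does not depend on [e]. *)
Lemma abel_kernel_far e eta t : 0 < e -> 0 < eta -> eta <= `|t| ->
  abel_kernel e t <= e * (1 + eta ^- 2) * abel_kernel 1 t.
Proof.
move=> e0 eta0 et; rewrite /abel_kernel.
have t2 : eta ^+ 2 <= t ^+ 2 by rewrite -[t ^+ 2]real_normK ?num_real// lerXn2r// nnegrE ltW.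
have eta2 : 0 < eta ^+ 2 by rewrite exprn_gt0.
have d0 := abel_denom_gt0 t e0.
rewrite expr1n ler_pdivrMr//.
have -> : e * (1 + eta ^- 2) * (2 * 1 / (1 + t ^+ 2)) * (e ^+ 2 + t ^+ 2) =
   2 * e * ((1 + eta ^- 2) * (e ^+ 2 + t ^+ 2) / (1 + t ^+ 2)).
  by field; rewrite !gt_eqF// ltr_wpDr ?sqr_ge0.
rewrite ler_peMr ?mulr_ge0 ?(ltW e0)// ler_pdivlMr ?ltr_wpDr ?sqr_ge0// mul1r.
have : 1 <= eta ^- 2 * t ^+ 2 by rewrite mulrC ler_pdivlMr// mul1r.
have : 0 <= eta ^- 2 * e ^+ 2 by rewrite mulr_ge0 ?invr_ge0 ?sqr_ge0// ltW.
have := sqr_ge0 e; lra.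
Qed.

(** The kernel is an approximate identity: continuity of [a] at [x] handles [|x - y| < eta], and
    [abel_kernel_far] handles the rest, where [a] is merely square summable. *)
Lemma abel_approximation a x : continuous (a : R -> R) -> square_summable a ->
  integ (fun y => a y * abel_kernel (en n) (x - y)) @[n --> \oo] --> 2 * pi * a x.
Proof.
move=> ca La; apply/cvgrPdist_le => d d0.
have p0 : 0 < pi :> R by exact: pi_gt0.
(* The kernel has mass [2 * pi], so the near part contributes at most [d / 2]. *)
pose d1 := d / (4 * pi); have d10 : 0 < d1 by rewrite divr_gt0// mulr_gt0.
have [eta /= eta0 Heta] : \forall y \near nbhs x, `|a x - a y| < d1.
  by move: (ca x) => /cvgrPdist_lt; apply.
have lone : 0 < 1 :> R by [].
have S1 : summable1 (fun y => (`|a y| + `|a x|) * abel_kernel 1 (x - y)).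
  under eq_fun do rewrite mulrDl; apply: summable1D.
    apply: eq_summable1 (summable1_norm (square_summableM La (square_summable_abel_diff x lone))) => y.
    by rewrite normrM [`|abel_kernel _ _|]ger0_norm ?abel_kernel_ge0.
  exact/summable1Z/summable1_abel_diff.
pose D := (1 + eta ^- 2) * integ (fun y => (`|a y| + `|a x|) * abel_kernel 1 (x - y)).
have D0 : 0 <= D.
  rewrite mulr_ge0 ?addr_ge0 ?invr_ge0 ?sqr_ge0//.
  by apply: integ_ge0 => y; rewrite mulr_ge0 ?abel_kernel_ge0 ?addr_ge0.
have H : forall n, `|2 * pi * a x - integ (fun y => a y * abel_kernel (en n) (x - y))| <=
    d / 2 + en n * D.
  move=> n; have e0 := en0 n.
  have sk := summable1_abel_diff x e0.
  have sak := square_summableM La (square_summable_abel_diff x e0).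
  rewrite -(integ_abel_diff x e0) mulrC -integZ// -integB//; last exact: summable1Z.
  have -> : d / 2 = d1 * (2 * pi).
    by rewrite /d1; move: p0; generalize (pi : R) => q q0; field; rewrite gt_eqF.
  rewrite -(integ_abel_diff x e0) -integZ// /D mulrA -integZ// -integD//; last 2 first.
  - exact: summable1Z.
  - exact: summable1Z.
  apply: integ_norm_le.
  - by apply: summable1B => //; exact: summable1Z.
  - by apply: summable1D; exact: summable1Z.
  move=> y; rewrite -mulrBl normrM [`|abel_kernel _ _|]ger0_norm ?abel_kernel_ge0//.
  have k1 : 0 <= abel_kernel 1 (x - y) by exact: abel_kernel_ge0.
  have c0 : 0 <= en n * (1 + eta ^- 2).
    by rewrite mulr_ge0 ?(ltW e0)// addr_ge0// invr_ge0 sqr_ge0.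
  have [near_|far_] := ltP `|x - y| eta.
    rewrite -[leLHS]addr0 lerD//; first by rewrite ler_wpM2r ?abel_kernel_ge0// ltW// Heta.
    by rewrite mulr_ge0// mulr_ge0// addr_ge0.
  rewrite -[leLHS]add0r; apply: lerD; first by rewrite mulr_ge0 ?abel_kernel_ge0// ltW.
  apply: (@le_trans _ _ ((`|a y| + `|a x|) * (en n * (1 + eta ^- 2) * abel_kernel 1 (x - y)))).
    apply: ler_pM => //; first exact: abel_kernel_ge0.
      by rewrite (le_trans (ler_normB _ _))// addrC.
    exact: abel_kernel_far.
  by rewrite mulrCA mulrA.
have K : en n * D @[n --> \oo] --> (0 : R).
  by rewrite -(mul0r D); apply: cvgM; [exact: cvg_harmonic|exact: cvg_cst].
have d20 : 0 < d / 2 by rewrite divr_gt0.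
move/cvgrPdist_le : K => /(_ _ d20); apply: filterS => n.
rewrite sub0r normrN => Kn; apply: (le_trans (H n)).
have := le_trans (ler_norm _) Kn; lra.
Qed.

Lemma abel_mean_cvg g : summable1 g ->
  integ (fun xi => abel_weight (en n) xi * g xi) @[n --> \oo] --> integ g.
Proof.
move=> sg; have mg := summable1_mfun sg.
have [] // := @dominated_integ _ (fun n xi => abel_weight (en n) xi * g xi) g (fun xi => `|g xi|).
- move=> n; apply: measurable_funM => //.
  by apply: measurable_contR; exact: cont_abel_weight.
- exact: summable1_norm.
- move=> n x; rewrite normrM ler_piMl// ger0_norm ?abel_weight_ge0//.
  by rewrite abel_weight_le1// ltW.
- move=> x; rewrite -[X in _ --> X]mul1r; apply: cvgM; last exact: cvg_cst.
  rewrite -expR0 -oppr0 -(mul0r `|x|).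
  apply: (@cvg_comp _ _ _ (fun n => - (en n * `|x|)) expR _ (nbhs (- (0 * `|x|)))).
    by apply: cvgN; apply: cvgM; [exact: cvg_harmonic|exact: cvg_cst].
  exact: continuous_expR.
Qed.

(** Both sides of [abel_mean_is_fourier] are followed as [e] tends to 0: integrability of [U] gives
    the limit of one, continuity of [u] the limit of the other at every point [x]. *)
Theorem fourier_inversion u U x : is_fourier u U ->
  continuous (fun y => Re (u y) : R) -> continuous (fun y => Im (u y) : R) ->
  summable1 (fun xi => Re (U xi)) -> summable1 (fun xi => Im (U xi)) ->
  2 * pi * Re (u x) =
    integ (fun xi => Re (U xi) * cos (x * xi) - Im (U xi) * sin (x * xi)) /\
  2 * pi * Im (u x) =
    integ (fun xi => Re (U xi) * sin (x * xi) + Im (U xi) * cos (x * xi)).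
Proof.
move=> uU cr ci sr si; have [Lu _ _] := uU.
have [Lr Li] := (in_L2P u).1 Lu.
split.
- have s : summable1 (fun xi => Re (U xi) * cos (x * xi) - Im (U xi) * sin (x * xi)).
    by apply: summable1B; [exact: summable1_cosM|exact: summable1_sinM].
  have K := abel_mean_cvg s; have L := abel_approximation (x := x) cr Lr.
  have E : (fun n => integ (fun xi => abel_weight (en n) xi *
      (Re (U xi) * cos (x * xi) - Im (U xi) * sin (x * xi)))) =
      (fun n => integ (fun y => Re (u y) * abel_kernel (en n) (x - y))).
    by apply/funext => n; case: (abel_mean_is_fourier x (en0 n) uU).
  by rewrite E in K; exact: cvg_unique L K.
- have s : summable1 (fun xi => Re (U xi) * sin (x * xi) + Im (U xi) * cos (x * xi)).
    by apply: summable1D; [exact: summable1_sinM|exact: summable1_cosM].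
  have K := abel_mean_cvg s; have L := abel_approximation (x := x) ci Li.
  have E : (fun n => integ (fun xi => abel_weight (en n) xi *
      (Re (U xi) * sin (x * xi) + Im (U xi) * cos (x * xi)))) =
      (fun n => integ (fun y => Im (u y) * abel_kernel (en n) (x - y))).
    by apply/funext => n; case: (abel_mean_is_fourier x (en0 n) uU).
  by rewrite E in K; exact: cvg_unique L K.
Qed.

End FourierInversion.

(** * Reflection, almost everywhere comparison and Cauchy-Schwarz *)

Section MeasurableReflection.
Variable R : realType.
Local Notation mu := (@lebesgue_measure R).
Implicit Types (f g : R -> R).

Let measurable_opp : measurable_fun setT (@GRing.opp R : measurableTypeR R -> measurableTypeR R).
Proof. by apply: measurable_contR; apply: contN; exact: contid. Qed.

Let opp_mixin := isMeasurableFun.Build _ _ _ _ _ measurable_opp.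
Let opp_mfun : {mfun measurableTypeR R >-> measurableTypeR R} := HB.pack (@GRing.opp R) opp_mixin.

(** Fourier transforms are merely measurable, so reflection is proved for the measure itself and not
    by calculus on continuous functions. Intervals suffice, and reflection turns []a, b]] into [[-b,
    -a[], of the same length. *)
Lemma lebesgue_measure_opp (A : set (measurableTypeR R)) : measurable A ->
  mu A = pushforward mu opp_mfun A.
Proof.
apply: lebesgue_measure_unique => X [[a b] _ <-].
have E : (-%R @^-1` `]a, b]%classic) = `[- b, - a[%classic :> set R.
  apply/seteqP; split => x /=; rewrite !in_itv/= => /andP[h1 h2]; apply/andP; split; lra.
rewrite [RHS](_ : _ = mu (-%R @^-1` `]a, b]%classic))// E.
rewrite !lebesgue_measure_itv/= !lte_fin ltrN2; case: ifP => // _.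
by rewrite opprK addeC.
Qed.

Lemma ge0_integral_opp f : measurable_fun setT f -> (forall x, 0 <= f x) ->
  (\int[mu]_x (f (- x))%:E = \int[mu]_x (f x)%:E)%E.
Proof.
move=> mf f0.
rewrite [RHS](@eq_measure_integral _ _ _ _ (pushforward mu opp_mfun)).
  rewrite ge0_integral_pushforward//.
  - exact/measurable_EFinP.
  - by move=> x _; rewrite lee_fin.
by move=> A mA _; exact: lebesgue_measure_opp.
Qed.

Lemma summable1_opp f : summable1 f -> summable1 (fun x => f (- x)).
Proof.
move=> sf; have mf := summable1_mfun sf.
apply/integrableP; split.
  by apply/measurable_EFinP; exact: (measurableT_comp mf measurable_opp).
have := summable1_lty (summable1_norm sf).
rewrite -(ge0_integral_opp _ (fun x => normr_ge0 (f x)))//.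
exact: summable1_mfun (summable1_norm sf).
Qed.

Lemma integ_opp f : measurable_fun setT f -> (forall x, 0 <= f x) ->
  integ (fun x => f (- x)) = integ f.
Proof. by move=> mf f0; rewrite /integ /Rintegral ge0_integral_opp. Qed.

End MeasurableReflection.

Section AlmostEverywhere.
Variable R : realType.
Local Notation mu := (@lebesgue_measure R).
Implicit Types (f g : R -> R).

Lemma ae_imply (P Q : R -> Prop) : (forall x, P x -> Q x) ->
  {ae mu, forall x, P x} -> {ae mu, forall x, Q x}.
Proof. by move=> PQ; apply: (@filterS _ _ (ae_filter_ringOfSetsType mu)). Qed.

Lemma summable1_ae_le f g : measurable_fun setT f -> summable1 g ->
  {ae mu, forall x, `|f x| <= g x} -> summable1 f.
Proof.
move=> mf sg fg; apply/integrableP; split; first exact/measurable_EFinP.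
apply: le_lt_trans (summable1_lty (summable1_norm sg)).
apply: ae_ge0_le_integral => //.
- by apply/measurable_EFinP; apply: measurableT_comp.
- by apply/measurable_EFinP; exact: summable1_mfun (summable1_norm sg).
- by apply: ae_imply fg => x fgx _; rewrite lee_fin (le_trans fgx)// ler_norm.
Qed.

Lemma integ_ae f g : measurable_fun setT f -> measurable_fun setT g ->
  {ae mu, forall x, f x = g x} -> integ f = integ g.
Proof.
move=> mf mg fg; rewrite /integ /Rintegral; congr fine.
apply: ae_eq_integral => //; [exact/measurable_EFinP|exact/measurable_EFinP|].
by apply: ae_imply fg => x fgx _; rewrite fgx.
Qed.

(** Cauchy-Schwarz up to the factor 2, with bounds for the norms in place of square roots of
    integrals: [integ_mul_le] is taken at the optimal [t = B / A]. *)
Lemma integ_mul_sqrt f g (A B : R) : square_summable f -> square_summable g ->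
  0 <= A -> 0 < B -> integ (fun x => f x ^+ 2) <= A ^+ 2 ->
  integ (fun x => g x ^+ 2) <= B ^+ 2 ->
  integ (fun x => `|f x * g x|) <= 2 * (A * B).
Proof.
move=> Lf Lg A0 B0 fA gB.
have I0 : 0 <= integ (fun x => `|f x * g x|) by exact: integ_ge0.
have H t : 0 < t -> integ (fun x => `|f x * g x|) <= t * A ^+ 2 + t^-1 * B ^+ 2.
  move=> t0; apply: (le_trans (integ_mul_le t0 Lf Lg)).
  by rewrite lerD// ler_wpM2l ?invr_ge0// ltW.
move: A0; rewrite le_eqVlt => /predU1P[A0|A0]; last first.
  have BA : 0 < B / A by rewrite divr_gt0.
  apply: (le_trans (H _ BA)); rewrite le_eqVlt; apply/orP; left; apply/eqP.
  by field; rewrite !gt_eqF.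
rewrite -A0 mul0r mulr0 leNgt; apply/negP => Ipos.
(* When [A = 0] every [t] is allowed; this one turns the inequality into [I <= I / 2] for the
   integral [I]. *)
have t0 : 0 < 2 * B ^+ 2 / integ (fun x => `|f x * g x|).
  by rewrite divr_gt0// mulr_gt0// exprn_gt0.
have := H _ t0; rewrite -A0 expr0n/= mulr0 add0r.
have -> : (2 * B ^+ 2 / integ (fun x => `|f x * g x|))^-1 * B ^+ 2 =
    integ (fun x => `|f x * g x|) / 2.
  by move: Ipos; generalize (integ (fun x => `|f x * g x|)) => I Ipos; field; rewrite !gt_eqF.
have half (I : R) : 0 < I -> I <= I / 2 -> False by lra.
exact: half Ipos.
Qed.

End AlmostEverywhere.

(** * Bernstein's inequality for band-limited functions *)

Section BesovFourier.
Variable R : realType.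
Local Notation mu := (@lebesgue_measure R).
Implicit Types (u v U V W : R -> R[i]) (f g chi : R -> R).
Local Notation Re := complex.Re.
Local Notation Im := complex.Im.

Lemma Re_realM (c : R) (z : R[i]) : Re (c%:C * z) = c * Re z.
Proof. by case: z => a b /=; rewrite mul0r subr0. Qed.

Lemma Im_realM (c : R) (z : R[i]) : Im (c%:C * z) = c * Im z.
Proof. by case: z => a b /=; rewrite mul0r addr0. Qed.

Definition l1norm (z : R[i]) : R := `|Re z| + `|Im z|.

Lemma l1norm_ge0 z : 0 <= l1norm z. Proof. by rewrite addr_ge0. Qed.

Lemma l1norm_realM c z : l1norm (c%:C * z) = `|c| * l1norm z.
Proof. by rewrite /l1norm Re_realM Im_realM !normrM mulrDr. Qed.

Lemma square_summable_norm f : square_summable f -> square_summable (fun x => `|f x|).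
Proof.
move=> Lf; apply: (square_summable_le _ Lf) => [|x]; last by rewrite normr_id.
by apply: measurableT_comp => //; case: Lf.
Qed.

Lemma square_summable_l1norm U : in_L2 U -> square_summable (fun xi => l1norm (U xi)).
Proof. by move=> /in_L2P[Lr Li]; apply: square_summableD; exact: square_summable_norm. Qed.

Lemma integ_l1norm_sqr U : in_L2 U ->
  integ (fun xi => l1norm (U xi) ^+ 2) <=
  2 * (integ (fun xi => Re (U xi) ^+ 2) + integ (fun xi => Im (U xi) ^+ 2)).
Proof.
move=> /in_L2P[Lr Li]; rewrite mulrDr.
have := integ_sqrD (square_summable_norm Lr) (square_summable_norm Li).
have nE f : integ (fun x => `|f x| ^+ 2) = integ (fun x => f x ^+ 2).
  by apply: eq_integ => x; rewrite real_normK ?num_real.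
by rewrite !nE.
Qed.

Lemma square_summable_indic (N : R) : square_summable (\1_(`[- N, N]%classic) : R -> R) .
Proof.
split; first exact: measurable_indic.
have : summable1 (\1_(`[- N, N]%classic) : R -> R) by exact: integrable_indic_itv.
by apply: eq_summable1 => x; rewrite indicE; case: (_ \in _); rewrite ?expr1n// expr0n.
Qed.

Lemma integ_indic_sqr (N : R) : 0 <= N ->
  integ (fun x => (\1_(`[- N, N]%classic) x : R) ^+ 2) = 2 * N.
Proof.
move=> N0; have -> : (fun x => (\1_(`[- N, N]%classic) x : R) ^+ 2) = \1_(`[- N, N]%classic).
  by apply/funext => x; rewrite indicE; case: (_ \in _); rewrite ?expr1n// expr0n.
rewrite /integ /Rintegral integral_indic//= setIT lebesgue_measure_itv/= lte_fin.
by case: ltP => [_|NN]/=; lra.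
Qed.

(** Bernstein's inequality on the Fourier side: Cauchy-Schwarz against the indicator of the band,
    whose squared L^2 norm is [2 * N], and the Plancherel bound for [V]. The resulting square root
    of [N] is what the weight [2 ^ (k / 2)] of the Besov norm compensates. *)
Lemma is_fourier_band u V (N M : R) : 0 < N -> 0 <= M -> is_fourier u V ->
  (forall xi, N < `|xi| -> V xi = 0) ->
  L2norm u = M%:E ->
  summable1 (fun xi => l1norm (V xi)) /\
  integ (fun xi => l1norm (V xi)) <= 24 * (1 + pi) * M * Num.sqrt N.
Proof.
move=> N0 M0 uV supp uM; have [Lu LV _] := uV.
have [Lr Li] := (in_L2P u).1 Lu.
have Ln := square_summable_l1norm LV.
have E xi : l1norm (V xi) = l1norm (V xi) * \1_(`[- N, N]%classic) xi.
  rewrite indicE; case: (boolP (xi \in _)) => [_|]; first by rewrite mulr1.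
  rewrite notin_setE/= in_itv/= => /negP; rewrite -ler_norml -ltNge => /supp ->.
  by rewrite /l1norm/= normr0 addr0 mul0r.
have LI := square_summable_indic N.
have p0 : 0 <= pi :> R by exact: pi_ge0.
split.
  by apply: eq_summable1 (square_summableM Ln LI) => xi; rewrite -E.
have MM : integ (fun x => Re (u x) ^+ 2) + integ (fun x => Im (u x) ^+ 2) = M ^+ 2.
  move: uM; rewrite L2normE// => -[<-]; rewrite sqr_sqrtr// addr_ge0//.
    by apply: integ_ge0 => x; exact: sqr_ge0.
  by apply: integ_ge0 => x; exact: sqr_ge0.
have P := plancherel_le uV; rewrite MM in P.
have Q := integ_l1norm_sqr LV.
(* [integ_mul_sqrt] wants a square as bound, and [32 * pi <= (6 * (1 + pi)) ^+ 2] provides one. *)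
have h1 : integ (fun xi => l1norm (V xi) ^+ 2) <= (6 * (1 + pi) * M) ^+ 2.
  apply: (le_trans Q); apply: (@le_trans _ _ (32 * pi * M ^+ 2)).
    by rewrite -[32 * _]/(32%:R * _); lra.
  rewrite !exprMn ler_wpM2r ?sqr_ge0//.
  by have := mulr_ge0 p0 p0; move: p0; generalize (pi : R) => p; nra.
have sN : 0 < 2 * Num.sqrt N by rewrite mulr_gt0// sqrtr_gt0.
have h2 : integ (fun x => (\1_(`[- N, N]%classic) x : R) ^+ 2) <= (2 * Num.sqrt N) ^+ 2.
  by rewrite integ_indic_sqr ?ltW// exprMn sqr_sqrtr ?ltW//; lra.
have c0 : 0 <= 6 * (1 + pi) * M by rewrite !mulr_ge0// addr_ge0.
have := integ_mul_sqrt Ln LI c0 sN h1 h2.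
have -> : integ (fun x => `|l1norm (V x) * \1_(`[- N, N]%classic) x|) =
   integ (fun x => l1norm (V x)).
  by apply: eq_integ => xi; rewrite -E ger0_norm ?l1norm_ge0.
by move=> H; apply: (le_trans H); rewrite le_eqVlt; apply/orP; left; apply/eqP; ring.
Qed.

End BesovFourier.
(** * The Fourier representation of the extension *)

Section BesovSummable.
Variable R : realType.
Local Notation mu := (@lebesgue_measure R).
Implicit Types (u v U V W : R -> R[i]) (f g chi : R -> R).
Local Notation Re := complex.Re.
Local Notation Im := complex.Im.

Lemma smooth_continuous f : smooth f -> continuous (f : R -> R).
Proof.
move=> sf x; have := sf 0%N x; rewrite /derive1n/= => /derivable1_diffP.
exact: differentiable_continuous.
Qed.

(** The symbol of the projection to frequencies up to about [2 ^ n]; consecutive ones differ by the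
    symbol of one Littlewood-Paley block ([lp_symbolE]). *)
Definition dyadic_cutoff chi (n : nat) (xi : R) : R := chi (xi / 2 ^+ n).

Lemma lp_symbolE chi (k : nat) xi :
  lp_symbol chi k.+1%:Z xi = dyadic_cutoff chi k.+1 xi - dyadic_cutoff chi k xi.
Proof.
rewrite /lp_symbol /dyadic_cutoff.
have -> : k.+1%:Z - 1 = k%:Z by rewrite -addn1 PoszD addrK.
by rewrite -!exprnP.
Qed.

Lemma measurable_dyadic_cutoff chi n : lp_cutoff chi ->
  measurable_fun setT (dyadic_cutoff chi n).
Proof.
move=> [schi _ _ _]; apply: measurable_contR; apply: contcomp; last exact: smooth_continuous.
by apply: contM; [exact: contid|exact: contcst].
Qed.

Lemma dyadic_cutoff_supp chi n xi : lp_cutoff chi -> 2 ^+ n.+1 < `|xi| ->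
  dyadic_cutoff chi n xi = 0.
Proof.
move=> [_ _ _ c0] H; apply: c0.
rewrite normrM [`|_ ^-1|]ger0_norm ?invr_ge0 ?exprn_ge0//.
by rewrite ler_pdivlMr ?exprn_gt0// -exprS ltW.
Qed.

Lemma measurable_l1norm U : measurable_fun setT (fun x => Re (U x)) ->
  measurable_fun setT (fun x => Im (U x)) -> measurable_fun setT (fun x => l1norm (U x)).
Proof. by move=> mr mi; apply: measurable_funD; apply: measurableT_comp. Qed.

Lemma powR_half (n : nat) : 2 `^ (n%:R / 2) = Num.sqrt (2 ^+ n) :> R.
Proof. by rewrite powRrM powR_mulrn// powR12_sqrt// exprn_ge0. Qed.

(** The block of index [k + 1] lives in [|xi| <= 2 ^ (k + 2)]; this compares the loss of
    [is_fourier_band] there with the weight of the Besov norm. *)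
Lemma sqrt_dyadic (k : nat) : Num.sqrt (2 ^+ k.+2) <= 2 * 2 `^ (k.+1%:R / 2) :> R.
Proof.
rewrite powR_half -[leRHS]ger0_norm ?mulr_ge0 ?sqrtr_ge0// -sqrtr_sqr.
rewrite ler_wsqrtr// exprMn sqr_sqrtr ?exprn_ge0// [leLHS]exprS expr2 -mulrA ler_wpM2l//.
by rewrite ler_peMl ?exprn_ge0// ler1n.
Qed.

(** The embedding of the critical Besov space into the functions with integrable Fourier transform.
    [is_fourier_band] bounds the integral of the transform over one block by the corresponding term
    of the Besov norm; the blocks are summed by telescoping, and Fatou's lemma removes the
    cutoff. *)
Theorem besov_fourier_summable chi W : lp_cutoff chi -> besov_half chi W ->
  exists2 U, is_fourier W U & summable1 (fun xi => l1norm (U xi)).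
Proof.
move=> lp [cW [Plow [P [[U WU PU] HP Hsum]]]].
exists U => //; have [_ LU _] := WU.
have [[mUr _] [mUi _]] := (in_L2P U).1 LU.
have mU := measurable_l1norm mUr mUi.
have [schi c01 c1 c0] := lp.
pose d := dyadic_cutoff chi.
(* [q k] is the size of the transform of the block [P k.+1], but written with the transform [U] of
   [W]; [fourier_unique] identifies the two almost everywhere. *)
pose q k xi := `|d k.+1 xi - d k xi| * l1norm (U xi).
have L2fin k : (1 <= k)%N -> exists2 M : R, L2norm (P k) = M%:E & 0 <= M.
  move=> /HP [Uk _ [LPk _ _]]; have [Lr Li] := (in_L2P _).1 LPk.
  by rewrite L2normE//; eexists; [reflexivity|exact: sqrtr_ge0].
pose M k := fine (L2norm (P k)).
have ME k : (1 <= k)%N -> L2norm (P k) = (M k)%:E /\ 0 <= M k.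
  by move=> /L2fin[m mE m0]; rewrite /M mE.
have p0 : 0 <= pi :> R by exact: pi_ge0.
(* The 24 of [is_fourier_band] times the 2 of [sqrt_dyadic]. *)
pose C : R := 48 * (1 + pi).
have C0 : 0 <= C by rewrite mulr_ge0// addr_ge0.
have Hq k : summable1 (q k) /\ integ (q k) <= C * (2 `^ (k.+1%:R / 2) * M k.+1).
  have [Mk Mk0] := ME k.+1 isT.
  have [Uk WUk PUk] := HP k.+1 isT.
  have supp xi : 2 ^+ k.+2 < `|xi| -> (lp_symbol chi k.+1%:Z xi)%:C * Uk xi = 0.
    move=> H; rewrite lp_symbolE dyadic_cutoff_supp// dyadic_cutoff_supp// ?subrr ?mul0r//.
    by apply: le_lt_trans H; rewrite [leRHS]exprS ler_peMl ?exprn_ge0// ler1n.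
  have N0 : 0 < 2 ^+ k.+2 :> R by rewrite exprn_gt0.
  have [sV IV] := is_fourier_band N0 Mk0 PUk supp Mk.
  have mq : measurable_fun setT (q k).
    apply: measurable_funM => //; apply: measurableT_comp => //.
    by apply: measurable_funB; exact: measurable_dyadic_cutoff.
  have aeq : {ae mu, forall xi, q k xi = l1norm ((lp_symbol chi k.+1%:Z xi)%:C * Uk xi)}.
    apply: ae_imply (fourier_unique WU WUk) => xi e.
    by rewrite l1norm_realM lp_symbolE -e.
  split.
    apply: (summable1_ae_le mq sV); apply: ae_imply aeq => xi ->.
    by rewrite ger0_norm// l1norm_ge0.
  rewrite (integ_ae mq (summable1_mfun sV) aeq); apply: (le_trans IV).
  rewrite /C -!mulrA.
  have -> : 48 * ((1 + pi) * (2 `^ (k.+1%:R / 2) * M k.+1)) =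
    24 * ((1 + pi) * (M k.+1 * (2 * 2 `^ (k.+1%:R / 2)))) by ring.
  rewrite ler_wpM2l//; apply: ler_wpM2l; first exact: addr_ge0.
  by rewrite ler_wpM2l// sqrt_dyadic.
pose f n xi := `|d n xi| * l1norm (U xi).
have sf0 : summable1 (f 0%N).
  have supp xi : 2 < `|xi| -> (chi xi)%:C * U xi = 0.
    by move=> /ltW /c0 ->; rewrite mul0r.
  have [LP _ _] := PU; have [Lr Li] := (in_L2P _).1 LP.
  have [] := is_fourier_band (N := 2) _ _ PU supp (L2normE Lr Li) => //.
  move=> s _; apply: eq_summable1 s => xi.
  by rewrite l1norm_realM /f /d /dyadic_cutoff expr0 divr1.
have fq n xi : f n xi <= f 0%N xi + \sum_(k < n) q k xi.
  elim: n => [|n IH]; first by rewrite big_ord0 addr0.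
  rewrite big_ord_recr/= addrA; apply: le_trans (lerD IH (lexx _)).
  rewrite /f /q -mulrDl ler_wpM2r ?l1norm_ge0//.
  by rewrite -{1}[d n.+1 xi](subrK (d n xi)) addrC ler_normD.
have ssum n : summable1 (fun xi => \sum_(k < n) q k xi) /\
   integ (fun xi => \sum_(k < n) q k xi) = \sum_(k < n) integ (q k).
  elim: n => [|n [s IH]].
    rewrite big_ord0; under eq_fun do rewrite big_ord0.
    by split; [exact: summable1_cst0|exact: integ0].
  have [sq _] := Hq n; rewrite big_ord_recr/= -IH -integD//.
  under eq_fun do rewrite big_ord_recr/=.
  by split => //; exact: summable1D.
have mf n : measurable_fun setT (f n).
  apply: measurable_funM => //; apply: measurableT_comp => //.
  exact: measurable_dyadic_cutoff.
have f0 n xi : 0 <= f n xi by rewrite mulr_ge0// l1norm_ge0.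
have sf n : summable1 (f n).
  have [s _] := ssum n; apply: (summable1_le (mf n) (summable1D sf0 s)) => xi.
  by rewrite ger0_norm.
set T := (\sum_(1 <= k <oo) _)%E in Hsum.
have u0 k : (1 <= k)%N -> (0 <= (2 `^ (k%:R / 2))%:E * L2norm (P k))%E.
  by move=> k1; rewrite mule_ge0 ?lee_fin ?powR_ge0//; exact: Lnorm_ge0.
have T0 : (0 <= T)%E by apply: nneseries_ge0 => k k1 _; exact: u0.
have Tfin : (T < +oo)%E.
  by apply: le_lt_trans Hsum; rewrite leeDl//; exact: Lnorm_ge0.
have TE : T = (fine T)%:E by rewrite fineK// ge0_fin_numE.
have partial n : \sum_(k < n) (2 `^ (k.+1%:R / 2) * M k.+1) <= fine T.
  rewrite -lee_fin -TE; apply: le_trans (nneseries_lim_ge n.+1 (fun k k1 _ => u0 k k1)).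
  rewrite big_add1/= big_mkord -sumEFin; apply: lee_sum => k _.
  by have [-> _] := ME k.+1 isT; rewrite EFinM.
have [] // := @fatou_bounded _ f (fun xi => l1norm (U xi)) (integ (f 0%N) + C * fine T).
- move=> xi; apply: cvg_near_cst.
  near=> n; rewrite /f /d /dyadic_cutoff c1 ?normr1 ?mul1r//.
  rewrite normrM [`|_ ^-1|]ger0_norm ?invr_ge0 ?exprn_ge0//.
  rewrite ler_pdivrMr ?exprn_gt0// mul1r.
  apply: (@le_trans _ _ n%:R).
    by near: n; exact: nbhs_infty_ger.
  by rewrite -natrX ler_nat ltnW// ltn_expl.
- move=> n; have [s IE] := ssum n.
  apply: (@le_trans _ _ (integ (fun xi => f 0%N xi + \sum_(k < n) q k xi))).
    by apply: integ_le => //; exact: summable1D.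
  rewrite integD// IE lerD2l.
  apply: (@le_trans _ _ (\sum_(k < n) C * (2 `^ (k.+1%:R / 2) * M k.+1))).
    by apply: ler_sum => k _; case: (Hq k).
  by rewrite -mulr_sumr ler_wpM2l.
Unshelve. all: by end_near. Qed.

End BesovSummable.

(** * Moduli and continuity in the complex plane *)

Section StripTopology.
Variable R : realType.
Local Notation Re := complex.Re.
Local Notation Im := complex.Im.

Lemma ltc_normP (z : R[i]) (e : R) : (`|z| < e%:C) = (Normc.normc z < e).
Proof. by rewrite -ltcR. Qed.

Lemma normc_ge_Re (z : R[i]) : `|Re z| <= Normc.normc z.
Proof.
case: z => a b /=; rewrite -sqrtr_sqr ler_wsqrtr// lerDl sqr_ge0//.
Qed.

Lemma normc_ge_Im (z : R[i]) : `|Im z| <= Normc.normc z.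
Proof.
case: z => a b /=; rewrite -sqrtr_sqr ler_wsqrtr// lerDr sqr_ge0//.
Qed.

Lemma normc_le_l1 (z : R[i]) : Normc.normc z <= `|Re z| + `|Im z|.
Proof.
case: z => a b /=; rewrite -[leRHS]ger0_norm ?addr_ge0// -sqrtr_sqr ler_wsqrtr//.
rewrite sqrrD !real_normK ?num_real// addrAC lerDl mulrn_wge0// mulr_ge0//.
Qed.

Lemma continuous_componentsP (u : R -> R[i]^o) : continuous u ->
  continuous (fun x => Re (u x) : R) /\ continuous (fun x => Im (u x) : R).
Proof.
move=> cu; suff H x e : 0 < e -> \forall y \near nbhs x, Normc.normc (u x - u y) < e.
  split=> x; apply/cvgrPdist_lt => e e0; have := H x e e0; apply: filterS => y.
    by apply: le_lt_trans; rewrite -raddfB normc_ge_Re.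
  by apply: le_lt_trans; rewrite -raddfB normc_ge_Im.
move=> e0; have := cu x => /cvgrPdist_lt /(_ e%:C).
by rewrite ltcR => /(_ e0); apply: filterS => y; rewrite ltc_normP.
Qed.

Lemma closed_strip_continuousP (h : R) (E : R[i] -> R[i]) :
  {within (closed_strip h : set R[i]^o), continuous (E : R[i]^o -> R[i]^o)} ->
  forall z, closed_strip h z -> forall e, 0 < e ->
  exists2 eta, 0 < eta & forall w, closed_strip h w ->
    Normc.normc (z - w) < eta -> Normc.normc (E z - E w) < e.
Proof.
move=> cE z hz e e0.
move: cE => /subspace_continuousP /(_ z hz) /cvgrPdist_lt /(_ e%:C).
rewrite ltcR => /(_ e0); rewrite near_withinE => -[/= r r0 H].
have [rR r0'] : exists r', r = r'%:C.
  by exists (Re r); case: r r0 {H} => a b; rewrite ltcE/= => /andP[/eqP -> _].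
exists rR; first by move: r0; rewrite r0' ltcR.
move=> w hw zw; rewrite -ltc_normP; apply: H => //.
by rewrite /ball/= r0' ltc_normP.
Qed.

End StripTopology.

(** * The symbol of the extension and its Fourier integral *)

Section StripRepresentation.
Variable R : realType.
Local Notation mu := (@lebesgue_measure R).
Local Notation Re := complex.Re.
Local Notation Im := complex.Im.
Implicit Types (h b x xi : R) (W : R -> R[i]).

(** The symbol that takes the real part of the trace to the extension at height [b]: it is
    [1 / cosh (h * xi)] on the bottom and [1 - tanh (h * xi)] on the top. *)
Definition strip_symbol h b xi : R := expR (- ((b + h) * xi)) / cosh (h * xi).

Lemma cosh_gt0 x : 0 < cosh x.
Proof. by rewrite /cosh divr_gt0// addr_gt0// expR_gt0. Qed.

Lemma cosh_ge x : expR `|x| / 2 <= cosh x.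
Proof.
rewrite /cosh ler_wpM2r//; case: (ger0P x) => _.
  by rewrite lerDl expR_ge0.
by rewrite lerDr expR_ge0.
Qed.

Lemma strip_symbol_ge0 h b xi : 0 <= strip_symbol h b xi.
Proof. by rewrite divr_ge0 ?expR_ge0// ltW// cosh_gt0. Qed.

Lemma expR_strip_le h b xi : - h <= b <= 0 ->
  expR (- ((b + h) * xi)) <= expR `|h * xi|.
Proof.
move=> /andP[b1 b2]; rewrite ler_expR.
rewrite normrM [`|h|]ger0_norm; last by lra.
apply: (@le_trans _ _ ((b + h) * `|xi|)).
  by rewrite -mulrN ler_wpM2l ?ler_normr ?lexx ?orbT//; lra.
by rewrite ler_wpM2r//; lra.
Qed.

Lemma strip_symbol_le2 h b xi : - h <= b <= 0 -> strip_symbol h b xi <= 2.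
Proof.
move=> hb; rewrite /strip_symbol ler_pdivrMr ?cosh_gt0//.
have := cosh_ge (h * xi); have := expR_strip_le xi hb; lra.
Qed.

(** On the top the symbol is bounded below for negative frequencies but decays exponentially for
    positive ones; the latter are recovered by parity in [strip_representation]. *)
Lemma strip_symbol_top_ge1 h xi : xi <= 0 -> 0 < h -> 1 <= strip_symbol h 0 xi.
Proof.
move=> xi0 h0; rewrite /strip_symbol ler_pdivlMr ?cosh_gt0// mul1r add0r /cosh.
have : expR (h * xi) <= expR (- (h * xi)).
  rewrite ler_expR; have : h * xi <= 0 by rewrite mulr_ge0_le0// ltW.
  lra.
lra.
Qed.

Lemma expR_lip (a a' : R) : expR a - expR a' <= (a - a') * expR a.
Proof.
have -> : expR a' = expR a * expR (a' - a) by rewrite -expRD addrC subrK.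
have := expR_ge1Dx (a' - a); have := expR_gt0 a; nra.
Qed.

Lemma strip_symbol_lip h b b' xi : - h <= b <= 0 -> - h <= b' <= 0 ->
  `|strip_symbol h b xi - strip_symbol h b' xi| <= 2 * (`|b - b'| * `|xi|).
Proof.
move=> hb hb'; rewrite /strip_symbol -mulrBl normrM [`|_ ^-1|]ger0_norm; last first.
  by rewrite invr_ge0 ltW// cosh_gt0.
rewrite ler_pdivrMr ?cosh_gt0//.
have H c c' : - h <= c <= 0 -> expR (- ((c + h) * xi)) - expR (- ((c' + h) * xi)) <=
    `|c - c'| * `|xi| * expR `|h * xi|.
  move=> hc; apply: (le_trans (expR_lip _ _)).
  have -> : - ((c + h) * xi) - - ((c' + h) * xi) = (c' - c) * xi by ring.
  apply: (@le_trans _ _ (`|c - c'| * `|xi| * expR (- ((c + h) * xi)))).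
    by rewrite ler_wpM2r ?expR_ge0// distrC -normrM ler_norm.
  by rewrite ler_wpM2l ?mulr_ge0// expR_strip_le.
apply: (@le_trans _ _ (`|b - b'| * `|xi| * expR `|h * xi|)).
  rewrite ler_norml lerNl opprB; apply/andP; split; last exact: H.
  by rewrite (distrC b); exact: H.
have := cosh_ge (h * xi); have : 0 <= `|b - b'| * `|xi| by rewrite mulr_ge0.
nra.
Qed.

(** The exponential growth of [cosh] absorbs one derivative. This is the source of the bound for the
    increments on the bottom. *)
Lemma strip_symbol_bottom_le h xi : 0 < h -> `|xi| * strip_symbol h (- h) xi <= 2 / h.
Proof.
move=> h0; rewrite /strip_symbol addNr mul0r oppr0 expR0 mul1r.
rewrite ler_pdivrMr ?cosh_gt0// mulrAC ler_pdivlMr//.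
have := cosh_ge (h * xi); have := expR_ge1Dx `|h * xi|.
rewrite normrM (ger0_norm (ltW h0)) => ? ?; lra.
Qed.

Lemma cont_strip_symbol h b : continuous (strip_symbol h b : R -> R).
Proof.
have cl (c : R) : continuous (fun xi : R => c * xi : R).
  by apply: contM; [exact: contcst|exact: contid].
apply: contM.
  by apply: (contcomp (contN (cl (b + h)))); exact: continuous_expR.
apply: contV; last by move=> xi; rewrite gt_eqF// cosh_gt0.
apply: contM; last exact: contcst.
apply: contD; first by apply: (contcomp (cl h)); exact: continuous_expR.
by apply: (contcomp (contN (cl h))); exact: continuous_expR.
Qed.

(** Parity passes to limits in L^2; [s ^+ 2 = 1] lets the same integral measure the error and its
    reflection. *)
Lemma ae_parity (s : R) (f : R -> R) (T : nat -> R -> R) : s ^+ 2 = 1 ->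
  square_summable f -> (forall n, square_summable (T n)) ->
  (forall n xi, T n (- xi) = s * T n xi) ->
  integ (fun xi => (f xi - T n xi) ^+ 2) @[n --> \oo] --> (0 : R) ->
  {ae mu, forall xi, f (- xi) = s * f xi}.
Proof.
move=> s1 Lf LT Tp H.
have Lopp (g : R -> R) : square_summable g -> square_summable (fun x => g (- x)).
  move=> [mg sg]; split; last exact: (@summable1_opp _ (fun x => g x ^+ 2)).
  apply: (measurableT_comp mg); apply: measurable_contR; apply: contN; exact: contid.
suff : {ae mu, forall xi, f (- xi) - s * f xi = 0}.
  by apply: ae_imply => xi /subr0_eq.
apply: integ_sqr_eq0_ae.
  by apply: square_summableB; [exact: Lopp|exact: square_summableZ].
apply: (le_cvg0 H H) => n; rewrite addr0.
have LB := square_summableB Lf (LT n).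
have := integ_sqrD (Lopp _ LB) (square_summableZ (- s) LB).
have -> : integ (fun x => (f (- x) - T n (- x) + - s * (f x - T n x)) ^+ 2) =
          integ (fun x => (f (- x) - s * f x) ^+ 2).
  by apply: eq_integ => x; rewrite Tp; congr (_ ^+ 2); ring.
have -> : integ (fun x => (- s * (f x - T n x)) ^+ 2) = integ (fun x => (f x - T n x) ^+ 2).
  by apply: eq_integ => x; rewrite exprMn sqrrN s1 mul1r.
rewrite (@integ_opp _ (fun x => (f x - T n x) ^+ 2))//.
  by apply: measurable_funX; case: LB.
by move=> x; exact: sqr_ge0.
Qed.

(** The Hermitian symmetry of the transform of a real function, read off from its truncated
    integrals. *)
Lemma fourier_real_parity (f : R -> R) U : is_fourier (fun x => (f x)%:C) U ->
  {ae mu, forall xi, Re (U (- xi)) = Re (U xi)} /\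
  {ae mu, forall xi, Im (U (- xi)) = - Im (U xi)}.
Proof.
move=> fU; have [cr ci] := is_fourier_cvg fU.
have [Lf LU _] := fU.
have [Lr Li] := (in_L2P _).1 Lf; have [LUr LUi] := (in_L2P _).1 LU.
have LT n := square_summable_trunc n%:R Lf.
have cut0 n xi : fourier_sin (cut (fun x => Im (f x)%:C) n%:R) xi = 0.
  by rewrite -[RHS](@integ0 R); apply: eq_integ => x; rewrite /cut/= !mul0r.
have cut1 n xi : fourier_cos (cut (fun x => Im (f x)%:C) n%:R) xi = 0.
  by rewrite -[RHS](@integ0 R); apply: eq_integ => x; rewrite /cut/= !mul0r.
split.
- have [] // := @ae_parity 1 _ _ _ LUr (fun n => (LT n).1) _ cr.
  + by rewrite expr1n.
  + move=> n xi; rewrite mul1r !fourier_truncE//= !cut0 !addr0.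
    by apply: eq_integ => x; rewrite mulNr cosN.
  + by move=> X HX; exists X => //; case: HX => mX X0 HX; split => // xi /=; rewrite -[Re (U xi)]mul1r; exact: HX.
- have := @ae_parity (-1) _ _ _ LUi (fun n => (LT n).2) _ ci.
  rewrite sqrrN expr1n => /(_ erefl).
  have Hp n xi : Im (fourier_trunc (fun x => (f x)%:C) n%:R (- xi)) =
      -1 * Im (fourier_trunc (fun x => (f x)%:C) n%:R xi).
    rewrite !fourier_truncE//= !cut1 !sub0r mulN1r opprK -integN.
      by apply: eq_integ => x; rewrite mulNr sinN mulrN opprK.
    by apply: summable1_sinM; exact: summable1_cut.
  by move=> /(_ Hp); apply: ae_imply => xi ->; rewrite mulN1r.
Qed.

(** [A] and [B] are the components of the transform of [Re W]. Multiplied by the top symbol they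
    give the transform of [W], integrable by the Besov hypothesis; dividing by the symbol is
    harmless for negative frequencies, and parity covers the positive ones. So [A] and [B] are
    integrable, and since [E] is continuous, inversion holds at every point of every horizontal
    line. *)
Theorem strip_representation h chi W E : 0 < h -> lp_cutoff chi -> besov_half chi W ->
  holomorphic_extension h W E ->
  exists A B : R -> R,
    [/\ summable1 A, summable1 B, square_summable A, square_summable B &
    forall b x, - h <= b <= 0 ->
      2 * pi * Re (E (x +i* b)) =
        integ (fun xi => strip_symbol h b xi * (A xi * cos (x * xi) - B xi * sin (x * xi))) /\
      2 * pi * Im (E (x +i* b)) =
        integ (fun xi => strip_symbol h b xi * (A xi * sin (x * xi) + B xi * cos (x * xi)))].
Proof.
move=> h0 lp WB Eext.
have [U WU sU] := besov_fourier_summable lp WB.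
have b00 : (- h <= (0 : R)) && ((0 : R) <= 0) by rewrite lexx andbT oppr_le0 ltW.
have [U0 RU0 EU0] := extension_multiplier Eext b00.
have E0W : (fun a => E (a +i* 0)) = W.
  by apply/funext => a; rewrite -(extension_trace Eext).
rewrite E0W in EU0.
have aeU := fourier_unique EU0 WU.
have [LR LU0 _] := RU0; have [LA LB] := (in_L2P _).1 LU0.
have [_ LUU _] := WU; have [[mUr _] [mUi _]] := (in_L2P _).1 LUU.
have [parA parB] := fourier_real_parity RU0.
have mm b : measurable_fun setT (strip_symbol h b).
  by apply: measurable_contR; exact: cont_strip_symbol.
(* The majorant is [strip_symbol h 0 xi * |f xi|] plus its reflection: at each frequency one of the
   two has a symbol at least 1. *)
have key (f : R -> R) : square_summable f ->
    {ae mu, forall xi, `|f (- xi)| = `|f xi|} ->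
    {ae mu, forall xi, `|strip_symbol h 0 xi * f xi| <= l1norm (U xi)} -> summable1 f.
  move=> [mf _] par fle.
  have sg : summable1 (fun xi => strip_symbol h 0 xi * `|f xi|).
    apply: (summable1_ae_le _ sU).
      by apply: measurable_funM => //; apply: measurableT_comp.
    apply: ae_imply fle => xi; apply: le_trans.
    by rewrite !normrM normr_id.
  apply: (summable1_ae_le mf (summable1D sg (summable1_opp sg))).
  apply: ae_imply par => xi e; have [xi0|xi0] := leP xi 0.
    rewrite -[leLHS]addr0 lerD//; last by rewrite mulr_ge0 ?strip_symbol_ge0.
    by rewrite ler_peMl// strip_symbol_top_ge1.
  rewrite -[leLHS]add0r e lerD//; first by rewrite mulr_ge0 ?strip_symbol_ge0.
  by rewrite ler_peMl// strip_symbol_top_ge1// oppr_le0 ltW.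
have sA : summable1 (fun xi => Re (U0 xi)).
  apply: key => //; first by apply: ae_imply parA => xi ->.
  apply: ae_imply aeU => xi e.
  by rewrite /strip_symbol -Re_realM e /l1norm lerDl.
have sB : summable1 (fun xi => Im (U0 xi)).
  apply: key => //; first by apply: ae_imply parB => xi ->; rewrite normrN.
  apply: ae_imply aeU => xi e.
  by rewrite /strip_symbol -Im_realM e /l1norm lerDr.
exists (fun xi => Re (U0 xi)), (fun xi => Im (U0 xi)); split => // b x hb.
have [Ub RUb EUb] := extension_multiplier Eext hb.
have aeb := fourier_unique RUb RU0.
have [_ LUb _] := RUb; have [[mbr _] [mbi _]] := (in_L2P _).1 LUb.
have mb2 xi : `|strip_symbol h b xi| <= 2.
  by rewrite ger0_norm ?strip_symbol_ge0// strip_symbol_le2.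
have sbr : summable1 (fun xi => Re ((strip_symbol h b xi)%:C * Ub xi)).
  apply: (summable1_ae_le _ (summable1_norm (summable1M (mm b) mb2 sA))).
    by under eq_fun do rewrite Re_realM; exact: measurable_funM.
  by apply: ae_imply aeb => xi ->; rewrite Re_realM mulrC.
have sbi : summable1 (fun xi => Im ((strip_symbol h b xi)%:C * Ub xi)).
  apply: (summable1_ae_le _ (summable1_norm (summable1M (mm b) mb2 sB))).
    by under eq_fun do rewrite Im_realM; exact: measurable_funM.
  by apply: ae_imply aeb => xi ->; rewrite Im_realM mulrC.
have cE : continuous (fun a => E (a +i* b) : R[i]^o).
  move=> a; apply/cvgrPdist_lt => -[e1 e2]; rewrite ltcE/= => /andP[/eqP-> e0].
  have hs y : closed_strip h (y +i* b) by [].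
  have [eta eta0 H] := closed_strip_continuousP (extension_continuous Eext) (hs a) e0.
  exists eta => //= y; rewrite /ball/= => ay.
  rewrite (ltc_normP _ e1); apply: H => //; rewrite /= subrr expr0n addr0 sqrtr_sqr//.
have [cr ci] := continuous_componentsP cE.
have [-> ->] := fourier_inversion x EUb cr ci sbr sbi.
have mcos : measurable_fun setT (fun xi => cos (x * xi)).
  by apply: measurable_contR; exact: cont_cosM.
have msin : measurable_fun setT (fun xi => sin (x * xi)).
  by apply: measurable_contR; exact: cont_sinM.
have [mA _] := LA; have [mB _] := LB.
split; apply: integ_ae.
- by apply: measurable_funB; apply: measurable_funM => //; exact: summable1_mfun.
- apply: measurable_funM => //; apply: measurable_funB; exact: measurable_funM.
- apply: ae_imply aeb => xi ->; rewrite Re_realM Im_realM /strip_symbol; ring.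
- by apply: measurable_funD; apply: measurable_funM => //; exact: summable1_mfun.
- apply: measurable_funM => //; apply: measurable_funD; exact: measurable_funM.
- apply: ae_imply aeb => xi ->; rewrite Re_realM Im_realM /strip_symbol; ring.
Qed.

End StripRepresentation.

(** * Boundedness, decay and increments of the extension *)

Section StripBounds.
Variable R : realType.
Local Notation mu := (@lebesgue_measure R).
Local Notation Re := complex.Re.
Local Notation Im := complex.Im.
Implicit Types (f g A B : R -> R) (h b x xi : R) (W : R -> R[i]).

Lemma lip1_derive (f df : R -> R) : (forall x, is_derive x 1 f (df x)) ->
  (forall x, `|df x| <= 1) -> forall x y, `|f x - f y| <= `|x - y|.
Proof.
move=> fd df1.
have H x y : x < y -> `|f x - f y| <= `|x - y|.
  move=> xy; have [|c _ E] := @MVT _ f df x y xy.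
    by apply: derivable_within_continuous => z _; case: (fd z).
  by rewrite distrC E normrM [leRHS]distrC ler_piMl.
move=> x y; case: (ltgtP x y) => [/H//|/H|->]; last by rewrite !subrr normr0.
by rewrite distrC [leRHS]distrC.
Qed.

Lemma cos_lip x y : `|cos x - cos y| <= `|x - y|.
Proof.
apply: (@lip1_derive _ (fun x => - sin x)) => z.
by rewrite normrN sin_bounded1.
Qed.

Lemma sin_lip x y : `|sin x - sin y| <= `|x - y|.
Proof.
apply: (@lip1_derive _ cos) => z.
exact: cos_bounded1.
Qed.

(** A majorant, up to constants, for the variation of both the symbol and the trigonometric factors:
    it is bounded, so [A] and [B] dominate, and it tends to 0 with [t] at each frequency. *)
Definition min1 (t xi : R) : R := Num.min 1 (t * `|xi|).

Lemma min1_ge0 t xi : 0 <= t -> 0 <= min1 t xi.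
Proof. by move=> t0; rewrite /min1 le_min ler01 mulr_ge0. Qed.

Lemma min1_le1 t xi : min1 t xi <= 1.
Proof. by rewrite /min1 ge_min lexx. Qed.

Lemma measurable_min1 t : measurable_fun setT (min1 t).
Proof.
by apply: measurable_minr => //; exact: measurable_funM.
Qed.

Lemma le_2min1 (a t xi : R) : a <= 2 -> a <= 2 * (t * `|xi|) -> a <= 2 * min1 t xi.
Proof. by move=> a2 at_; rewrite /min1 minr_pMr ?mulr1 ?le_min ?a2. Qed.

Lemma integ_min1_small f (e : R) : summable1 f -> (forall x, 0 <= f x) -> 0 < e ->
  exists2 t, 0 < t & integ (fun xi => f xi * min1 t xi) < e.
Proof.
move=> sf f0 e0; have mf := summable1_mfun sf.
have [|||||_ H] := @dominated_integ _ (fun n xi => f xi * min1 n.+1%:R^-1 xi) (fun=> 0) f.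
- by move=> n; apply: measurable_funM => //; exact: measurable_min1.
- exact: measurable_cst.
- exact: sf.
- move=> n xi; rewrite normrM (ger0_norm (f0 xi)) ger0_norm ?min1_ge0 ?invr_ge0//.
  by rewrite ler_piMr// min1_le1.
- move=> xi; rewrite -(mulr0 (f xi)); apply: cvgM; first exact: cvg_cst.
  have K : n.+1%:R^-1 * `|xi| @[n --> \oo] --> (0 : R).
    by rewrite -(mul0r `|xi|); apply: cvgM; [exact: cvg_harmonic|exact: cvg_cst].
  apply: (squeeze_cvgr _ (cvg_cst 0) K); apply: nearW => n.
  by rewrite min1_ge0 ?invr_ge0//= /min1 ge_min lexx orbT.
rewrite integ0 in H.
move/cvgrPdist_lt : H => /(_ _ e0)[N _ /(_ N (leqnn N))] HN.
exists N.+1%:R^-1; first by rewrite invr_gt0.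
by apply: le_lt_trans HN; rewrite sub0r normrN ler_norm.
Qed.

Definition uniformly_cont f :=
  forall e, 0 < e -> exists2 t, 0 < t & forall x y, `|x - y| <= t -> `|f x - f y| <= e.

Lemma square_summable_tail f (e : R) : square_summable f -> 0 < e ->
  exists n : nat, integ (fun x => f x ^+ 2 - cut (fun y => f y ^+ 2) n%:R x) < e.
Proof.
move=> [mf sf] e0; have mf2 := summable1_mfun sf.
have [|||||_ H] := @dominated_integ _ (fun n x => f x ^+ 2 - cut (fun y => f y ^+ 2) n%:R x)
   (fun=> 0) (fun x => f x ^+ 2).
- by move=> n; apply: measurable_funB => //; exact: measurable_cut.
- exact: measurable_cst.
- exact: sf.
- move=> n x; rewrite ger0_norm.
    by rewrite gerBl /cut mulr_ge0 ?sqr_ge0// indicE; case: (_ \in _).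
  rewrite subr_ge0 /cut indicE; case: (_ \in _); first by rewrite mulr1.
  by rewrite mulr0 sqr_ge0.
- move=> x; rewrite -(subrr (f x ^+ 2)); apply: cvgB; first exact: cvg_cst.
  exact: cut_cvg.
rewrite integ0 in H.
move/cvgrPdist_lt : H => /(_ _ e0)[N _ /(_ N (leqnn N))] HN.
by exists N; apply: le_lt_trans HN; rewrite sub0r normrN ler_norm.
Qed.

(** Barbalat's argument: a value above [e] far out forces [|f| >= e / 2] on an interval of fixed
    length [t], hence a mass [(e / 2) ^+ 2 * t] in the tail of the square of [f]. *)
Lemma uniformly_cont_decay f (e : R) : square_summable f -> uniformly_cont f -> 0 < e ->
  exists M, forall x, M <= `|x| -> `|f x| <= e.
Proof.
move=> Lf uf e0; have e20 : 0 < e / 2 by rewrite divr_gt0.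
have [t t0 Ht] := uf _ e20.
have d0 : 0 < (e / 2) ^+ 2 * t by rewrite mulr_gt0 ?exprn_gt0.
have [n Hn] := square_summable_tail Lf d0.
(* The margin [t] keeps the whole interval from [x] to [x + t] outside [[-n, n]], also when [x] is
   negative. *)
exists (n%:R + t + 1) => x xM; rewrite leNgt; apply/negP => fx.
move: Hn; apply/negP; rewrite -leNgt.
pose J := `[x, x + t]%classic.
have [mf sf] := Lf.
have scut : summable1 (fun x => f x ^+ 2 - cut (fun y => f y ^+ 2) n%:R x).
  apply: summable1B => //.
  apply: (summable1_le _ sf); first by apply: measurable_cut; exact: measurable_funX.
  move=> y; apply: (le_trans (cut_le _ _ _)).
  by rewrite ger0_norm ?sqr_ge0.
have mJm : measurable J by exact: measurable_itv.
have mJ : integ (fun y => (e / 2) ^+ 2 * \1_J y) = (e / 2) ^+ 2 * t.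
  rewrite integZ; last exact: integrable_indic_itv.
  have -> : integ \1_J = t; last by [].
  rewrite /integ /Rintegral integral_indic//= setIT lebesgue_measure_itv/= lte_fin.
  by rewrite ltrDl t0/=; ring.
rewrite -mJ; apply: integ_le => //.
  by apply: summable1Z; exact: integrable_indic_itv.
move=> y; rewrite indicE; case: (boolP (y \in J)) => [|_]; last first.
  rewrite mulr0 subr_ge0 /cut indicE; case: (_ \in _); first by rewrite mulr1.
  by rewrite mulr0 sqr_ge0.
rewrite inE /J/= in_itv/= => /andP[xy yx]; rewrite mulr1.
have -> : cut (fun y => f y ^+ 2) n%:R y = 0.
  rewrite /cut indicE memNset ?mulr0//= in_itv/= => /andP[h1 h2].
  move: xM; apply/negP; rewrite -ltNge ltr_norml; apply/andP; split; lra.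
rewrite subr0 -[f y ^+ 2]real_normK ?num_real// lerXn2r ?nnegrE ?(ltW e20)//.
have : `|f x - f y| <= e / 2.
  by apply: Ht; rewrite distrC ger0_norm; lra.
have := ler_normD (f y) (f x - f y); rewrite [f y + _]addrC subrK.
move: fx; lra.
Qed.

Section Representation.
Variables (h : R) (E : R[i] -> R[i]) (A B : R -> R).
Hypothesis h0 : 0 < h.
Hypotheses (sA : summable1 A) (sB : summable1 B).
Hypotheses (LA : square_summable A) (LB : square_summable B).
Hypothesis rep : forall b x, - h <= b <= 0 ->
      2 * pi * Re (E (x +i* b)) =
        integ (fun xi => strip_symbol h b xi * (A xi * cos (x * xi) - B xi * sin (x * xi))) /\
      2 * pi * Im (E (x +i* b)) =
        integ (fun xi => strip_symbol h b xi * (A xi * sin (x * xi) + B xi * cos (x * xi))).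

Let D xi := `|A xi| + `|B xi|.
Let sD : summable1 D. Proof. by apply: summable1D; exact: summable1_norm. Qed.
Let D0 xi : 0 <= D xi. Proof. by rewrite addr_ge0. Qed.
Let p0 : 0 < 2 * pi :> R. Proof. by rewrite mulr_gt0// pi_gt0. Qed.

Let mm b : measurable_fun setT (strip_symbol h b).
Proof. by apply: measurable_contR; exact: cont_strip_symbol. Qed.

Let mb2 b xi : - h <= b <= 0 -> `|strip_symbol h b xi| <= 2.
Proof. by move=> hb; rewrite ger0_norm ?strip_symbol_ge0// strip_symbol_le2. Qed.

Let smm b f : - h <= b <= 0 -> summable1 f -> summable1 (fun xi => strip_symbol h b xi * f xi).
Proof.
move=> hb sf; apply: eq_summable1 (summable1M (mm b) (fun xi => mb2 xi hb) sf) => xi.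
by rewrite mulrC.
Qed.

Let sre b x : - h <= b <= 0 ->
  summable1 (fun xi => strip_symbol h b xi * (A xi * cos (x * xi) - B xi * sin (x * xi))).
Proof. by move=> hb; apply: smm => //; apply: summable1B; [exact: summable1_cosM|exact: summable1_sinM]. Qed.

Let sim b x : - h <= b <= 0 ->
  summable1 (fun xi => strip_symbol h b xi * (A xi * sin (x * xi) + B xi * cos (x * xi))).
Proof. by move=> hb; apply: smm => //; apply: summable1D; [exact: summable1_sinM|exact: summable1_cosM]. Qed.

(** The symbol is at most 2 and the trigonometric factors at most 1, so the integral of [2 * D]
    bounds the representation at all points. *)
Lemma strip_bounded : exists2 K, 0 <= K & forall b x, - h <= b <= 0 ->
  `|Re (E (x +i* b))| <= K /\ `|Im (E (x +i* b))| <= K.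
Proof.
exists (integ (fun xi => 2 * D xi) / (2 * pi)).
  by rewrite divr_ge0 ?(ltW p0)// integ_ge0// => xi; rewrite mulr_ge0.
move=> b x hb; have [r i] := rep x hb.
have trig (a c u v : R) : `|u| <= 1 -> `|v| <= 1 -> `|a * u + c * v| <= `|a| + `|c|.
  move=> u1 v1; apply: (le_trans (ler_normD _ _)); rewrite !normrM.
  by rewrite lerD// ler_piMr.
split; rewrite ler_pdivlMr// mulrC -[2 * pi]ger0_norm ?(ltW p0)// -normrM ?r ?i.
  apply: integ_norm_le; [exact: sre|exact: summable1Z|move=> xi].
  rewrite normrM ler_pM// ?mb2// -mulrN; apply: trig; first exact: cos_bounded1.
  by rewrite normrN sin_bounded1.
apply: integ_norm_le; [exact: sim|exact: summable1Z|move=> xi].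
by rewrite normrM ler_pM// ?mb2//; apply: trig; [exact: sin_bounded1|exact: cos_bounded1].
Qed.

Let diff_le b b' (t u u' v v' xi : R) : - h <= b <= 0 -> - h <= b' <= 0 -> `|b - b'| <= t ->
  `|u| <= 1 -> `|v| <= 1 -> `|u - u'| <= 2 * min1 t xi -> `|v - v'| <= 2 * min1 t xi ->
  `|strip_symbol h b xi * (A xi * u + B xi * v) -
    strip_symbol h b' xi * (A xi * u' + B xi * v')| <= 6 * (D xi * min1 t xi).
Proof.
move=> hb hb' bt u1 v1 uu vv.
have t0 : 0 <= t by apply: le_trans bt.
have m0 := min1_ge0 xi t0.
have -> : strip_symbol h b xi * (A xi * u + B xi * v) -
    strip_symbol h b' xi * (A xi * u' + B xi * v') =
    (strip_symbol h b xi - strip_symbol h b' xi) * (A xi * u + B xi * v) +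
    strip_symbol h b' xi * (A xi * (u - u') + B xi * (v - v')) by ring.
have -> : 6 * (D xi * min1 t xi) = (2 * min1 t xi) * D xi + 2 * (D xi * (2 * min1 t xi)) by ring.
apply: (le_trans (ler_normD _ _)).
rewrite [X in X + _]normrM [X in _ + X]normrM; apply: lerD.
  apply: ler_pM => //.
    apply: le_2min1.
      have := strip_symbol_le2 xi hb; have := strip_symbol_le2 xi hb'.
      have := strip_symbol_ge0 h b xi; have := strip_symbol_ge0 h b' xi.
      by rewrite ler_norml => ? ? ? ?; apply/andP; split; lra.
    apply: (le_trans (strip_symbol_lip xi hb hb')).
    by rewrite ler_wpM2l// ler_wpM2r.
  apply: (le_trans (ler_normD _ _)); rewrite !normrM.
  by rewrite lerD// ler_piMr.
apply: ler_pM => //; first exact: mb2.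
apply: (le_trans (ler_normD _ _)); rewrite !normrM /D mulrDl.
by apply: lerD; rewrite ler_wpM2l.
Qed.

(** By [diff_le] the variation is at most the integral of [6 * D * min1 t], which tends to 0 with
    [t] and does not depend on the point. Thus the continuity is uniform on the whole unbounded
    strip. *)
Lemma strip_uniform (e : R) : 0 < e -> exists2 t, 0 < t & forall b b' x x',
  - h <= b <= 0 -> - h <= b' <= 0 -> `|x - x'| <= t -> `|b - b'| <= t ->
  `|Re (E (x +i* b)) - Re (E (x' +i* b'))| <= e /\
  `|Im (E (x +i* b)) - Im (E (x' +i* b'))| <= e.
Proof.
move=> e0; have e1 : 0 < e * (2 * pi) / 6 by rewrite divr_gt0// mulr_gt0.
have [t t0 It] := integ_min1_small sD D0 e1.
exists t => // b b' x x' hb hb' xx bb.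
have smin : summable1 (fun xi => 6 * (D xi * min1 t xi)).
  apply: summable1Z; apply: (@summable1M _ _ _ 1) => //; first exact: measurable_min1.
  by move=> xi; rewrite ger0_norm ?min1_le1// min1_ge0// ltW.
have cosd xi : `|cos (x * xi) - cos (x' * xi)| <= 2 * min1 t xi.
  apply: le_2min1.
    apply: (le_trans (ler_normB _ _)).
    by have := cos_bounded1 (x * xi); have := cos_bounded1 (x' * xi); lra.
  apply: (le_trans (cos_lip _ _)); rewrite -mulrBl normrM.
  have : `|x - x'| * `|xi| <= t * `|xi| by rewrite ler_wpM2r.
  by have : 0 <= `|x - x'| * `|xi| by []; lra.
have sind xi : `|sin (x * xi) - sin (x' * xi)| <= 2 * min1 t xi.
  apply: le_2min1.
    apply: (le_trans (ler_normB _ _)).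
    by have := sin_bounded1 (x * xi); have := sin_bounded1 (x' * xi); lra.
  apply: (le_trans (sin_lip _ _)); rewrite -mulrBl normrM.
  have : `|x - x'| * `|xi| <= t * `|xi| by rewrite ler_wpM2r.
  by have : 0 <= `|x - x'| * `|xi| by []; lra.
have [r i] := rep x hb; have [r' i'] := rep x' hb'.
have fin (u v : R) : `|2 * pi * u - 2 * pi * v| <= integ (fun xi => 6 * (D xi * min1 t xi)) ->
    `|u - v| <= e.
  rewrite integZ; last first.
    apply: (@summable1M _ _ _ 1) => //; first exact: measurable_min1.
    by move=> xi; rewrite ger0_norm ?min1_le1// min1_ge0// ltW.
  rewrite -mulrBr normrM (ger0_norm (ltW p0)) => H.
  have : 2 * pi * `|u - v| <= 2 * pi * e.
    apply: (le_trans H); move: It; rewrite ltr_pdivlMr// => /ltW.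
    by rewrite mulrC [e * _]mulrC.
  by rewrite ler_pM2l.
split; apply: fin; rewrite ?r ?r' ?i ?i' -integB; try exact: sre; try exact: sim.
  apply: integ_norm_le => //; first by apply: summable1B; exact: sre.
  move=> xi; have := @diff_le b b' t (cos (x * xi)) (cos (x' * xi)) (- sin (x * xi))
    (- sin (x' * xi)) xi hb hb' bb (cos_bounded1 _).
  rewrite normrN -opprD normrN => /(_ (sin_bounded1 _) (cosd xi) (sind xi)).
  by rewrite !mulrN.
apply: integ_norm_le => //; first by apply: summable1B; exact: sim.
move=> xi; apply: diff_le => //; [exact: sin_bounded1|exact: cos_bounded1].
Qed.

(** Along one horizontal line decay follows from square summability and uniform continuity. Uniform
    continuity in the height carries it over to a band of width [t], and finitely many lines at
    spacing [t] cover the strip; [grid] climbs them one at a time. *)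
Lemma strip_decay (e : R) : 0 < e ->
  (forall b, - h <= b <= 0 -> square_summable (fun x => Re (E (x +i* b))) /\
                              square_summable (fun x => Im (E (x +i* b)))) ->
  exists M, forall b x, - h <= b <= 0 -> M <= `|x| ->
    `|Re (E (x +i* b))| <= e /\ `|Im (E (x +i* b))| <= e.
Proof.
move=> e0 L2; have e20 : 0 < e / 2 by rewrite divr_gt0.
have [t t0 Ht] := strip_uniform e20.
have line b : - h <= b <= 0 -> exists M, forall x, M <= `|x| ->
    `|Re (E (x +i* b))| <= e / 2 /\ `|Im (E (x +i* b))| <= e / 2.
  move=> hb; have [Lr Li] := L2 b hb.
  have ur : uniformly_cont (fun x => Re (E (x +i* b))).
    move=> d /strip_uniform[s s0 Hs]; exists s => // x y xy.
    by have [] := Hs b b x y hb hb xy; rewrite // subrr normr0 ltW.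
  have ui : uniformly_cont (fun x => Im (E (x +i* b))).
    move=> d /strip_uniform[s s0 Hs]; exists s => // x y xy.
    by have [] := Hs b b x y hb hb xy; rewrite // subrr normr0 ltW.
  have [M1 H1] := uniformly_cont_decay Lr ur e20.
  have [M2 H2] := uniformly_cont_decay Li ui e20.
  exists (Num.max M1 M2) => x; rewrite ge_max => /andP[x1 x2].
  by split; [exact: H1|exact: H2].
have grid (n : nat) : exists M, forall b x, - h <= b <= 0 -> b <= - h + n%:R * t -> M <= `|x| ->
    `|Re (E (x +i* b))| <= e /\ `|Im (E (x +i* b))| <= e.
  elim: n => [|n [M HM]].
    have hh : - h <= - h <= 0 by rewrite lexx oppr_le0 ltW.
    have [M HM] := line _ hh; exists M => b x hb; rewrite mul0r addr0 => bh xM.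
    have -> : b = - h by apply/eqP; rewrite eq_le bh; case/andP: hb.
    by have [] := HM x xM; split; lra.
  have [hn|hn] := leP (- h + n%:R * t) 0; last first.
    by exists M => b x hb _; apply: HM => //; case/andP: hb => _ /le_trans; apply; exact: ltW.
  have hbn : - h <= - h + n%:R * t <= 0 by rewrite hn lerDl mulr_ge0// ltW.
  have [M' HM'] := line _ hbn.
  exists (Num.max M M') => b x hb bn; rewrite ge_max => /andP[x1 x2].
  have [b1|b1] := leP b (- h + n%:R * t); first exact: HM.
  have [H1 H2] := HM' x x2.
  have bt : `|b - (- h + n%:R * t)| <= t.
    rewrite ger0_norm; last by rewrite subr_ge0 ltW.
    move: bn; rewrite -natr1 mulrDl mul1r; lra.
  have xx : `|x - x| <= t by rewrite subrr normr0 ltW.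
  have [H3 H4] := Ht _ _ _ _ hb hbn xx bt.
  have tri (u v : R) : `|v| <= e / 2 -> `|u - v| <= e / 2 -> `|u| <= e.
    by move=> ? ?; rewrite -[u](subrK v) (le_trans (ler_normD _ _))//; lra.
  by split; [exact: tri H1 H3|exact: tri H2 H4].
have [n Hn] : exists n : nat, h <= n%:R * t.
  exists (Num.truncn (h / t)).+1; rewrite -ler_pdivrMr// ltW// .
  exact: truncnS_gt.
have [M HM] := grid n; exists M => b x hb; apply: HM => //.
by case/andP: hb => _; lra.
Qed.

(** The transform of an increment carries a factor of size [|s| * |xi|], which the bottom symbol
    turns into [2 / h * |s|]; Bessel's inequality then leads back to the increment itself. *)
Lemma bottom_difference_bound : exists2 C, 0 <= C & forall s : R,
  square_summable (fun x => Re (E ((x + s) -i* h)) - Re (E (x -i* h))) /\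
  integ (fun x => (Re (E ((x + s) -i* h)) - Re (E (x -i* h))) ^+ 2) <= C * s ^+ 2.
Proof.
have hh : - h <= - h <= 0 by rewrite lexx oppr_le0 ltW.
pose I2 := integ (fun xi => A xi ^+ 2) + integ (fun xi => B xi ^+ 2).
have I20 : 0 <= I2 by rewrite addr_ge0// integ_ge0// => xi; exact: sqr_ge0.
pose C := 2 * (2 * pi * (2 * (2 / h) ^+ 2 * I2) + 2 * pi * (2 * (2 / h) ^+ 2 * I2)) / (2 * pi) ^+ 2.
have C0 : 0 <= C.
  have pp := ltW p0.
  rewrite /C divr_ge0 ?sqr_ge0// mulr_ge0// addr_ge0//.
    by rewrite mulr_ge0// mulr_ge0// mulr_ge0// sqr_ge0.
  by rewrite mulr_ge0// mulr_ge0// mulr_ge0// sqr_ge0.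
exists C => // s.
(* [P] and [Q] are the coefficients of [cos (x * xi)] and [sin (x * xi)] once the addition formulas
   are applied to the representation at [x + s]. *)
pose P xi := strip_symbol h (- h) xi * (A xi * (cos (s * xi) - 1) - B xi * sin (s * xi)).
pose Q xi := strip_symbol h (- h) xi * (- (A xi * sin (s * xi)) - B xi * (cos (s * xi) - 1)).
have mA := summable1_mfun sA; have mB := summable1_mfun sB.
have mc : measurable_fun setT (fun xi => cos (s * xi)).
  by apply: measurable_contR; exact: cont_cosM.
have ms : measurable_fun setT (fun xi => sin (s * xi)).
  by apply: measurable_contR; exact: cont_sinM.
have mP : measurable_fun setT P.
  apply: measurable_funM => //; apply: measurable_funB; apply: measurable_funM => //.
  exact: measurable_funB.
have mQ : measurable_fun setT Q.
  apply: measurable_funM => //; apply: measurable_funB.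
    by apply: measurableT_comp => //; exact: measurable_funM.
  by apply: measurable_funM => //; exact: measurable_funB.
have c1 xi : `|cos (s * xi) - 1| <= `|s| * `|xi|.
  by rewrite -normrM -[1]cos0 (le_trans (cos_lip _ _))// subr0.
have s1 xi : `|sin (s * xi)| <= `|s| * `|xi|.
  by rewrite -normrM -[sin _]subr0 -sin0 (le_trans (sin_lip _ _))// subr0.
have bnd (a c u v xi : R) : `|u| <= `|s| * `|xi| -> `|v| <= `|s| * `|xi| ->
   `|strip_symbol h (- h) xi * (a * u + c * v)| <= (2 / h * `|s|) * (`|a| + `|c|).
  move=> hu hv; rewrite normrM ger0_norm ?strip_symbol_ge0//.
  apply: (@le_trans _ _ (strip_symbol h (- h) xi * (`|s| * `|xi| * (`|a| + `|c|)))).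
    rewrite ler_wpM2l ?strip_symbol_ge0// (le_trans (ler_normD _ _))// !normrM.
    by rewrite mulrDr; apply: lerD; rewrite mulrC ler_wpM2r.
  rewrite !mulrA ler_wpM2r ?addr_ge0//.
  have := ler_wpM2r (normr_ge0 s) (strip_symbol_bottom_le xi h0).
  by apply: le_trans; rewrite le_eqVlt; apply/orP; left; apply/eqP; ring.
have bP xi : `|P xi| <= (2 / h * `|s|) * D xi.
  by rewrite /P -mulrN; apply: bnd => //; rewrite normrN.
have bQ xi : `|Q xi| <= (2 / h * `|s|) * D xi.
  rewrite /Q -!mulrN; apply: bnd; rewrite normrN//.
have LD : square_summable D by apply: square_summableD; exact: square_summable_norm.
have k0 : 0 <= 2 / h * `|s| by rewrite mulr_ge0// divr_ge0// ltW.
have gen (T : R -> R) : measurable_fun setT T -> (forall xi, `|T xi| <= (2 / h * `|s|) * D xi) ->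
    [/\ summable1 T, square_summable T &
    integ (fun xi => T xi ^+ 2) <= (2 * (2 / h) ^+ 2 * I2) * s ^+ 2].
  move=> mT bT; split.
  - exact: (summable1_le mT (summable1Z _ sD)).
  - apply: (square_summable_le mT (square_summableZ (2 / h * `|s|) LD)) => xi.
    by rewrite [leRHS]ger0_norm// mulr_ge0.
  have -> : (2 * (2 / h) ^+ 2 * I2) * s ^+ 2 = (2 / h * `|s|) ^+ 2 * (2 * I2).
    by rewrite [in RHS]exprMn real_normK ?num_real//; ring.
  apply: (@le_trans _ _ (integ (fun xi => (2 / h * `|s|) ^+ 2 * D xi ^+ 2))).
    apply: integ_le.
    - by have [] := square_summable_le mT (square_summableZ (2 / h * `|s|) LD) (fun xi => le_trans (bT xi) (ler_norm _)).
    - by apply: summable1Z; case: LD.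
    move=> xi; rewrite -exprMn -[T xi ^+ 2]real_normK ?num_real// lerXn2r ?nnegrE//.
    by rewrite mulr_ge0.
  rewrite integZ; last by case: LD.
  rewrite ler_wpM2l ?sqr_ge0// mulrDr.
  have := integ_sqrD (square_summable_norm LA) (square_summable_norm LB).
  have nE f : integ (fun x => `|f x| ^+ 2) = integ (fun x => f x ^+ 2).
    by apply: eq_integ => x; rewrite real_normK ?num_real.
  by rewrite !nE.
have [sP LP IP] := gen P mP bP; have [sQ LQ IQ] := gen Q mQ bQ.
have [cP _ BP] := bessel_fourier sP LP; have [_ sQ' BQ] := bessel_fourier sQ LQ.
have FE x : Re (E ((x + s) -i* h)) - Re (E (x -i* h)) =
    (2 * pi)^-1 * (fourier_cos P x + fourier_sin Q x).
  have [r _] := rep (x + s) hh; have [r' _] := rep x hh.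
  have -> : Re (E ((x + s) -i* h)) - Re (E (x -i* h)) =
     (2 * pi)^-1 * (2 * pi * Re (E ((x + s) -i* h)) - 2 * pi * Re (E (x -i* h))).
    by rewrite -mulrBr mulKf// gt_eqF.
  rewrite r r' -integB; [|exact: sre|exact: sre].
  rewrite /fourier_cos /fourier_sin -integD; [|exact: summable1_cosM|exact: summable1_sinM].
  congr (_ * _); apply: eq_integ => xi.
  by rewrite /P /Q mulrDl cosD sinD; ring.
have LF : square_summable (fun x => fourier_cos P x + fourier_sin Q x).
  exact: square_summableD.
split.
  by under eq_fun do rewrite FE; exact: square_summableZ.
under eq_integ do rewrite FE exprMn.
rewrite integZ; last by case: LF.
have H := integ_sqrD cP sQ'.
have cos0' : 0 <= integ (fun x => fourier_sin P x ^+ 2) by apply: integ_ge0 => x; exact: sqr_ge0.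
have sin0' : 0 <= integ (fun x => fourier_cos Q x ^+ 2) by apply: integ_ge0 => x; exact: sqr_ge0.
rewrite exprVn mulrC ler_pdivrMr ?exprn_gt0//.
have -> : C * s ^+ 2 * (2 * pi) ^+ 2 =
   2 * (2 * pi * (2 * (2 / h) ^+ 2 * I2 * s ^+ 2)) + 2 * (2 * pi * (2 * (2 / h) ^+ 2 * I2 * s ^+ 2)).
  rewrite /C; move: p0; move: (2 * pi) => q q0; field.
  by rewrite !gt_eqF.
apply: (le_trans H); apply: lerD; rewrite ler_wpM2l//.
  apply: (@le_trans _ _ (2 * pi * integ (fun x => P x ^+ 2))).
    by apply: le_trans BP; rewrite lerDl.
  by rewrite ler_wpM2l// ltW.
apply: (@le_trans _ _ (2 * pi * integ (fun x => Q x ^+ 2))).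
  by apply: le_trans BQ; rewrite lerDr.
by rewrite ler_wpM2l// ltW.
Qed.

End Representation.

End StripBounds.
(** * Goursat's and Cauchy's theorems in the strip *)

Section Goursat.
Variable R : realType.
Local Notation mu := (@lebesgue_measure R).
Implicit Types (f g : R -> R) (a b c x y w l e : R).

Definition segint f a b : R := Rintegral mu `[a, b] f.

Lemma segint_integrable f a b : (forall t, a <= t <= b -> {for t, continuous (f : R -> R)}) ->
  mu.-integrable `[a, b] (EFin \o f).
Proof.
move=> cf; apply: continuous_compact_integrable; first exact: segment_compact.
apply: continuous_in_subspaceT => t; rewrite inE/= in_itv/= => tab.
exact: cf.
Qed.

Lemma segint_integrableB f g a b : mu.-integrable `[a, b] (EFin \o f) ->
  mu.-integrable `[a, b] (EFin \o g) -> mu.-integrable `[a, b] (EFin \o (fun t => f t - g t)).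
Proof.
move=> fi gi.
suff : mu.-integrable `[a, b] ((EFin \o f) \- (EFin \o g))%E by apply: eq_integrable.
by apply: integrableB => //; exact: measurable_itv.
Qed.

Lemma segint_split f a b c : a <= b -> b <= c ->
  mu.-integrable `[a, c] (EFin \o f) -> segint f a c = segint f a b + segint f b c.
Proof.
move=> ab bc fi; rewrite /segint.
have := @Rintegral_itvB _ f (BLeft a) (BRight c) b fi.
rewrite bnd_simp => /(_ ab); rewrite bnd_simp => /(_ bc) H.
rewrite -[X in _ + X]Rintegral_itv_obnd_cbnd; last first.
  by apply: integrableS fi => // t /=; rewrite !in_itv/= => /andP[/ltW bt ->]; rewrite (le_trans ab bt).
by rewrite -H addrC subrK.
Qed.

Lemma segint_near f a b c (M : R) : a <= b -> mu.-integrable `[a, b] (EFin \o f) ->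
  (forall t, a <= t <= b -> `|f t - c| <= M) ->
  `|segint f a b - c * (b - a)| <= M * (b - a).
Proof.
move=> ab fi H.
have mI : measurable (`[a, b]%classic : set R) by exact: measurable_itv.
have fin : (mu `[a, b] < +oo)%E.
  by rewrite lebesgue_measure_itv/=; case: ifP => _; rewrite ?ltry// -EFinD ltry.
have ci (k : R) : mu.-integrable `[a, b] (EFin \o cst k).
  by apply: measurable_bounded_integrable => //; exact: bounded_cst.
have kE (k : R) : segint (cst k) a b = k * (b - a).
  transitivity (k * fine (mu `[a, b]%classic)); first exact: Rintegral_cst.
  rewrite lebesgue_measure_itv/= lte_fin.
  case: ifP => [_|/negbT]; first by rewrite -EFinD.
  rewrite -leNgt => ba; have -> : b = a by apply/eqP; rewrite eq_le ba ab.
  by rewrite subrr.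
have fci : mu.-integrable `[a, b] (EFin \o (fun t => f t - c)).
  by apply: segint_integrableB => //; exact: ci.
rewrite -kE -[in leRHS]kE /segint -RintegralB//; last exact: ci.
apply: le_trans; first by apply: le_normr_Rintegral => //; exact: measurable_itv.
apply: le_Rintegral => //; first exact: (integrable_norm fci).
exact: ci.
Qed.

Section Field.
Variables (c0 d0 : R) (P Q : R -> R -> R).

(* The common coefficient [b] says that the field [(P, Q)] is curl-free at the point. *)
Hypothesis diffPQ : forall x0 y0, c0 < y0 < d0 -> exists a b c : R,
  forall e, 0 < e -> exists2 eta, 0 < eta & forall x y, `|x - x0| < eta -> `|y - y0| < eta ->
    `|P x y - (P x0 y0 + a * (x - x0) + b * (y - y0))| <= e * (`|x - x0| + `|y - y0|) /\
    `|Q x y - (Q x0 y0 + b * (x - x0) + c * (y - y0))| <= e * (`|x - x0| + `|y - y0|).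

Let field_continuous x0 y0 : c0 < y0 < d0 -> forall e, 0 < e ->
  exists2 eta, 0 < eta & forall x y, `|x - x0| < eta -> `|y - y0| < eta ->
    `|P x y - P x0 y0| < e /\ `|Q x y - Q x0 y0| < e.
Proof.
move=> y0S e e0; have [a [b [c H]]] := diffPQ x0 y0S.
have [eta1 eta10 {}H] := H 1 ltr01.
pose k := `|a| + `|b| + `|c| + 1.
have k0 : 0 < k by rewrite /k ltr_wpDl// !addr_ge0.
have ek : 0 < e / (4 * k) by rewrite divr_gt0// mulr_gt0.
exists (Num.min eta1 (e / (4 * k))); first by rewrite lt_min eta10.
move=> x y; rewrite !lt_min => /andP[x1 x2] /andP[y1 y2].
have [HP HQ] := H x y x1 y1.
have key (u v F F0 : R) : `|u| <= k - 1 -> `|v| <= k - 1 ->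
   `|F - (F0 + u * (x - x0) + v * (y - y0))| <= 1 * (`|x - x0| + `|y - y0|) -> `|F - F0| < e.
  move=> uk vk FF.
  have -> : F - F0 = (F - (F0 + u * (x - x0) + v * (y - y0))) + (u * (x - x0) + v * (y - y0)) by ring.
  apply: (le_lt_trans (ler_normD _ _)).
  have h1 : `|u * (x - x0) + v * (y - y0)| <= (k - 1) * (`|x - x0| + `|y - y0|).
    apply: (le_trans (ler_normD _ _)); rewrite !normrM mulrDr.
    by apply: lerD; rewrite ler_wpM2r.
  have h2 : k * (`|x - x0| + `|y - y0|) < e.
    have : `|x - x0| + `|y - y0| < 2 * (e / (4 * k)) by lra.
    have -> : e = k * (4 * (e / (4 * k))) by field; rewrite gt_eqF.
    move=> h; rewrite ltr_pM2l//; apply: (lt_le_trans h).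
    have : e / (4 * k) = k * (4 * (e / (4 * k))) / (4 * k) by field; rewrite gt_eqF.
    by move=> <-; lra.
  lra.
have na := normr_ge0 a; have nb := normr_ge0 b; have nc := normr_ge0 c.
by split; [apply: key HP|apply: key HQ]; rewrite /k; lra.
Qed.

Let contP y : c0 < y < d0 -> forall x, {for x, continuous (P ^~ y : R -> R)}.
Proof.
move=> hy x; apply/cvgrPdist_lt => e e0; have [eta eta0 H] := field_continuous x hy e0.
exists eta => //= t xt; rewrite distrC; have yy : `|y - y| < eta by rewrite subrr normr0.
by have [] := H t y _ yy; first by rewrite distrC.
Qed.

Let contQ x y : c0 < y < d0 -> {for y, continuous (Q x : R -> R)}.
Proof.
move=> hy; apply/cvgrPdist_lt => e e0; have [eta eta0 H] := field_continuous x hy e0.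
exists eta => //= t xt; rewrite distrC; have xx : `|x - x| < eta by rewrite subrr normr0.
by have [] := H x t xx _; first by rewrite distrC.
Qed.

Let iP y a b : c0 < y < d0 -> mu.-integrable `[a, b] (EFin \o P ^~ y).
Proof. by move=> hy; apply: segint_integrable => t _; exact: contP. Qed.

Lemma field_integrable x a b : c0 < a -> b < d0 -> mu.-integrable `[a, b] (EFin \o Q x).
Proof.
move=> ca bd; apply: segint_integrable => t /andP[ta tb]; apply: contQ.
by rewrite (lt_le_trans ca ta) (le_lt_trans tb bd).
Qed.

(** The circulation of [(P, Q)] counterclockwise along the boundary of the rectangle with lower left
    corner [(x, y)], width [w] and height [l]. *)
Definition loopint x y w l : R :=
  segint (P ^~ y) x (x + w) - segint (P ^~ (y + l)) x (x + w) +
  (segint (Q (x + w)) y (y + l) - segint (Q x) y (y + l)).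

(** The inner sides are traversed twice in opposite directions. *)
Lemma loopint_quarter x y w l : 0 <= w -> 0 <= l -> c0 < y -> y + l + l < d0 ->
  loopint x y (w + w) (l + l) = loopint x y w l + loopint (x + w) y w l +
    loopint x (y + l) w l + loopint (x + w) (y + l) w l.
Proof.
move=> w0 l0 cy yd; rewrite /loopint.
have hP z : c0 < z < d0 -> segint (P ^~ z) x (x + (w + w)) =
    segint (P ^~ z) x (x + w) + segint (P ^~ z) (x + w) (x + w + w).
  by move=> hz; rewrite addrA; apply: segint_split; rewrite ?lerDl//; exact: iP.
have hQ z : segint (Q z) y (y + (l + l)) =
    segint (Q z) y (y + l) + segint (Q z) (y + l) (y + l + l).
  by rewrite addrA; apply: segint_split; rewrite ?lerDl//; exact: field_integrable.
rewrite !hP ?hQ ?addrA; first ring.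
- by apply/andP; split; lra.
- by apply/andP; split; lra.
Qed.

(** An affine field with the common coefficient [b] has no circulation: the horizontal sides give
    [- b l w] and the vertical ones [b w l]. Only the remainder of the expansion is left, integrated
    over four sides. *)
Lemma loopint_small x0 y0 : c0 < y0 < d0 -> forall e, 0 < e ->
  exists2 eta, 0 < eta & forall x y w l, 0 <= w < eta -> 0 <= l < eta -> c0 < y -> y + l < d0 ->
    x <= x0 <= x + w -> y <= y0 <= y + l ->
    `|loopint x y w l| <= 2 * e * (w + l) ^+ 2.
Proof.
move=> hy e e0; have [a [b [c H]]] := diffPQ x0 hy.
have [eta eta0 {}H] := H e e0; exists eta => // x y w l /andP[w0 weta] /andP[l0 leta] cy yd
  /andP[x1 x2] /andP[y1 y2].
have yl : c0 < y < d0 by apply/andP; split; lra.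
have yl' : c0 < y + l < d0 by apply/andP; split; lra.
have near0 (s t : R) : x <= s <= x + w -> y <= t <= y + l ->
    [/\ `|s - x0| <= w, `|t - y0| <= l, `|s - x0| < eta & `|t - y0| < eta].
  move=> /andP[s1 s2] /andP[t1 t2].
  have h1 : `|s - x0| <= w by rewrite ler_norml; apply/andP; split; lra.
  have h2 : `|t - y0| <= l by rewrite ler_norml; apply/andP; split; lra.
  by split => //; [exact: le_lt_trans weta|exact: le_lt_trans leta].
have mono (s t : R) : x <= s <= x + w -> y <= t <= y + l ->
   e * (`|s - x0| + `|t - y0|) <= e * (w + l).
  by move=> hs ht; have [? ? _ _] := near0 s t hs ht; rewrite ler_pM2l//; lra.
have yb : y <= y <= y + l by rewrite lexx lerDl.
have yb' : y <= y + l <= y + l by rewrite lexx lerDl l0.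
have xb : x <= x <= x + w by rewrite lexx lerDl.
have xb' : x <= x + w <= x + w by rewrite lexx lerDl w0.
have DP : `|segint (P ^~ y) x (x + w) - segint (P ^~ (y + l)) x (x + w) - (- (b * l)) * w|
    <= 2 * (e * (w + l)) * w.
  have E : segint (P ^~ y) x (x + w) - segint (P ^~ (y + l)) x (x + w) =
      segint (fun t => P t y - P t (y + l)) x (x + w).
    by rewrite /segint -RintegralB//; exact: iP.
  have xw : x <= x + w by rewrite lerDl.
  have := @segint_near (fun t => P t y - P t (y + l)) x (x + w) (- (b * l)) (2 * (e * (w + l))) xw.
  have -> : x + w - x = w by ring.
  rewrite E; apply.
    by apply: segint_integrableB; exact: iP.
  move=> t ht.
  have [_ _ n1 n2] := near0 t y ht yb; have [HP _] := H t y n1 n2.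
  have [_ _ n1' n2'] := near0 t (y + l) ht yb'; have [HP' _] := H t (y + l) n1' n2'.
  have := le_trans HP (mono _ _ ht yb); have := le_trans HP' (mono _ _ ht yb').
  rewrite !ler_norml => /andP[u1 u2] /andP[v1 v2].
  apply/andP; split; lra.
have DQ : `|segint (Q (x + w)) y (y + l) - segint (Q x) y (y + l) - (b * w) * l|
    <= 2 * (e * (w + l)) * l.
  have E : segint (Q (x + w)) y (y + l) - segint (Q x) y (y + l) =
      segint (fun t => Q (x + w) t - Q x t) y (y + l).
    by rewrite /segint -RintegralB//; exact: field_integrable.
  have yw : y <= y + l by rewrite lerDl.
  have := @segint_near (fun t => Q (x + w) t - Q x t) y (y + l) (b * w) (2 * (e * (w + l))) yw.
  have -> : y + l - y = l by ring.
  rewrite E; apply.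
    by apply: segint_integrableB; exact: field_integrable.
  move=> t ht.
  have [_ _ n1 n2] := near0 x t xb ht; have [_ HQ] := H x t n1 n2.
  have [_ _ n1' n2'] := near0 (x + w) t xb' ht; have [_ HQ'] := H (x + w) t n1' n2'.
  have := le_trans HQ (mono _ _ xb ht); have := le_trans HQ' (mono _ _ xb' ht).
  rewrite !ler_norml => /andP[u1 u2] /andP[v1 v2].
  apply/andP; split; lra.
rewrite /loopint; move: DP DQ.
move: (segint (P ^~ y) x (x + w) - segint (P ^~ (y + l)) x (x + w)) => A.
move: (segint (Q (x + w)) y (y + l) - segint (Q x) y (y + l)) => B DP DQ.
have -> : A + B = (A - (- (b * l)) * w) + (B - (b * w) * l) by ring.
apply: (le_trans (ler_normD _ _)).
have -> : 2 * e * (w + l) ^+ 2 = 2 * (e * (w + l)) * w + 2 * (e * (w + l)) * l by ring.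
exact: lerD.
Qed.

Section Bisection.
Variables (x0 y0 w l : R).
Hypotheses (w0 : 0 <= w) (l0 : 0 <= l) (cy : c0 < y0) (yd : y0 + l < d0).

Let W n : R := w / 2 ^+ n.
Let Lh n : R := l / 2 ^+ n.

(** Moves to the corner of a quarter that carries at least a quarter of the circulation. The last
    quarter is not tested: when the other three fail, it qualifies by [loopint_quarter]. *)
Definition goursat_step n (z : R * R) : R * R :=
  let: (x, y) := z in
  let big x' y' := `|loopint x y (W n) (Lh n)| / 4 <= `|loopint x' y' (W n.+1) (Lh n.+1)| in
  if big x y then (x, y)
  else if big (x + W n.+1) y then (x + W n.+1, y)
  else if big x (y + Lh n.+1) then (x, y + Lh n.+1)
  else (x + W n.+1, y + Lh n.+1).

Fixpoint goursat_corner n : R * R :=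
  if n is m.+1 then goursat_step m (goursat_corner m) else (x0, y0).

Let X n := (goursat_corner n).1.
Let Y n := (goursat_corner n).2.

Let halves (u : R) n : u / 2 ^+ n = u / 2 ^+ n.+1 + u / 2 ^+ n.+1.
Proof. by rewrite exprS; field; rewrite expf_neq0. Qed.

Let W0 n : 0 <= W n. Proof. by rewrite divr_ge0// exprn_ge0. Qed.
Let L0 n : 0 <= Lh n. Proof. by rewrite divr_ge0// exprn_ge0. Qed.

Let stepX n : X n <= X n.+1 /\ X n.+1 + W n.+1 <= X n + W n.
Proof.
rewrite /X /= /goursat_step; case: (goursat_corner n) => x y /=.
have := halves w n; have := W0 n.+1; rewrite -/(W n) -/(W n.+1) => ? ?.
case: ifP => _ /=; first by split; lra.
case: ifP => _ /=; first by split; lra.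
by case: ifP => _ /=; split; lra.
Qed.

Let stepY n : Y n <= Y n.+1 /\ Y n.+1 + Lh n.+1 <= Y n + Lh n.
Proof.
rewrite /Y /= /goursat_step; case: (goursat_corner n) => x y /=.
have := halves l n; have := L0 n.+1; rewrite -/(Lh n) -/(Lh n.+1) => ? ?.
case: ifP => _ /=; first by split; lra.
case: ifP => _ /=; first by split; lra.
by case: ifP => _ /=; split; lra.
Qed.

Let nested (Z U : nat -> R) : (forall n, Z n <= Z n.+1 /\ Z n.+1 + U n.+1 <= Z n + U n) ->
  (forall n, 0 <= U n) ->
  exists z, forall n, Z n <= z <= Z n + U n.
Proof.
move=> step U0.
have up m n : (m <= n)%N -> Z m <= Z n /\ Z n + U n <= Z m + U m.
  elim: n => [|n IH]; first by rewrite leqn0 => /eqP ->.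
  rewrite leq_eqVlt => /predU1P[->//|]; rewrite ltnS => /IH[h1 h2].
  by have [h3 h4] := step n; split; lra.
have nd : nondecreasing_seq Z by move=> m n mn; case: (up m n mn).
have bd m n : Z m <= Z n + U n.
  have [h1 h2] := up m (maxn m n) (leq_maxl _ _); have [h3 h4] := up n (maxn m n) (leq_maxr _ _).
  by have := U0 (maxn m n); lra.
have cv : cvgn Z.
  apply: nondecreasing_is_cvgn => //; exists (Z 0%N + U 0%N) => _ [n _ <-]; exact: bd.
exists (limn Z) => n; rewrite nondecreasing_cvgn_le//=.
by apply: limr_le => //; apply: nearW => m; exact: bd.
Qed.

Let Yin n : c0 < Y n /\ Y n + Lh n < d0.
Proof.
elim: n => [|n [h1 h2]]; first by rewrite /Y /Lh /= expr0 divr1.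
by have [h3 h4] := stepY n; split; lra.
Qed.

Let big_loop n : `|loopint x0 y0 w l| / 4 ^+ n <= `|loopint (X n) (Y n) (W n) (Lh n)|.
Proof.
elim: n => [|n IH]; first by rewrite /X /Y /W /Lh /= !expr0 !divr1.
have [Y1 Y2] := Yin n.
suff H : `|loopint (X n) (Y n) (W n) (Lh n)| / 4 <=
    `|loopint (X n.+1) (Y n.+1) (W n.+1) (Lh n.+1)|.
  apply: le_trans H; rewrite exprS invfM mulrCA mulrC ler_wpM2r//.
have Wn : W n = W n.+1 + W n.+1 by exact: halves.
have Ln : Lh n = Lh n.+1 + Lh n.+1 by exact: halves.
have q : `|loopint (X n) (Y n) (W n) (Lh n)| <=
   `|loopint (X n) (Y n) (W n.+1) (Lh n.+1)| +
   `|loopint (X n + W n.+1) (Y n) (W n.+1) (Lh n.+1)| +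
   `|loopint (X n) (Y n + Lh n.+1) (W n.+1) (Lh n.+1)| +
   `|loopint (X n + W n.+1) (Y n + Lh n.+1) (W n.+1) (Lh n.+1)|.
  rewrite {1}Wn {1}Ln loopint_quarter//; last by rewrite -addrA -Ln.
  by do 3 (apply: (le_trans (ler_normD _ _)); rewrite lerD2r).
move: q; rewrite /X /Y /= /goursat_step; case: (goursat_corner n) => x y /= q.
case: ifP => [//|/negbT]; rewrite -ltNge => h1.
case: ifP => [//|/negbT]; rewrite -ltNge => h2.
case: ifP => [//|/negbT]; rewrite -ltNge => h3 /=.
move: q h1 h2 h3.
move: `|loopint x y (W n) (Lh n)| => a0.
move: `|loopint x y (W n.+1) (Lh n.+1)| => a1.
move: `|loopint (x + W n.+1) y (W n.+1) (Lh n.+1)| => a2.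
move: `|loopint x (y + Lh n.+1) (W n.+1) (Lh n.+1)| => a3.
move: `|loopint (x + W n.+1) (y + Lh n.+1) (W n.+1) (Lh n.+1)| => a4.
lra.
Qed.

(** Each bisection keeps at least a quarter of the circulation, so stage [n] has at least [4 ^- n]
    of it; near the common point of the rectangles it is at most [2 * e * (w + l) ^+ 2 / 4 ^+ n],
    with [e] arbitrary. *)
Lemma goursat_rectangle : loopint x0 y0 w l = 0.
Proof.
have [xs Hx] := nested stepX W0; have [ys Hy] := nested stepY L0.
have ysin : c0 < ys < d0.
  have := Hy 0%N; rewrite /Y /Lh /= expr0 divr1 => /andP[h1 h2].
  by rewrite (lt_le_trans cy h1) (le_lt_trans h2 yd).
apply/eqP; rewrite -normr_le0 leNgt; apply/negP => pos.
(* Chosen so that [2 * e * (w + l) ^+ 2] is smaller than the circulation; the [+ 1] covers a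
   degenerate rectangle. *)
pose e := `|loopint x0 y0 w l| / (4 * ((w + l) ^+ 2 + 1)).
have s0 : 0 < (w + l) ^+ 2 + 1 by rewrite ltr_wpDl// sqr_ge0.
have e0 : 0 < e by rewrite divr_gt0// mulr_gt0.
have [eta eta0 H] := loopint_small xs ysin e0.
have [n [Wn Ln]] : exists n, W n < eta /\ Lh n < eta.
  have K : (w + l) * (2^-1) ^+ n @[n --> \oo] --> (0 : R).
    rewrite -(mulr0 (w + l)); apply: cvgM; first exact: cvg_cst.
    by apply: cvg_expr; rewrite ger0_norm ?invr_ge0// invf_lt1// ltr1n.
  move/cvgrPdist_lt : K => /(_ _ eta0)[N _ /(_ N (leqnn N))] HN.
  move: HN; rewrite /= sub0r normrN => /(le_lt_trans (ler_norm _)); rewrite exprVn mulrDl => HN.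
  by exists N; have := W0 N; have := L0 N; move: HN; rewrite /W /Lh => ? ? ?; split; lra.
have [Y1 Y2] := Yin n.
have := H (X n) (Y n) (W n) (Lh n).
rewrite W0 L0 Wn Ln => /(_ isT isT Y1 Y2 (Hx n) (Hy n)) h.
have := le_trans (big_loop n) h.
have -> : W n + Lh n = (w + l) / 2 ^+ n by rewrite /W /Lh mulrDl.
rewrite expr_div_n -exprM mulnC exprM.
have -> : (2 : R) ^+ 2 = 4 by ring.
rewrite ler_pdivrMr ?exprn_gt0// mulrA mulfVK ?expf_neq0//.
have E : `|loopint x0 y0 w l| = e * (4 * ((w + l) ^+ 2 + 1)).
  by rewrite /e mulfVK// gt_eqF// mulr_gt0.
rewrite E; have := mulr_ge0 (ltW e0) (sqr_ge0 (w + l)); have := e0; lra.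
Qed.

End Bisection.

End Field.

End Goursat.

(** * Cauchy's theorem between the two boundaries of the strip *)

Section CauchyStrip.
Variable R : realType.
Local Notation mu := (@lebesgue_measure R).
Local Notation Re := complex.Re.
Local Notation Im := complex.Im.
Implicit Types (x y s t e b : R) (f : R[i] -> R[i]).

Section CurlFree.
Variables (h : R) (P Q : R -> R -> R) (K : R).
Hypothesis h0 : 0 < h.
Hypothesis diffPQ : forall x0 y0, - h < y0 < 0 -> exists a b c : R,
  forall e, 0 < e -> exists2 eta, 0 < eta & forall x y, `|x - x0| < eta -> `|y - y0| < eta ->
    `|P x y - (P x0 y0 + a * (x - x0) + b * (y - y0))| <= e * (`|x - x0| + `|y - y0|) /\
    `|Q x y - (Q x0 y0 + b * (x - x0) + c * (y - y0))| <= e * (`|x - x0| + `|y - y0|).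
Hypothesis contP : forall b, - h <= b <= 0 -> continuous (P ^~ b : R -> R).
Hypothesis contPy : forall x b, - h <= b <= 0 -> forall e, 0 < e ->
  exists2 eta, 0 < eta & forall b' : R, - h <= b' <= 0 -> `|b - b'| < eta -> `|P x b - P x b'| < e.
Hypothesis bndP : forall x b, - h <= b <= 0 -> `|P x b| <= K.
Hypothesis decayQ : forall e, 0 < e ->
  exists M, forall x b, - h <= b <= 0 -> M <= `|x| -> `|Q x b| <= e.

(** Integrals over a bounded segment depend continuously on the height up to the boundary, where
    continuity of the field is assumed but not its differentiability. *)
Let segment_level (N b : R) (b_ : nat -> R) : - h <= b <= 0 -> (forall n, - h <= b_ n <= 0) ->
  b_ n @[n --> \oo] --> b ->
  integ (cut (P ^~ (b_ n)) N) @[n --> \oo] --> integ (cut (P ^~ b) N).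
Proof.
move=> hb hbn bb.
have mP c : - h <= c <= 0 -> measurable_fun setT (cut (P ^~ c) N).
  by move=> hc; apply: measurable_cut; apply: measurable_contR; exact: contP.
have [||||| _ H] := @dominated_integ _ (fun n => cut (P ^~ (b_ n)) N) (cut (P ^~ b) N) (cut (cst K) N).
- by move=> n; exact: mP.
- exact: mP.
- have : summable1 (\1_(`[- N, N]%classic) : R -> R) by exact: integrable_indic_itv.
  exact: summable1Z.
- move=> n x; rewrite /cut indicE normrM normr_nat /cst.
  by rewrite ler_wpM2r//; exact: bndP.
- move=> x; apply: cvgM; last exact: cvg_cst.
  apply/cvgrPdist_lt => e e0; have [eta eta0 He] := contPy x hb e0.
  have /cvgrPdist_lt/(_ _ eta0) := bb; apply: filterS => n; exact: He.
exact: H.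
Qed.

(** The field is differentiable in the open strip, so Goursat is applied to rectangles at distance
    [t n] from both boundaries. The vertical sides are small by decay, uniformly in [n]; first [n]
    goes to infinity, then the width of the rectangle. *)
Lemma curlfree_level_integral : summable1 (P ^~ 0) -> summable1 (P ^~ (- h)) ->
  integ (P ^~ 0) = integ (P ^~ (- h)).
Proof.
move=> s0 sh.
have hb0 : - h <= 0 <= (0 : R) by rewrite lexx andbT lerNl oppr0 ltW.
have hbh : - h <= - h <= 0 by rewrite lexx/= lerNl oppr0 ltW.
(* The bound [h / 3] keeps the upper side of the rectangle above the lower one. *)
pose t n : R := h / 3 / n.+1%:R.
have t0 n : 0 < t n by rewrite divr_gt0// divr_gt0.
have th n : t n <= h / 3.
  rewrite /t ler_pdivrMr// ler_peMr ?ler1n//; first by rewrite divr_ge0// ltW.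
have tc : t n @[n --> \oo] --> (0 : R).
  rewrite -(mulr0 (h / 3)); apply: cvgM; first exact: cvg_cst.
  exact: cvg_harmonic.
have near_level e : 0 < e -> exists M : R, forall N : R, 0 <= N -> M <= N ->
    `|integ (cut (P ^~ (- h)) N) - integ (cut (P ^~ 0) N)| <= 2 * (e * h).
  move=> e0; have [M HM] := decayQ e0; exists M => N N0 MN.
  have step n : `|integ (cut (P ^~ (- h + t n)) N) - integ (cut (P ^~ (- t n)) N)| <= 2 * (e * h).
    have := t0 n; have := th n; move: (t n) => u uh u0.
    have l0 : 0 <= h - u - u by lra.
    have NN : 0 <= N + N by rewrite addr_ge0.
    have c1 : - h < - h + u by lra.
    have c2 : - h + u + (h - u - u) < 0 by lra.
    have := goursat_rectangle diffPQ (- N) NN l0 c1 c2; rewrite /loopint.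
    have -> : - N + (N + N) = N by ring.
    have -> : - h + u + (h - u - u) = - u by ring.
    have c3 : - u < 0 by lra.
    have sideQ x : M <= `|x| -> `|segint (Q x) (- h + u) (- u)| <= e * h.
      move=> Mx.
      have ab : - h + u <= - u by lra.
      have := @segint_near _ (Q x) _ _ 0 e ab (field_integrable diffPQ x c1 c3).
      rewrite mul0r subr0 => H; apply: le_trans; first apply: H.
        move=> z /andP[z1 z2]; rewrite subr0; apply: HM => //.
        by apply/andP; split; lra.
      by rewrite ler_pM2l//; lra.
    rewrite -!Rintegral_cut -/(segint _ _ _) -/(segint _ _ _) => /eqP; rewrite addr_eq0 => /eqP ->.
    rewrite normrN; apply: (le_trans (ler_normB _ _)); rewrite mulrDl mul1r.
    apply: lerD; apply: sideQ; rewrite ?normrN ger0_norm//.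
  have c1 : integ (cut (P ^~ (- h + t n)) N) @[n --> \oo] --> integ (cut (P ^~ (- h)) N).
    apply: segment_level => //.
      by move=> n; have := t0 n; have := th n => ? ?; apply/andP; split; lra.
    by rewrite -[X in _ --> X]addr0; apply: cvgD => //; exact: cvg_cst.
  have c2 : integ (cut (P ^~ (- t n)) N) @[n --> \oo] --> integ (cut (P ^~ 0) N).
    apply: segment_level => //.
      by move=> n; have := t0 n; have := th n => ? ?; apply/andP; split; lra.
    by rewrite -[X in _ --> X]oppr0; apply: cvgN.
  have c3 : `|integ (cut (P ^~ (- h + t n)) N) - integ (cut (P ^~ (- t n)) N)| @[n --> \oo] -->
     `|integ (cut (P ^~ (- h)) N) - integ (cut (P ^~ 0) N)|.
    by apply: cvg_norm; apply: cvgB.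
  rewrite -(cvg_lim _ c3)//; apply: limr_le; first exact: (cvgP _ c3).
  by apply: nearW => n; exact: step.
have cutc b : - h <= b <= 0 -> summable1 (P ^~ b) ->
    integ (cut (P ^~ b) n%:R) @[n --> \oo] --> integ (P ^~ b).
  move=> hb sb; have mP := measurable_contR (contP hb).
  have [||||| _ H] := @dominated_integ _ (fun n => cut (P ^~ b) n%:R) (P ^~ b) (fun x => `|P x b|).
  - by move=> n; exact: measurable_cut.
  - exact: mP.
  - exact: summable1_norm.
  - by move=> n x; exact: cut_le.
  - by move=> x; exact: cut_cvg.
  exact: H.
apply/eqP; rewrite eq_sym -subr_eq0 -normr_le0; apply/ler_addgt0Pl => e e0; rewrite addr0.
have e1 : 0 < e / (2 * h) by rewrite divr_gt0// mulr_gt0.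
have [M HM] := near_level _ e1.
have c3 : `|integ (cut (P ^~ (- h)) n%:R) - integ (cut (P ^~ 0) n%:R)| @[n --> \oo] -->
     `|integ (P ^~ (- h)) - integ (P ^~ 0)|.
  by apply: cvg_norm; apply: cvgB; exact: cutc.
have eE : e = 2 * (e / (2 * h) * h) by field; rewrite gt_eqF.
rewrite eE -(cvg_lim _ c3)//; apply: limr_le; first exact: (cvgP _ c3).
near=> n; apply: HM => //.
by near: n; exact: nbhs_infty_ger.
Unshelve. all: by end_near. Qed.

End CurlFree.

(** Complex differentiability as a first order expansion with real error terms, the form in which
    the hypothesis of Goursat's theorem is verified. *)
Lemma derivable_expansion f z : derivable (f : R[i]^o -> R[i]^o) z 1 ->
  exists d : R[i], forall e, 0 < e -> exists2 eta, 0 < eta &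
    forall w, Normc.normc w < eta -> Normc.normc (f (w + z) - f z - d * w) <= e * Normc.normc w.
Proof.
move=> /cvg_ex[d Hd]; exists d => e e0.
move/cvgrPdist_lt : Hd => /(_ e%:C); rewrite ltcR => /(_ e0).
rewrite near_withinE => -[/= r r0 H].
have [rR r0'] : exists r', r = r'%:C.
  by exists (Re r); case: r r0 {H} => a b; rewrite ltcE/= => /andP[/eqP -> _].
exists rR; first by move: r0; rewrite r0' ltcR.
move=> w wr; have [->|w0] := eqVneq w 0.
  by rewrite add0r subrr mulr0 subrr Normc.normc0 mulr0.
have := H w; rewrite /ball/= sub0r normrN r0' ltc_normP => /(_ wr w0).
rewrite /GRing.scale/= mulr1 ltc_normP => Hw.
have -> : f (w + z) - f z - d * w = - (w * (d - w^-1 * (f (w + z) - f z))).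
  rewrite mulrBr mulrA mulfV// mul1r; ring.
by rewrite normcN Normc.normcM mulrC ler_wpM2r ?normc_ge0// ltW.
Qed.

Lemma expansion_derivable f z (d : R[i]) :
  (forall e, 0 < e -> exists2 eta, 0 < eta &
    forall w, Normc.normc w < eta -> Normc.normc (f (w + z) - f z - d * w) <= e * Normc.normc w) ->
  derivable (f : R[i]^o -> R[i]^o) z 1.
Proof.
move=> H; apply/cvg_ex; exists d; apply/cvgrPdist_le => e e0.
have [eR e0'] : exists e', e = e'%:C.
  by exists (Re e); case: e e0 => a b; rewrite ltcE/= => /andP[/eqP -> _].
move: e0; rewrite e0' ltcR => /H[eta eta0 Heta].
rewrite near_withinE; exists eta%:C; first by rewrite /= ltcR.
move=> w; rewrite /ball/= sub0r normrN ltc_normP => weta w0.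
have := Heta w weta; rewrite /GRing.scale/= mulr1.
have -> : f (w + z) - f z - d * w = - (w * (d - w^-1 * (f (w + z) - f z))).
  rewrite mulrBr mulrA mulfV// mul1r; ring.
rewrite normcN Normc.normcM mulrC ler_pM2r; last first.
  by rewrite lt_def normc_ge0 andbT; apply: contra w0 => /eqP/Normc.eq0_normc ->.
by rewrite -lecR.
Qed.

Section Holomorphic.
Variables (h : R) (f : R[i] -> R[i]) (K : R).
Hypothesis h0 : 0 < h.
Hypothesis holf : forall z, strip h z -> derivable (f : R[i]^o -> R[i]^o) z 1.
Hypothesis contf : forall z, closed_strip h z -> forall e, 0 < e ->
  exists2 eta, 0 < eta & forall w, closed_strip h w ->
    Normc.normc (z - w) < eta -> Normc.normc (f z - f w) < e.
Hypothesis bndf : forall z, closed_strip h z -> Normc.normc (f z) <= K.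
Hypothesis decayf : forall e, 0 < e ->
  exists M, forall x b, - h <= b <= 0 -> M <= `|x| -> Normc.normc (f (x +i* b)) <= e.

(** The Cauchy-Riemann equations: for a derivative [a + i b], the coefficient of [y] is [- b] in the
    real part and [a] in the imaginary part. *)
Let expand x0 y0 : - h < y0 < 0 -> exists a b : R,
  forall e, 0 < e -> exists2 eta, 0 < eta & forall x y, `|x - x0| < eta -> `|y - y0| < eta ->
    `|Re (f (x +i* y)) - (Re (f (x0 +i* y0)) + a * (x - x0) + - b * (y - y0))|
      <= e * (`|x - x0| + `|y - y0|) /\
    `|Im (f (x +i* y)) - (Im (f (x0 +i* y0)) + b * (x - x0) + a * (y - y0))|
      <= e * (`|x - x0| + `|y - y0|).
Proof.
move=> hy; have [d Hd] := derivable_expansion (holf (z := x0 +i* y0) hy).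
exists (Re d), (Im d) => e e0; have [eta eta0 {}Hd] := Hd e e0; exists (eta / 2); first by rewrite divr_gt0.
move=> x y hx hy'; pose w := (x - x0) +i* (y - y0).
have wl : Normc.normc w <= `|x - x0| + `|y - y0| by exact: normc_le_l1.
have ww : w + (x0 +i* y0) = x +i* y by apply/eqP; rewrite eq_complex/= !subrK !eqxx.
have weta : Normc.normc w < eta by apply: (le_lt_trans wl); lra.
have := Hd w weta; rewrite ww => H.
have H1 := le_trans H (ler_wpM2l (ltW e0) wl).
split; apply: le_trans H1.
  apply: le_trans (normc_ge_Re _); rewrite le_eqVlt; apply/orP; left; apply/eqP; congr `|_|.
  by rewrite /w; case: (f (x +i* y)) (f (x0 +i* y0)) d {Hd H} => ? ? [? ?] [? ?] /=; ring.
apply: le_trans (normc_ge_Im _); rewrite le_eqVlt; apply/orP; left; apply/eqP; congr `|_|.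
by rewrite /w; case: (f (x +i* y)) (f (x0 +i* y0)) d {Hd H} => ? ? [? ?] [? ?] /=; ring.
Qed.

Let contx b : - h <= b <= 0 -> forall x e, 0 < e ->
  \forall t \near x, Normc.normc (f (x +i* b) - f (t +i* b)) < e.
Proof.
move=> hb x e e0; have [eta eta0 H] := contf (z := x +i* b) hb e0.
exists eta => //= t xt; apply: H => //.
by apply: le_lt_trans (normc_le_l1 _) _; rewrite /= subrr normr0 addr0.
Qed.

Let conty x b : - h <= b <= 0 -> forall e, 0 < e ->
  exists2 eta, 0 < eta & forall b' : R, - h <= b' <= 0 -> `|b - b'| < eta ->
    Normc.normc (f (x +i* b) - f (x +i* b')) < e.
Proof.
move=> hb e e0; have [eta eta0 H] := contf (z := x +i* b) hb e0.
exists eta => // b' hb' bb; apply: H => //.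
by apply: le_lt_trans (normc_le_l1 _) _; rewrite /= subrr normr0 add0r.
Qed.

Lemma holomorphic_cont_Re b : - h <= b <= 0 -> continuous (fun x => Re (f (x +i* b)) : R).
Proof.
move=> hb x; apply/cvgrPdist_lt => e e0; apply: filterS (contx hb x e0) => t.
by apply: le_lt_trans; rewrite -raddfB normc_ge_Re.
Qed.

Lemma holomorphic_cont_Im b : - h <= b <= 0 -> continuous (fun x => Im (f (x +i* b)) : R).
Proof.
move=> hb x; apply/cvgrPdist_lt => e e0; apply: filterS (contx hb x e0) => t.
by apply: le_lt_trans; rewrite -raddfB normc_ge_Im.
Qed.

(** The real part of [f dz] is [Re f dx - Im f dy], and its imaginary part, used in the companion
    lemma, is [Im f dx + Re f dy]; [expand] shows that both fields are curl-free. *)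
Lemma cauchy_strip_Re : summable1 (fun x => Re (f (x +i* 0))) ->
  summable1 (fun x => Re (f (x +i* - h))) ->
  integ (fun x => Re (f (x +i* 0))) = integ (fun x => Re (f (x +i* - h))).
Proof.
apply: (@curlfree_level_integral h (fun x y => Re (f (x +i* y))) (fun x y => - Im (f (x +i* y))) K h0).
- move=> x0 y0 hy; have [a [b H]] := expand x0 hy; exists a, (- b), (- a) => e e0.
  have [eta eta0 {}H] := H e e0; exists eta => // x y hx hy'; have [H1 H2] := H x y hx hy'.
  split=> //; move: H2; rewrite -normrN; congr (`|_| <= _); ring.
- exact: holomorphic_cont_Re.
- move=> x b hb e e0; have [eta eta0 H] := conty x hb e0; exists eta => // b' hb' bb.
  by apply: le_lt_trans (H _ hb' bb); rewrite -raddfB normc_ge_Re.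
- by move=> x b hb; apply: le_trans (normc_ge_Re _) (bndf (z := x +i* b) hb).
- move=> e e0; have [M HM] := decayf e0; exists M => x b hb xM.
  by rewrite normrN; apply: le_trans (normc_ge_Im _) (HM x b hb xM).
Qed.

Lemma cauchy_strip_Im : summable1 (fun x => Im (f (x +i* 0))) ->
  summable1 (fun x => Im (f (x +i* - h))) ->
  integ (fun x => Im (f (x +i* 0))) = integ (fun x => Im (f (x +i* - h))).
Proof.
apply: (@curlfree_level_integral h (fun x y => Im (f (x +i* y))) (fun x y => Re (f (x +i* y))) K h0).
- move=> x0 y0 hy; have [a [b H]] := expand x0 hy; exists b, a, (- b) => e e0.
  have [eta eta0 {}H] := H e e0; exists eta => // x y hx hy'; have [H1 H2] := H x y hx hy'.
  by split.
- exact: holomorphic_cont_Im.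
- move=> x b hb e e0; have [eta eta0 H] := conty x hb e0; exists eta => // b' hb' bb.
  by apply: le_lt_trans (H _ hb' bb); rewrite -raddfB normc_ge_Im.
- by move=> x b hb; apply: le_trans (normc_ge_Im _) (bndf (z := x +i* b) hb).
- move=> e e0; have [M HM] := decayf e0; exists M => x b hb xM.
  by apply: le_trans (normc_ge_Re _) (HM x b hb xM).
Qed.

End Holomorphic.

End CauchyStrip.
(** * The weight *)

Section Weight.
Variable R : realType.
Local Notation Re := complex.Re.
Local Notation Im := complex.Im.
Implicit Types (a b e h x y k : R) (f g : R[i] -> R[i]) (z w : R[i]).

Lemma expR_sub1_le a : `|a| <= 2^-1 -> `|expR a - 1 - a| <= 2 * a ^+ 2.
Proof.
rewrite ler_norml => /andP[a1 a2].
have h1 := expR_ge1Dx a; have := expR_lip a 0; rewrite expR0 subr0 => h2.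
have := sqr_ge0 a; rewrite expr2 => h3.
rewrite ler_norml; apply/andP; split; first by lra.
have h4 : expR a <= 2.
  have : expR a * 2^-1 <= expR a * (1 - a) by rewrite ler_wpM2l ?expR_ge0//; lra.
  have -> : expR a * (1 - a) = expR a - a * expR a by ring.
  lra.
have : (expR a - 1) * a <= 2 * (a * a).
  case: (lerP 0 a) => a0.
    have : a * (expR a) <= a * 2 by rewrite ler_wpM2l.
    move=> h5; have : (expR a - 1) * a <= (a * 2) * a by rewrite ler_wpM2r//; lra.
    by lra.
  have h6 : a <= expR a - 1 by lra.
  have : (expR a - 1) * a <= a * a by rewrite ler_wnM2r// ltW.
  lra.
have -> : (expR a - 1) * a = a * expR a - a by ring.
lra.
Qed.

Lemma cos_sub1_le b : `|b| <= 1 -> `|cos b - 1| <= b ^+ 2.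
Proof.
move=> b1; have cb := cos_lip b 0; rewrite cos0 subr0 in cb.
have c0 : 0 <= cos b by move: cb; rewrite ler_norml => /andP[+ _]; lra.
have c1 : cos b <= 1 by exact: cos_le1.
have sb := sin_lip b 0; rewrite sin0 !subr0 in sb.
have s2 : sin b ^+ 2 <= b ^+ 2.
  by rewrite -[leLHS]real_normK ?num_real// -[leRHS]real_normK ?num_real// lerXn2r ?nnegrE.
rewrite ler0_norm; last by lra.
have := cos2Dsin2 b; have : cos b ^+ 2 <= cos b by rewrite expr2 ler_piMr.
lra.
Qed.

Lemma sin_sub_le b : `|sin b - b| <= b ^+ 2.
Proof.
have pos x : 0 < x -> `|sin x - x| <= x ^+ 2.
  move=> x0; have [|c cx] := @MVT _ (fun t => sin t - t) (fun t => cos t - 1) 0 x x0.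
    by apply: derivable_within_continuous => z _; apply: derivableB; [exact: ex_derive|exact: ex_derive].
  rewrite sin0 !subr0 => ->; rewrite normrM expr2 (gtr0_norm x0) ler_wpM2r ?(ltW x0)//.
  move: cx; rewrite in_itv/= => /andP[c0 cx].
  have := cos_lip c 0; rewrite cos0 subr0 => /le_trans; apply.
  by rewrite gtr0_norm// ltW.
case: (ltgtP b 0) => [b0|/pos//|->]; last by rewrite sin0 subrr normr0 sqr_ge0.
have nb : 0 < - b by rewrite oppr_gt0.
have := pos _ nb; rewrite sinN sqrrN -opprD normrN; by [].
Qed.

Definition cexp z : R[i] := (expR (Re z) * cos (Im z)) +i* (expR (Re z) * sin (Im z)).

Lemma cexpD z w : cexp (z + w) = cexp z * cexp w.
Proof.
rewrite /cexp; case: z w => [a b] [c d] /=.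
by apply/eqP; rewrite eq_complex/= expRD cosD sinD; apply/andP; split; apply/eqP; ring.
Qed.

(** The remainder is quadratic: [6 * |w| ^ 2] collects the second order bounds for [expR], [cos] and
    [sin], valid for [|w| <= 1 / 2]. *)
Lemma cexp_expansion e : 0 < e -> exists2 eta, 0 < eta &
  forall w, Normc.normc w < eta -> Normc.normc (cexp w - 1 - w) <= e * Normc.normc w.
Proof.
move=> e0; exists (Num.min 2^-1 (e / 6)); first by rewrite lt_min invr_gt0 ltr0n divr_gt0.
move=> w; rewrite lt_min => /andP[w1 w2].
apply: (@le_trans _ _ (6 * Normc.normc w ^+ 2)); last first.
  by rewrite expr2 mulrA ler_wpM2r ?normc_ge0//; lra.
have hr := le_trans (normc_ge_Re w) (ltW w1); have hi := le_trans (normc_ge_Im w) (ltW w1).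
rewrite normc_sqr; apply: (le_trans (normc_le_l1 _)).
case: w hr hi {w1 w2} => [a b] /= hr hi; rewrite subr0.
have b1 : `|b| <= 1 by apply: (le_trans hi); lra.
have h1 := expR_sub1_le hr; have h2 := cos_sub1_le b1; have h3 := sin_sub_le b.
have sb := sin_lip b 0; rewrite sin0 !subr0 in sb.
have ea : expR a - 1 <= 2 * `|a| /\ - (expR a - 1) <= 2 * `|a|.
  have : `|expR a - 1| <= 2 * `|a|.
    have -> : expR a - 1 = (expR a - 1 - a) + a by ring.
    apply: (le_trans (ler_normD _ _)).
    have : 2 * a ^+ 2 <= `|a|.
      rewrite -(real_normK (num_real a)) expr2 mulrA ler_piMl//.
      by lra.
    lra.
  by rewrite ler_norml => /andP[? ?]; split; lra.
have ea1 : `|expR a - 1| <= 2 * `|a| by rewrite ler_norml; apply/andP; split; lra.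
have ea2 : expR a <= 2 by move: ea => [ea _]; lra.
have R1 : `|expR a * cos b - 1 - a| <= 2 * a ^+ 2 + 2 * b ^+ 2.
  have -> : expR a * cos b - 1 - a = (expR a - 1 - a) + expR a * (cos b - 1) by ring.
  apply: (le_trans (ler_normD _ _)); apply: lerD => //.
  by rewrite normrM (ger0_norm (expR_ge0 a)); apply: ler_pM => //; exact: expR_ge0.
have I1 : `|expR a * sin b - b| <= b ^+ 2 + 2 * (`|a| * `|b|).
  have -> : expR a * sin b - b = (sin b - b) + (expR a - 1) * sin b by ring.
  apply: (le_trans (ler_normD _ _)); apply: lerD => //.
  by rewrite normrM mulrA; apply: ler_pM.
have := sqr_ge0 (`|a| - `|b|); rewrite sqrrB !real_normK ?num_real//.
have := sqr_ge0 a; have := sqr_ge0 b; lra.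
Qed.

(** The functional equation reduces the expansion at [z] to the one at 0. *)
Lemma derivable_cexp (c z : R[i]) : 
  derivable ((fun z => cexp (c * z)) : R[i]^o -> R[i]^o) z 1.
Proof.
have n0 : 0 <= Normc.normc c by exact: normc_ge0.
apply: (@expansion_derivable _ (fun z => cexp (c * z)) z (cexp (c * z) * c)) => e e0.
pose k := Normc.normc (cexp (c * z)).
have k0 : 0 <= k by exact: normc_ge0.
pose d := (k + 1) * (Normc.normc c + 1).
have d0 : 0 < d by rewrite mulr_gt0// ltr_wpDl.
have [eta eta0 H] := cexp_expansion (divr_gt0 e0 d0).
exists (eta / (Normc.normc c + 1)); first by rewrite divr_gt0// ltr_wpDl.
move=> w; rewrite ltr_pdivlMr ?ltr_wpDl// => weta.
have -> : cexp (c * (w + z)) - cexp (c * z) - cexp (c * z) * c * w =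
    cexp (c * z) * (cexp (c * w) - 1 - c * w) by rewrite mulrDr cexpD; ring.
rewrite Normc.normcM -/k.
have cw : Normc.normc (c * w) <= Normc.normc w * (Normc.normc c + 1).
  by rewrite Normc.normcM mulrC ler_wpM2l ?normc_ge0// lerDl.
have := H (c * w) (le_lt_trans cw weta) => H1.
have H2 : e / d * Normc.normc (c * w) <= e / d * (Normc.normc w * (Normc.normc c + 1)).
  by rewrite ler_wpM2l// divr_ge0// ltW.
apply: (@le_trans _ _ ((k + 1) * (e / d * (Normc.normc w * (Normc.normc c + 1))))).
  apply: ler_pM => //; [exact: normc_ge0|by rewrite lerDl|exact: le_trans H1 H2].
rewrite le_eqVlt; apply/orP; left; apply/eqP; rewrite /d; field.
by rewrite !gt_eqF// ltr_wpDl.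
Qed.

Lemma cderivableM f g z : derivable (f : R[i]^o -> R[i]^o) z 1 ->
  derivable (g : R[i]^o -> R[i]^o) z 1 ->
  derivable ((fun z => f z * g z) : R[i]^o -> R[i]^o) z 1.
Proof. exact: (@derivableM (R[i] : numFieldType) (R[i]^o) f g z 1). Qed.

Lemma cderivableV f z : f z != 0 -> derivable (f : R[i]^o -> R[i]^o) z 1 ->
  derivable ((fun z => (f z)^-1) : R[i]^o -> R[i]^o) z 1.
Proof. exact: (@derivableV (R[i] : numFieldType) (R[i]^o) f z 1). Qed.

Lemma cderivableD f g z : derivable (f : R[i]^o -> R[i]^o) z 1 ->
  derivable (g : R[i]^o -> R[i]^o) z 1 ->
  derivable ((fun z => f z + g z) : R[i]^o -> R[i]^o) z 1.
Proof. exact: (@derivableD (R[i] : numFieldType) (R[i]^o) (R[i]^o) f g z 1). Qed.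

Lemma cderivableB f g z : derivable (f : R[i]^o -> R[i]^o) z 1 ->
  derivable (g : R[i]^o -> R[i]^o) z 1 ->
  derivable ((fun z => f z - g z) : R[i]^o -> R[i]^o) z 1.
Proof. exact: (@derivableB (R[i] : numFieldType) (R[i]^o) (R[i]^o) f g z 1). Qed.

Lemma cderivable_cst (c z : R[i]) : derivable ((fun=> c) : R[i]^o -> R[i]^o) z 1.
Proof. exact: (@derivable_cst (R[i] : numFieldType) (R[i]^o) (R[i]^o)). Qed.

Lemma derivable_eps f z : derivable (f : R[i]^o -> R[i]^o) z 1 -> forall e, 0 < e ->
  exists2 eta, 0 < eta & forall w, Normc.normc (z - w) < eta -> Normc.normc (f z - f w) < e.
Proof.
move=> /derivable_expansion[d Hd] e e0; have [eta eta0 H] := Hd 1 ltr01.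
pose k := Normc.normc d + 1 + 1.
have k0 : 0 < k by rewrite /k ltr_wpDl// addr_ge0// normc_ge0.
exists (Num.min eta (e / k)); first by rewrite lt_min eta0 divr_gt0.
move=> w; rewrite lt_min -normcN opprB => /andP[w1]; rewrite ltr_pdivlMr// => w2.
have := H (w - z) w1; rewrite subrK mul1r => H1.
rewrite -normcN opprB.
have -> : f w - f z = (f w - f z - d * (w - z)) + d * (w - z) by ring.
apply: (le_lt_trans (le_normcD _ _)); rewrite Normc.normcM.
apply: le_lt_trans w2; rewrite /k; have := normc_ge0 (w - z); lra.
Qed.

(* tanh (z / 4h) *)
Definition weight h z : R[i] :=
  (cexp (((2 * h)^-1)%:C * z) - 1) / (cexp (((2 * h)^-1)%:C * z) + 1).

Section WeightProperties.
Variable h : R.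
Hypothesis h0 : 0 < h.

Let cexp_half x b : cexp (((2 * h)^-1)%:C * (x +i* b)) =
  (expR (x / (2 * h)) * cos (b / (2 * h))) +i* (expR (x / (2 * h)) * sin (b / (2 * h))).
Proof.
by rewrite /cexp /= !mul0r subr0 addr0 ![_^-1 * _]mulrC.
Qed.

Let half_le b : - h <= b <= 0 -> - 1 < b / (2 * h) <= 0.
Proof.
move=> /andP[b1 b2]; have h2 : 0 < 2 * h by rewrite mulr_gt0.
rewrite ltr_pdivlMr// ler_pdivrMr// mul0r; apply/andP; split=> //.
by have := h0; lra.
Qed.

(** The scale [2 * h] keeps the argument [b / (2 * h)] of the exponential small enough for its
    cosine to be positive throughout the closed strip. *)
Let Re_cexp_gt0 z : closed_strip h z -> 0 < Re (cexp (((2 * h)^-1)%:C * z)).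
Proof.
case: z => x b hb; rewrite cexp_half /= mulr_gt0 ?expR_gt0//.
apply: cos_gt0_pihalf; rewrite /closed_strip/= in hb; have := half_le hb; have := @pi_ge2 R; move: (pi) => p p2 /andP[h1 h2].
by apply/andP; split; lra.
Qed.

Let cexp1_neq0 z : closed_strip h z -> cexp (((2 * h)^-1)%:C * z) + 1 != 0.
Proof.
move=> /Re_cexp_gt0; case: (cexp _) => a b /= a0.
by apply/negP => /eqP[]; lra.
Qed.

Lemma weight_derivable z : closed_strip h z -> derivable (weight h : R[i]^o -> R[i]^o) z 1.
Proof.
move=> hz; have dc := @derivable_cexp ((2 * h)^-1)%:C z.
have num := cderivableB dc (@cderivable_cst 1 z).
have den := cderivableD dc (@cderivable_cst 1 z).
have inv := @cderivableV (fun z => cexp (((2 * h)^-1)%:C * z) + 1) z (cexp1_neq0 hz) den.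
exact: (cderivableM num inv).
Qed.

(** The Cayley transform maps the right half-plane into the unit disc. *)
Lemma weight_le1 z : closed_strip h z -> Normc.normc (weight h z) <= 1.
Proof.
move=> hz; have := Re_cexp_gt0 hz; have := cexp1_neq0 hz; rewrite /weight.
move: (cexp _) => c c1 rc; rewrite Normc.normcM Normc.normcV.
have n1 : 0 < Normc.normc (c + 1).
  by rewrite lt_def normc_ge0 andbT; apply: contra c1 => /eqP/Normc.eq0_normc ->.
rewrite ler_pdivrMr// mul1r -ler_sqr ?nnegrE ?normc_ge0// !normc_sqr.
by case: c rc {c1 n1} => a b /= a0; rewrite subr0 addr0 sqrrB1 sqrrD1; lra.
Qed.

Lemma weight_top x : weight h (x +i* 0) = (1 - 2 / (expR (x / (2 * h)) + 1))%:C.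
Proof.
rewrite /weight cexp_half mul0r cos0 sin0 mulr0 mulr1.
have e0 := expR_gt0 (x / (2 * h)); move: (expR _) e0 => E e0.
have -> : E +i* 0 - 1 = (E - 1)%:C by apply/eqP; rewrite eq_complex/= subr0 !eqxx.
have -> : E +i* 0 + 1 = (E + 1)%:C by apply/eqP; rewrite eq_complex/= addr0 !eqxx.
rewrite -fmorphV -rmorphM; congr (_%:C); field.
by rewrite gt_eqF// addr_gt0.
Qed.

(** The derivative of the weight on the top, [h^-1 * E / (E + 1) ^+ 2] with
    [E = expR (x / (2 * h))], reduced by the factor [expR (- (2 * h)^-1)]. So reduced it bounds from
    below the increments over all steps [s <= 1], and not just in the limit. *)
Definition weight_slope x : R :=
  h^-1 * expR (- (2 * h)^-1) * (expR (x / (2 * h)) / (expR (x / (2 * h)) + 1) ^+ 2).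

Lemma weight_slope_gt0 x : 0 < weight_slope x.
Proof.
by rewrite !mulr_gt0 ?invr_gt0 ?exprn_gt0 ?addr_gt0 ?expR_gt0.
Qed.

Lemma cont_weight_slope : continuous (weight_slope : R -> R).
Proof.
have ce : continuous (fun x => expR (x / (2 * h)) : R).
  apply: (@contcomp _ (fun x => x / (2 * h)) expR); last exact: continuous_expR.
  by apply: contM; [exact: contid|exact: contcst].
apply: contM; first exact: contcst.
apply: contM => //; apply: contV; first by apply: contX; apply: contD => //; exact: contcst.
by move=> x; rewrite gt_eqF// exprn_gt0// addr_gt0// expR_gt0.
Qed.

Lemma weight_slope_le x s : 0 < s <= 1 ->
  s * weight_slope x <= Re (weight h (x +i* 0)) - Re (weight h ((x - s) +i* 0)).
Proof.
move=> /andP[s0 s1]; rewrite !weight_top /=.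
pose k := (2 * h)^-1; have k0 : 0 < k by rewrite invr_gt0 mulr_gt0.
have hk : h^-1 = 2 * k by rewrite /k; field; rewrite gt_eqF.
rewrite /weight_slope hk -/k; set E := expR (x * k); set D := expR ((x - s) * k).
have E0 : 0 < E by exact: expR_gt0. have D0 : 0 < D by exact: expR_gt0.
have DE : D <= E by rewrite ler_expR ler_pM2r//; lra.
(* A step of length at most 1 lowers the exponential by at most the factor [expR (- k)]; this is
   where [s <= 1] enters. *)
have h1 : E * expR (- k) <= D.
  rewrite -expRD ler_expR; have : s * k <= 1 * k by rewrite ler_pM2r.
  lra.
have h2 : s * k * D <= E - D.
  have -> : E = D * expR (s * k) by rewrite -expRD; congr expR; ring.
  have := expR_ge1Dx (s * k) => h3.
  have : D * (1 + s * k) <= D * expR (s * k) by rewrite ler_pM2l.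
  lra.
have -> : 1 - 2 / (E + 1) - (1 - 2 / (D + 1)) = 2 * ((E - D) / ((E + 1) * (D + 1))).
  by field; rewrite !gt_eqF// addr_gt0.
have -> : s * (2 * k * expR (- k) * (E / (E + 1) ^+ 2)) =
   2 * (s * k * (E * expR (- k)) / ((E + 1) * (E + 1))).
  by field; rewrite !gt_eqF// addr_gt0.
rewrite ler_pM2l//; apply: ler_pM.
- by rewrite !mulr_ge0 ?expR_ge0// ltW.
- by rewrite invr_ge0 mulr_ge0// addr_ge0// ltW.
- by apply: le_trans h2; rewrite ler_pM2l// mulr_gt0.
rewrite lef_pV2 ?posrE ?mulr_gt0 ?addr_gt0//.
by rewrite ler_pM2l ?addr_gt0// lerD2r.
Qed.

(** The imaginary part of [(c - 1) / (c + 1)] has the sign of that of [c], and on the bottom the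
    argument of [c] is [- 1/2]. *)
Lemma weight_bottom x : Im (weight h (x +i* - h)) < 0.
Proof.
have hz : closed_strip h (x +i* - h) by rewrite /closed_strip/= lexx oppr_le0 ltW.
have := Re_cexp_gt0 hz.
have : Im (cexp (((2 * h)^-1)%:C * (x +i* - h))) < 0.
  rewrite cexp_half /= pmulr_rlt0 ?expR_gt0//.
  have -> : - h / (2 * h) = - 2^-1 by field; rewrite gt_eqF.
  rewrite sinN oppr_lt0; apply: sin_gt0_pihalf; have := @pi_ge2 R; move: (pi) => p p2.
  by apply/andP; split; lra.
rewrite /weight; case: (cexp _) => a b /= b0 a0.
rewrite /= !addr0 subr0.
have d0 : 0 < (a + 1) ^+ 2 + b ^+ 2 by rewrite ltr_pwDl ?sqr_ge0// exprn_gt0// addr_gt0.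
set d := _ ^+ 2 + _.
have -> : (a - 1) * - (b / d) + b * ((a + 1) / d) = 2 * (b / d) by ring.
by rewrite pmulr_rlt0// pmulr_llt0// invr_gt0.
Qed.

End WeightProperties.

End Weight.
(** * The lemma of du Bois-Reymond *)

Section DuBoisReymond.
Variable R : realType.
Local Notation mu := (@lebesgue_measure R).
Implicit Types (f g u v chi : R -> R) (a b x y t e : R).

Lemma derive1n_near n f g x : (\forall t \near x, f t = g t) ->
  \forall t \near x, derive1n n f t = derive1n n g t.
Proof.
elim: n => [//|n IH] /IH fg; rewrite /derive1n !iterS -!/(derive1n _ _).
have := near_join fg; apply: filterS => t tfg; rewrite !derive1E.
exact: near_eq_derive.
Qed.

Lemma smooth_glue f : (forall x, exists2 g, smooth g & \forall t \near x, g t = f t) -> smooth f.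
Proof.
move=> H n x; have [g sg gf] := H x.
exact: near_eq_derivable (derive1n_near n gf) (sg n x).
Qed.

Lemma smooth_cst (k : R) : smooth (fun=> k).
Proof.
have H n : exists c : R, derive1n n (fun=> k) = (fun=> c).
  elim: n => [|n [c IH]]; first by exists k.
  by exists 0; rewrite /derive1n iterS -/(derive1n _ _) IH; apply/funext => t; rewrite derive1_cst.
by move=> n x; have [c ->] := H n; exact: derivable_cst.
Qed.

Lemma is_derive_affine f (a e t : R) : derivable f ((t - a) / e) 1 ->
  is_derive t 1 (fun s => f ((s - a) / e)) (f^`()%classic ((t - a) / e) / e).
Proof.
move=> df; have H : is_derive t 1 (fun s => (s - a) / e) e^-1.
  by apply: is_derive_eq; rewrite /GRing.scale/=; ring.
have df' : is_derive ((t - a) / e) 1 f (f^`()%classic ((t - a) / e)).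
  by rewrite derive1E; exact: derivableP.
have := @is_derive1_comp _ f (fun s => (s - a) / e) t _ _ df' H; rewrite mulrC; exact.
Qed.

Lemma derive1n_affine n f (a e : R) : smooth f ->
  derive1n n (fun t => f ((t - a) / e)) = (fun t => (e^-1) ^+ n * derive1n n f ((t - a) / e)).
Proof.
move=> sf; elim: n => [|n IH]; first by apply/funext => t; rewrite expr0 mul1r.
rewrite /derive1n !iterS -!/(derive1n _ _) IH; apply/funext => t; rewrite derive1E.
have H := is_derive_affine (sf n ((t - a) / e)).
have := @is_deriveZ _ _ _ _ (e^-1 ^+ n) _ _ _ H => [[_ K]].
by rewrite -/(derive1n n f) in K *; rewrite [LHS]K /GRing.scale/= exprS; ring.
Qed.

Lemma smooth_affine f (a e : R) : smooth f -> smooth (fun t => f ((t - a) / e)).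
Proof.
move=> sf n x; rewrite derive1n_affine//.
by apply: derivableM; [exact: derivable_cst|have [] := is_derive_affine (sf n ((x - a) / e))].
Qed.

Lemma smooth_derive1 f : smooth f -> smooth (f^`()%classic).
Proof. by move=> sf n x; have := sf n.+1 x; rewrite /derive1n -iterSr. Qed.

Lemma segint_derive1 f a b : smooth f -> a < b -> segint (f^`()%classic) a b = f b - f a.
Proof.
move=> sf ab; have cf := smooth_continuous sf.
have cf' := smooth_continuous (smooth_derive1 sf).
rewrite /segint /Rintegral (@continuous_FTC2 _ _ f)//.
- exact: continuous_subspaceT.
- split; first by move=> x _; exact: (sf 0%N x).
    by apply: cvg_at_right_filter; exact: cf.
  by apply: cvg_at_left_filter; exact: cf.
Qed.

Lemma integ_segint f a b : (forall t, t < a \/ b < t -> f t = 0) -> integ f = segint f a b.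
Proof.
move=> f0; rewrite /segint Rintegral_mkcond; apply: eq_integ => t.
rewrite patchE; case: ifPn => // /negP H; apply: f0; case: (ltP t a) => ta; first by left.
right; rewrite ltNge; apply/negP => tb; apply: H; rewrite inE/= in_itv/= ta; exact: tb.
Qed.

Section Plateau.
Variables (chi : R -> R) (e x y : R).
Hypotheses (chi_lp : lp_cutoff chi) (e0 : 0 < e) (xy : x < y).

(** The cutoff [chi] at scale [e], cut at its centre and pulled apart to equal 1 between [x] and
    [y]. It stays smooth because [chi] is constant around its centre. *)
Definition plateau t : R :=
  if t < x then chi ((t - x) / e) else if t <= y then 1 else chi ((t - y) / e).

Let chi1 a t : `|t - a| <= e -> chi ((t - a) / e) = 1.
Proof.
move=> H; have [_ _ -> //] := chi_lp.
by rewrite normrM normfV (gtr0_norm e0) ler_pdivrMr// mul1r.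
Qed.

Let chi0 a t : 2 * e <= `|t - a| -> chi ((t - a) / e) = 0.
Proof.
move=> H; have [_ _ _ -> //] := chi_lp.
by rewrite normrM normfV (gtr0_norm e0) ler_pdivlMr.
Qed.

Lemma plateau_left t : t < x + e -> t < y -> plateau t = chi ((t - x) / e).
Proof.
move=> h1 h2; rewrite /plateau; case: ltP => // xt; rewrite (ltW h2) chi1//.
by rewrite ger0_norm ?subr_ge0//; lra.
Qed.

Lemma plateau_right t : y - e < t -> x < t -> plateau t = chi ((t - y) / e).
Proof.
move=> h1 h2; rewrite /plateau; case: ltP => [xt|_]; first by move: (lt_trans h2 xt); rewrite ltxx.
case: leP => // ty; rewrite chi1// ler0_norm ?subr_le0//; lra.
Qed.

Lemma plateau_mid t : x - e < t < y + e -> plateau t = 1.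
Proof.
move=> /andP[h1 h2]; rewrite /plateau; case: ltP => xt.
  by rewrite chi1// ler0_norm ?subr_le0 ?(ltW xt)//; lra.
by case: leP => // ty; rewrite chi1// ger0_norm ?subr_ge0 ?(ltW ty)//; lra.
Qed.

Lemma plateau_out t : t <= x - 2 * e \/ y + 2 * e <= t -> plateau t = 0.
Proof.
move: (e0) (xy) => E0 XY H; rewrite /plateau; case: H => H.
  rewrite ifT; last by lra.
  by rewrite chi0// ler0_norm; lra.
rewrite ifF; last by apply/negbTE; rewrite -leNgt; lra.
rewrite ifF; last by apply/negbTE; rewrite -ltNge; lra.
by rewrite chi0// ger0_norm; lra.
Qed.

Lemma plateau_le1 t : `|plateau t| <= 1.
Proof.
have [_ c01 _ _] := chi_lp.
rewrite /plateau; case: ifP => _; first by have /andP[? ?] := c01 ((t - x) / e); rewrite ger0_norm.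
by case: ifP => _; [rewrite normr1|have /andP[? ?] := c01 ((t - y) / e); rewrite ger0_norm].
Qed.

Let near_lt a t : t < a -> \forall s \near t, s < a.
Proof. by move=> ta; exact: lt_nbhsl. Qed.

Let near_gt a t : a < t -> \forall s \near t, a < s.
Proof. by move=> ta; exact: lt_nbhsr. Qed.

(** The three formulas overlap around [x] and [y], where [chi] equals 1, so near every point a
    single one of them describes the function. *)
Lemma plateau_local t : exists2 g, [\/ g = (fun s => chi ((s - x) / e)), g = (fun=> 1) |
   g = (fun s => chi ((s - y) / e))] & \forall s \near t, g s = plateau s.
Proof.
move: (e0) (xy) => E0 XY; case: (ltP t (x + e)) => t1.
  case: (ltP t y) => t2.
    exists (fun s => chi ((s - x) / e)); first by constructor 1.
    near=> s; rewrite plateau_left//; near: s; [exact: near_lt|exact: near_lt].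
  exists (fun s => chi ((s - y) / e)); first by constructor 3.
  near=> s; rewrite plateau_right//; near: s; apply: near_gt => //; lra.
case: (ltP t (y + e)) => t2.
  exists (fun=> 1); first by constructor 2.
  near=> s; rewrite plateau_mid//; apply/andP; split; near: s; [apply: near_gt|exact: near_lt].
  by lra.
exists (fun s => chi ((s - y) / e)); first by constructor 3.
near=> s; rewrite plateau_right//; near: s; apply: near_gt => //; lra.
Unshelve. all: by end_near. Qed.

Lemma smooth_plateau : smooth plateau.
Proof.
have [sc _ _ _] := chi_lp.
apply: smooth_glue => t; have [g H gt] := plateau_local t; exists g => //.
by case: H => ->; [exact: smooth_affine|exact: smooth_cst|exact: smooth_affine].
Qed.

Lemma test_plateau : test_function plateau.
Proof.
split; first exact: smooth_plateau.
exists (`|x| + `|y| + 2 * e) => t; have := ler_norm y; have := ler_norm (- x); rewrite normrN => h1 h2.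
have := normr_ge0 x; have := normr_ge0 y => h3 h4; move: (e0) (xy) => E0 XY.
case: (ger0P t) => t0 H; apply: plateau_out; [right|left]; lra.
Qed.

Lemma plateau_derive_le (M : R) t : (forall s, `|chi^`()%classic s| <= M) ->
  `|plateau^`()%classic t| <= M / e.
Proof.
move=> HM; have [sc _ _ _] := chi_lp; have [g H gp] := plateau_local t.
have M0 : 0 <= M by exact: le_trans (HM 0).
have -> : plateau^`()%classic t = g^`()%classic t by rewrite !derive1E; apply: near_eq_derive; apply: filterS gp.
have aff a : `|(fun s => chi ((s - a) / e))^`()%classic t| <= M / e.
  have [_ K] := is_derive_affine (sc 0%N ((t - a) / e)); rewrite derive1E [X in `|X|]K.
  by rewrite normrM normfV (gtr0_norm e0) ler_wpM2r// invr_ge0 ltW.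
case: H => -> //; by rewrite derive1_cst normr0 divr_ge0// ltW.
Qed.

Lemma plateau_derive_mid t : x <= t <= y -> plateau^`()%classic t = 0.
Proof.
move: (e0) (xy) => E0 XY /andP[h1 h2]; rewrite derive1E.
transitivity ('D_1 (fun=> 1 : R) t); last by rewrite -derive1E derive1_cst.
apply: near_eq_derive; near=> s; rewrite plateau_mid//.
by apply/andP; split; near: s; [apply: near_gt|apply: near_lt]; lra.
Unshelve. all: by end_near. Qed.

Lemma plateau_derive_out t : t < x - 2 * e \/ y + 2 * e < t -> plateau^`()%classic t = 0.
Proof.
move=> H; rewrite derive1E.
transitivity ('D_1 (fun=> 0 : R) t); last by rewrite -derive1E derive1_cst.
apply: near_eq_derive; have : \forall s \near t, s <= x - 2 * e \/ y + 2 * e <= s.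
  by case: H => [/near_lt|/near_gt]; apply: filterS => s /ltW ?; [left|right].
by apply: filterS => s /plateau_out.
Qed.

End Plateau.

Lemma lp_cutoff_derive_bounded chi : lp_cutoff chi ->
  exists2 M : R, 0 < M & forall s, `|chi^`()%classic s| <= M.
Proof.
move=> [sc _ _ c0]; have cc := smooth_continuous (smooth_derive1 sc).
have [c _ H] := @EVT_max _ (fun s => `|chi^`()%classic s|) (-2) 2 ltac:(lra)
   (continuous_subspaceT (contnorm cc)).
exists (`|chi^`()%classic c| + 1); first by rewrite ltr_wpDl.
move=> s; case: (leP `|s| 2) => s2.
  apply: (@le_trans _ _ `|chi^`()%classic c|); last by rewrite lerDl.
  by apply: H; rewrite in_itv/= -ler_norml.
have -> : chi^`()%classic s = 0; last by rewrite normr0 addr_ge0.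
rewrite derive1E; transitivity ('D_1 (fun=> 0 : R) s); last by rewrite -derive1E derive1_cst.
apply: near_eq_derive; have : \forall t \near s, 2 < `|t|.
  by have /cvgr_gt := @contnorm _ _ (@contid R) s; apply.
by apply: filterS => t /ltW/c0.
Qed.

(** Against the derivative of a plateau, [u] is averaged with total mass 1 just left of [x] and -1
    just right of [y]; against the plateau itself, [v] is integrated over the segment and two short
    ends. Continuity of [u] and boundedness of [v] remove the error as the ends shrink. *)
Lemma du_bois_reymond chi u v (V : R) : lp_cutoff chi ->
  continuous (u : R -> R) -> continuous (v : R -> R) -> (forall t, `|v t| <= V) ->
  (forall phi, test_function phi ->
     integ (fun t => u t * phi^`()%classic t) = - integ (fun t => v t * phi t)) ->
  forall x y, x < y -> u y - u x = segint v x y.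
Proof.
move=> lp cu cv vV H x y xy; have [M M0 HM] := lp_cutoff_derive_bounded lp.
have V0 : 0 <= V by exact: le_trans (vV 0).
have si f a b : continuous (f : R -> R) -> mu.-integrable `[a, b] (EFin \o f).
  by move=> cf; apply: segint_integrable => t _; exact: cf.
apply/eqP; rewrite -subr_eq0 -normr_le0; apply/ler_addgt0Pl => d d0; rewrite addr0.
(* On each end the derivative of the plateau is at most [M / e] over a length [2 * e], so an
   oscillation [w] of [u] costs [d / 4]. *)
pose w := d / (8 * M); have w0 : 0 < w by rewrite divr_gt0// mulr_gt0.
have near0 a : exists2 eta, 0 < eta & forall t, `|a - t| < eta -> `|u a - u t| < w.
  by have /cvgrPdist_lt/(_ _ w0)[eta eta0 K] := cu a; exists eta.
have [e1 e10 H1] := near0 x; have [e2 e20 H2] := near0 y.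
(* The first two bounds keep the ends, of length [2 * e], where [u] oscillates by less than [w]; the
   third makes the integrals of [v] over both ends add up to at most [d / 2]. *)
pose e := Num.min (Num.min (e1 / 3) (e2 / 3)) (d / (8 * (V + 1))).
have e0 : 0 < e by rewrite !lt_min !divr_gt0// mulr_gt0// ltr_wpDl.
have ee1 : 2 * e < e1.
  have : e <= e1 / 3 by rewrite !ge_min lexx.
  by lra.
have ee2 : 2 * e < e2.
  have : e <= e2 / 3 by rewrite !ge_min lexx orbT.
  by lra.
have eV : 4 * (V * e) <= d / 2.
  have : e <= d / (8 * (V + 1)) by rewrite !ge_min lexx orbT.
  rewrite ler_pdivlMr; last by rewrite mulr_gt0// ltr_wpDl.
  by move: e0; clear -V0; lra.
pose p := plateau chi e x y; pose a := x - 2 * e; pose b := y + 2 * e.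
have sp : smooth p by exact: smooth_plateau.
have cp := smooth_continuous sp; have cp' := smooth_continuous (smooth_derive1 sp).
have ax : a < x by rewrite /a; lra.
have yb : y < b by rewrite /b; lra.
have tp : test_function p by exact: test_plateau.
have pl c1 c2 (uc : R) : c1 < c2 -> c2 - c1 = 2 * e -> (forall t, c1 <= t <= c2 -> `|uc - u t| < w) ->
   `|segint (fun t => u t * p^`()%classic t) c1 c2 - uc * (p c2 - p c1)| <= d / 4.
  move=> c12 ce ucw; rewrite -segint_derive1//.
  have K : segint (fun t => u t * p^`()%classic t) c1 c2 - uc * segint (p^`()%classic) c1 c2 =
     segint (fun t => (u t - uc) * p^`()%classic t) c1 c2.
    rewrite /segint -RintegralZl//; last exact: si.
    rewrite -RintegralB//.
    - by apply: eq_Rintegral => t _; rewrite mulrBl.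
    - by apply: si; apply: contM.
    - by apply: si; apply: contM => //; exact: contcst.
  rewrite K; have := @segint_near _ (fun t => (u t - uc) * p^`()%classic t) c1 c2 0 (w * (M / e)) (ltW c12).
  rewrite mul0r subr0 ce => L; apply: le_trans; first apply: L.
  - by apply: si; apply: contM => //; apply: contB => //; exact: contcst.
  - move=> t /ucw tw; rewrite subr0 normrM; apply: ler_pM => //; first by rewrite distrC ltW.
    exact: plateau_derive_le.
  rewrite /w le_eqVlt; apply/orP; left; apply/eqP; field.
  by rewrite !gt_eqF.
have vl c1 c2 : c1 < c2 -> c2 - c1 = 2 * e -> `|segint (fun t => v t * p t) c1 c2| <= V * (2 * e).
  move=> c12 ce; have := @segint_near _ (fun t => v t * p t) c1 c2 0 V (ltW c12).
  rewrite mul0r subr0 ce => L; apply: L; first by apply: si; apply: contM.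
  move=> t _; rewrite subr0 normrM -[V]mulr1; apply: ler_pM => //; exact: plateau_le1.
have split3 f : continuous (f : R -> R) -> segint f a b = segint f a x + segint f x y + segint f y b.
  move=> cf; rewrite -addrA -segint_split ?(ltW xy) ?(ltW yb)//; last exact: si.
  by rewrite -segint_split ?(ltW ax) ?(ltW (lt_trans xy yb))//; exact: si.
have := H p tp.
rewrite (@integ_segint _ a b); last by move=> t K; rewrite plateau_derive_out// mulr0.
rewrite (@integ_segint (fun t => v t * p t) a b); last first.
  move=> t K; rewrite /p plateau_out ?mulr0//; case: K => /ltW K; [by left|by right].
rewrite !split3; [|exact: contM|exact: contM].
have -> : segint (fun t => u t * p^`()%classic t) x y = 0.
  transitivity (segint (fun=> 0) x y); last by rewrite /segint Rintegral_cst// mul0r.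
  apply: eq_Rintegral => t.
  by rewrite inE/= in_itv/= => K; rewrite plateau_derive_mid// mulr0.
have -> : segint (fun t => v t * p t) x y = segint v x y.
  apply: eq_Rintegral => t; rewrite inE/= in_itv/= => /andP[t1 t2].
  by rewrite /p plateau_mid ?mulr1//; apply/andP; split; lra.
have pa : p a = 0 by apply: plateau_out => //; left.
have pb : p b = 0 by apply: plateau_out => //; right.
have px : p x = 1 by apply: plateau_mid => //; apply/andP; split; lra.
have py : p y = 1 by apply: plateau_mid => //; apply/andP; split; lra.
have L1 : `|segint (fun t => u t * p^`()%classic t) a x - u x| <= d / 4.
  have := pl a x (u x) ax; rewrite pa px subr0 mulr1; apply; first by rewrite /a; ring.
  by move=> t /andP[t1 t2]; apply: H1; rewrite ger0_norm ?subr_ge0//; apply: le_lt_trans ee1; move: t1; rewrite /a; lra.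
have L2 : `|segint (fun t => u t * p^`()%classic t) y b + u y| <= d / 4.
  have := pl y b (u y) yb; rewrite pb py sub0r mulrN1 opprK; apply; first by rewrite /b; ring.
  by move=> t /andP[t1 t2]; apply: H2; rewrite ler0_norm ?subr_le0//; apply: le_lt_trans ee2; move: t2; rewrite /b; lra.
have V1 : `|segint (fun t => v t * p t) a x| <= V * (2 * e) by apply: vl => //; rewrite /a; ring.
have V2 : `|segint (fun t => v t * p t) y b| <= V * (2 * e) by apply: vl => //; rewrite /b; ring.
move: L1 L2 V1 V2.
move: (segint _ a x) (segint _ a x) (segint _ y b) (segint _ y b) (segint v x y) => A1 A2 B1 B2 C.
rewrite !ler_norml => /andP[? ?] /andP[? ?] /andP[? ?] /andP[? ?] E.
by apply/andP; split; lra.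
Qed.

End DuBoisReymond.
(** * Increments in L^2 *)

Section SegmentL2.
Variable R : realType.
Local Notation mu := (@lebesgue_measure R).
Implicit Types (f g u v : R -> R) (a b x y t s e D : R).

Lemma cont_integrable_segment f a b : continuous (f : R -> R) ->
  mu.-integrable `[a, b] (EFin \o f).
Proof. by move=> cf; apply: segint_integrable => t _; exact: cf. Qed.

Lemma segint_FTC f g a b : (forall t, is_derive t 1 g (f t)) -> continuous (f : R -> R) ->
  a < b -> segint f a b = g b - g a.
Proof.
move=> dg cf ab.
have cg : continuous (g : R -> R).
  by move=> t; apply: differentiable_continuous; apply/derivable1_diffP; case: (dg t).
rewrite /segint /Rintegral (@continuous_FTC2 _ _ g)//.
- exact: continuous_subspaceT.
- split; first by move=> t _; case: (dg t).
    by apply: cvg_at_right_filter; exact: cg.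
  by apply: cvg_at_left_filter; exact: cg.
- by move=> t _; rewrite derive1E; case: (dg t).
Qed.

Lemma primitive_is_derive u v : continuous (v : R -> R) ->
  (forall x y, x < y -> u y - u x = segint v x y) -> forall x, is_derive x 1 u (v x).
Proof.
move=> cv H x.
suff K : h^-1 *: (u (h *: 1 + x) - u x) @[h --> 0^'] --> v x.
  by apply: DeriveDef; [exact: cvgP K|exact: cvg_lim K].
apply/cvgrPdist_le => e e0; have /cvgrPdist_le/(_ _ e0)[eta eta0 Hx] := cv x.
have bnd y z : y < z -> (forall t, y <= t <= z -> `|x - t| < eta) ->
    `|(u z - u y) - v x * (z - y)| <= e * (z - y).
  move=> yz yzx; rewrite H//; apply: segint_near; [exact: ltW|exact: cont_integrable_segment|].
  by move=> t /yzx/Hx; rewrite distrC.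
rewrite near_withinE; exists eta => // h; rewrite /ball/= sub0r normrN => heta h0.
rewrite /GRing.scale/= mulr1.
have -> : v x - h^-1 * (u (h + x) - u x) = - (h^-1 * (u (h + x) - u x - v x * h)) by field.
rewrite normrN normrM normfV ler_pdivrMl ?normr_gt0//.
case: (ltgtP h 0) h0 => // hh _.
  have := bnd (h + x) x; rewrite (ltr0_norm hh) => /(_ _ _) B.
  have -> : u (h + x) - u x - v x * h = - (u x - u (h + x) - v x * (x - (h + x))) by ring.
  have -> : - h * e = e * (x - (h + x)) by ring.
  rewrite normrN; apply: B; first by lra.
  move=> t /andP[t1 t2]; rewrite ger0_norm ?subr_ge0//; move: heta; rewrite (ltr0_norm hh); lra.
have := bnd x (h + x); rewrite (gtr0_norm hh) [_ * e]mulrC.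
have -> : h + x - x = h by ring.
move=> B; apply: B; first by rewrite ltrDr.
move=> t /andP[t1 t2]; rewrite ler0_norm ?subr_le0//; move: heta; rewrite (gtr0_norm hh); lra.
Qed.

Lemma segint_indic f a b : segint f a b = integ (fun t => f t * \1_(`[a, b]%classic) t).
Proof.
rewrite /segint Rintegral_mkcond; apply: eq_integ => x.
by rewrite patchE indicE; case: ifP; rewrite ?mulr1 ?mulr0.
Qed.

Lemma summable1_segment f a b : continuous (f : R -> R) ->
  summable1 (fun t => f t * \1_(`[a, b]%classic) t).
Proof.
move=> cf; have ci := cont_integrable_segment a b cf.
have : mu.-integrable setT ((EFin \o f) \_ `[a, b]).
  by rewrite -integrable_mkcond//; exact: measurable_itv.
apply: eq_integrable => // x _ /=.
by rewrite patchE indicE; case: ifP; rewrite ?mulr1 ?mulr0.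
Qed.

Lemma segint_le f g a b : continuous (f : R -> R) -> continuous (g : R -> R) ->
  (forall t, a <= t <= b -> f t <= g t) -> segint f a b <= segint g a b.
Proof.
move=> cf cg fg; rewrite !segint_indic; apply: integ_le; [exact: summable1_segment..|].
move=> t; rewrite indicE; case: (boolP (_ \in _)) => [|_]; last by rewrite !mulr0.
by rewrite inE/= in_itv/= !mulr1 => /fg.
Qed.

(** Cauchy-Schwarz against 1, as the non-negativity of the variance of [f] on the segment. *)
Lemma segint_sqr_le f s : 0 < s -> continuous (f : R -> R) ->
  segint f 0 s ^+ 2 <= s * segint (fun t => f t ^+ 2) 0 s.
Proof.
move=> s0 cf; set A := segint f 0 s; set B := segint _ 0 s.
have cst_ k : segint (fun=> k) 0 s = k * s.
  rewrite (@segint_FTC _ (fun t => k * t) 0 s _ (@contcst _ k))//; first by ring.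
  by move=> t; apply: is_derive_eq; rewrite /GRing.scale/=; ring.
have si g : continuous (g : R -> R) -> summable1 (fun t => g t * \1_(`[0, s]%classic) t).
  exact: summable1_segment.
have : 0 <= segint (fun t => (f t - A / s) ^+ 2) 0 s.
  have := @segint_le (fun=> 0) (fun t => (f t - A / s) ^+ 2) 0 s (@contcst _ 0).
  rewrite cst_ mul0r; apply; last by move=> t _; exact: sqr_ge0.
  by apply: contX; apply: contB => //; exact: contcst.
have -> : segint (fun t => (f t - A / s) ^+ 2) 0 s = B - 2 * (A / s) * A + (A / s) ^+ 2 * s.
  rewrite -cst_ /A /B !segint_indic -integZ; last exact: si.
  rewrite -integB; [|by apply: si; exact: contX|by apply: summable1Z; exact: si].
  rewrite -integD; last by apply: si; exact: contcst.
    by apply: eq_integ => t; ring.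
  by apply: summable1B; [apply: si; exact: contX|apply: summable1Z; exact: si].
have -> : B - 2 * (A / s) * A + (A / s) ^+ 2 * s = (s * B - A ^+ 2) / s.
  by field; rewrite gt_eqF.
by rewrite pmulr_lge0 ?invr_gt0// subr_ge0.
Qed.

Lemma measurable_segint (K : R -> R -> R) s :
  measurable_fun setT (fun z : R * R => K z.1 z.2) -> (forall x t, 0 <= K x t) ->
  (forall x, continuous (K x : R -> R)) ->
  measurable_fun setT (fun x => segint (K x) 0 s).
Proof.
move=> mK K0 cK; pose I : R -> R := \1_(`[0, s]%classic).
pose k (z : R * R) := (K z.1 z.2 * I z.2)%:E.
have mk : measurable_fun setT k.
  apply/measurable_EFinP; apply: measurable_funM => //.
  by apply: (measurableT_comp (f := I)) => //; exact: measurable_indic.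
have k0 z : (0 <= k z)%E by rewrite lee_fin mulr_ge0// /I indicE.
apply/measurable_EFinP.
have -> : EFin \o (fun x => segint (K x) 0 s) = fubini_F mu k.
  apply/funext => x; rewrite /fubini_F /= segint_indic -integE//; exact: summable1_segment.
by apply: (@measurable_fun_fubini_tonelli_F _ _ _ _ _ mu k) => //.
Qed.

Lemma segint_tonelli (K : R -> R -> R) s D : 0 < s ->
  measurable_fun setT (fun z : R * R => K z.1 z.2) -> (forall x t, 0 <= K x t) ->
  (forall x, continuous (K x : R -> R)) ->
  (forall t, 0 <= t <= s -> summable1 (K ^~ t) /\ integ (K ^~ t) <= D) ->
  summable1 (fun x => segint (K x) 0 s) /\ integ (fun x => segint (K x) 0 s) <= s * D.
Proof.
move=> s0 mK K0 cK KD; pose I : R -> R := \1_(`[0, s]%classic).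
have I0 t : 0 <= I t by rewrite /I indicE.
pose k (z : R * R) := (K z.1 z.2 * I z.2)%:E.
have mk : measurable_fun setT k.
  apply/measurable_EFinP; apply: measurable_funM => //.
  by apply: (measurableT_comp (f := I)) => //; exact: measurable_indic.
have k0 z : (0 <= k z)%E by rewrite lee_fin mulr_ge0.
have E1 x : (\int[mu]_t k (x, t) = (segint (K x) 0 s)%:E)%E.
  by rewrite segint_indic -integE//; exact: summable1_segment.
have pos x : 0 <= segint (K x) 0 s.
  by rewrite segint_indic; apply: integ_ge0 => t; rewrite mulr_ge0.
have sI : summable1 I by exact: integrable_indic_itv.
have IE : integ I = s.
  have := segint_indic (fun=> 1) 0 s; rewrite (@segint_FTC _ id) ?subr0//; last exact: contcst.
  by move=> ->; apply: eq_integ => t; rewrite mul1r.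
have mJ := measurable_segint s mK K0 cK.
have L : (\int[mu]_x (segint (K x) 0 s)%:E <= (s * D)%:E)%E.
  have -> : (\int[mu]_x (segint (K x) 0 s)%:E = \int[mu]_x \int[mu]_t k (x, t))%E.
    by apply: eq_integral => x _; rewrite E1.
  rewrite (@fubini_tonelli _ _ _ _ _ mu mu k mk k0).
  have -> : ((s * D)%:E = \int[mu]_t (D * I t)%:E)%E.
    by rewrite integE ?integZ ?IE 1?mulrC//; exact: summable1Z.
  apply: ge0_le_integral => //.
  - by move=> t _; exact: integral_ge0.
  - exact: (@measurable_fun_fubini_tonelli_G _ _ _ _ _ mu k).
  - by apply/measurable_EFinP; exact: summable1_mfun (summable1Z _ sI).
  move=> t _; rewrite /k /= /I indicE; case: (boolP (_ \in _)) => [|_]; last first.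
    by under eq_integral do rewrite mulr0; rewrite integral0 mulr0.
  rewrite inE/= in_itv/= => /KD[sK KDt].
  by under eq_integral do rewrite mulr1; rewrite integE// mulr1 lee_fin.
have sJ : summable1 (fun x => segint (K x) 0 s).
  by apply: summable1_ge0P => //; apply: le_lt_trans L _; rewrite ltry.
by split=> //; move: L; rewrite integE// lee_fin.
Qed.

(** Minkowski's integral inequality in L^2, by Cauchy-Schwarz in [t] and Tonelli. Integration over a
    segment of length [s] thus gains a full factor [s] in norm. *)
Lemma segint_minkowski (H : R -> R -> R) s D : 0 < s ->
  measurable_fun setT (fun z : R * R => H z.1 z.2) ->
  (forall x t, 0 <= H x t) -> (forall x, continuous (H x : R -> R)) ->
  (forall t, 0 <= t <= s -> summable1 (fun x => H x t ^+ 2) /\ integ (fun x => H x t ^+ 2) <= D) ->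
  square_summable (fun x => segint (H x) 0 s) /\
  integ (fun x => segint (H x) 0 s ^+ 2) <= s ^+ 2 * D.
Proof.
move=> s0 mH H0 cH HD.
have [||||sT iT] := @segint_tonelli (fun x t => H x t ^+ 2) s D s0.
- exact: measurable_funX.
- by move=> x t; exact: sqr_ge0.
- by move=> x; apply: contX.
- exact: HD.
have mS := measurable_segint s mH H0 cH.
have le x : `|segint (H x) 0 s ^+ 2| <= s * segint (fun t => H x t ^+ 2) 0 s.
  by rewrite ger0_norm ?sqr_ge0//; exact: segint_sqr_le.
have sS : summable1 (fun x => segint (H x) 0 s ^+ 2).
  by apply: summable1_le (summable1Z s sT) le; exact: measurable_funX.
split; first by [].
rewrite expr2 -mulrA; apply: (@le_trans _ _ (s * integ (fun x => segint (fun t => H x t ^+ 2) 0 s))).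
  rewrite -integZ//; apply: integ_le => //; first exact: summable1Z.
  by move=> x; apply: le_trans (ler_norm _) (le x).
by rewrite ler_pM2l.
Qed.

End SegmentL2.

(** * Phase and modulus on the top line *)

Section TopLine.
Variable R : realType.
Local Notation mu := (@lebesgue_measure R).
Implicit Types (x y s t a b : R).

(** A constant is uniformly continuous, so [uniformly_cont_decay] makes it arbitrarily small. *)
Lemma square_summable_cst (k : R) : square_summable (fun _ : R => k) -> k = 0.
Proof.
move=> Lk; apply/eqP; rewrite -normr_le0; apply/ler_addgt0Pl => e e0; rewrite addr0.
have [|M HM] := @uniformly_cont_decay _ (fun=> k) e Lk _ e0.
  by move=> d d0; exists 1 => // x y _; rewrite subrr normr0 ltW.
by apply: (HM `|M|); rewrite normr_id ler_norm.
Qed.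

Lemma segint_cst (c : R) a b : a < b -> segint (fun=> c) a b = c * (b - a).
Proof.
move=> ab; rewrite (@segint_FTC _ _ (fun t => c * t) a b _ (@contcst _ c) ab); first by ring.
by move=> t; apply: is_derive_eq; rewrite /GRing.scale/=; ring.
Qed.

Lemma segintZ (c : R) (f : R -> R) a b : continuous (f : R -> R) ->
  segint (fun t => c * f t) a b = c * segint f a b.
Proof.
move=> cf; rewrite !segint_indic -integZ; last exact: summable1_segment.
by apply: eq_integ => t; rewrite mulrA.
Qed.

Lemma segintD (f g : R -> R) a b : continuous (f : R -> R) -> continuous (g : R -> R) ->
  segint (fun t => f t + g t) a b = segint f a b + segint g a b.
Proof.
move=> cf cg; rewrite !segint_indic -integD; [|exact: summable1_segment..].
by apply: eq_integ => t; rewrite mulrDl.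
Qed.

Variables (r T1 T2 : R -> R) (k m K C : R).
Hypotheses (k0 : 0 <= k) (m0 : 0 < m) (C0 : 0 <= C).
Hypotheses (rm : forall x, m <= r x) (rK : forall x, r x <= K).
Hypothesis cr : continuous (r : R -> R).
Hypothesis T1E : forall x, T1 x ^+ 2 + T2 x ^+ 2 = 1.

Definition pressure x : R := r x - (r x)^-1.

Hypothesis dT1 : forall x, is_derive x 1 T1 (k * pressure x * T2 x).
Hypothesis dT2 : forall x, is_derive x 1 T2 (- (k * pressure x * T1 x)).
Hypothesis Lr : square_summable (fun x => r x - 1).

(** The two components of [Q] on the top in polar form [F = r * (T1 + i T2)]. The first brackets of
    the two definitions are the cosine and the sine of the phase increment; [F(x+s) / F(x)] and its
    inverse have conjugate phases, which explains the sum and the difference of the ratios. *)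
Definition re_quotient s x : R :=
  (T1 (x + s) * T1 x + T2 (x + s) * T2 x) * (r (x + s) / r x + r x / r (x + s)) - 2.
Definition im_quotient s x : R :=
  (T2 (x + s) * T1 x - T1 (x + s) * T2 x) * (r (x + s) / r x - r x / r (x + s)).

Let r0 x : 0 < r x. Proof. exact: lt_le_trans m0 (rm x). Qed.
Let rn x : r x != 0. Proof. by rewrite gt_eqF. Qed.
Let K0 : 0 < K. Proof. exact: lt_le_trans (r0 0) (rK 0). Qed.
Let vr x : (r x)^-1 <= m^-1. Proof. by rewrite lef_pV2 ?posrE. Qed.
Let vr0 x : 0 < (r x)^-1. Proof. by rewrite invr_gt0. Qed.

Let cT1 : continuous (T1 : R -> R).
Proof. by move=> x; apply: differentiable_continuous; apply/derivable1_diffP; case: (dT1 x). Qed.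
Let cT2 : continuous (T2 : R -> R).
Proof. by move=> x; apply: differentiable_continuous; apply/derivable1_diffP; case: (dT2 x). Qed.

Lemma cont_pressure : continuous (pressure : R -> R).
Proof. by apply: contB => //; exact: contV. Qed.
Let cp := cont_pressure.

Let T1le x : `|T1 x| <= 1.
Proof. by rewrite -ler_sqr ?nnegrE// real_normK ?num_real// expr1n -(T1E x) lerDl sqr_ge0. Qed.
Let T2le x : `|T2 x| <= 1.
Proof. by rewrite -ler_sqr ?nnegrE// real_normK ?num_real// expr1n -(T1E x) lerDr sqr_ge0. Qed.

Let pE x : pressure x = (r x - 1) * (1 + (r x)^-1).
Proof. by rewrite /pressure; field. Qed.

Lemma square_summable_pressure : square_summable pressure.
Proof.
apply: (square_summable_le _ (square_summableZ (1 + m^-1) Lr)).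
  by apply: measurable_contR; exact: cp.
move=> x; rewrite pE !normrM mulrC ler_wpM2r//.
rewrite !ger0_norm; last 2 first.
- by rewrite addr_ge0// invr_ge0 ltW.
- by rewrite addr_ge0// ltW.
by rewrite lerD2l.
Qed.
Let Lp := square_summable_pressure.

Let P := K + m^-1.

Let pP x : `|pressure x| <= P.
Proof.
rewrite /pressure; apply: (le_trans (ler_normB _ _)).
by rewrite !gtr0_norm// lerD.
Qed.

Let shift_cont (f : R -> R) x : continuous (f : R -> R) -> continuous (fun t => f (x + t) : R).
Proof.
move=> cf; have := @continuous_shiftR _ f x cf.
by under eq_fun do rewrite addrC.
Qed.

Let mnorm : measurable_fun setT (fun u : R => `|u|).
Proof. by apply: measurable_contR; apply: contnorm; exact: contid. Qed.

(** Times [k], this bounds the variation of each phase component between [x] and [x + s]. *)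
Definition pressure_mass s x : R := segint (fun t => `|pressure (x + t)|) 0 s.
Definition modulus_mass s x : R := segint (fun t => `|r (x + t) - r x|) 0 s.

Let mshift (f : R -> R) : continuous (f : R -> R) -> measurable_fun setT (fun z : R * R => f (z.1 + z.2)).
Proof.
move=> cf; apply: (measurableT_comp (f := f)); first exact: measurable_contR.
exact: measurable_funD.
Qed.

Lemma pressure_mass_L2 s : 0 < s -> square_summable (pressure_mass s) /\
  integ (fun x => pressure_mass s x ^+ 2) <= s ^+ 2 * integ (fun x => pressure x ^+ 2).
Proof.
move=> s0; apply: (segint_minkowski s0).
- by apply: (measurableT_comp mnorm); exact: mshift.
- by move=> x t; exact: normr_ge0.
- by move=> x; apply: contnorm; exact: shift_cont.
move=> t _; have [_ Lp2] := Lp.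
have cp2 : continuous (fun x => pressure x ^+ 2 : R) by exact: contX.
have E x : pressure (x + t) ^+ 2 = `|pressure (x + t)| ^+ 2 by rewrite real_normK ?num_real.
split; first by apply: eq_summable1 E _; exact: (summable1_shift t cp2 Lp2).
by rewrite -(eq_integ E) (integ_shift t cp2 Lp2).
Qed.

Lemma phase_difference s x : 0 < s ->
  T1 (x + s) - T1 x = segint (fun t => k * pressure (x + t) * T2 (x + t)) 0 s /\
  T2 (x + s) - T2 x = segint (fun t => - (k * pressure (x + t) * T1 (x + t))) 0 s.
Proof.
move=> s0.
have D (f df : R -> R) : (forall y, is_derive y 1 f (df y)) -> continuous (df : R -> R) ->
    f (x + s) - f x = segint (fun t => df (x + t)) 0 s.
  move=> fd cdf; have fd' t : is_derive t 1 (fun t => f (x + t)) (df (x + t)).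
    have H : is_derive t 1 (fun u => x + u) 1.
      by apply: is_derive_eq; rewrite /GRing.scale/=; ring.
    have := @is_derive1_comp _ f (fun u => x + u) t _ _ (fd (x + t)) H.
    by rewrite mulr1; exact.
  by rewrite (@segint_FTC _ _ _ 0 s fd' (@shift_cont df x cdf) s0) addr0.
have cc (f : R -> R) : continuous (f : R -> R) -> continuous (fun y => k * pressure y * f y : R).
  by move=> cf; apply: contM => //; apply: contM => //; exact: contcst.
by split; apply: D => //; [exact: cc|apply: contN; exact: cc].
Qed.

Let kpT (f : R -> R) x s : 0 < s -> continuous (f : R -> R) -> (forall y, `|f y| <= 1) ->
  `|segint (fun t => k * pressure (x + t) * f (x + t)) 0 s| <= k * pressure_mass s x.
Proof.
move=> s0 cf f1.
have c1 : continuous (fun t => k * pressure (x + t) * f (x + t) : R).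
  by apply: contM; [apply: contM; [exact: contcst|exact: shift_cont]|exact: shift_cont].
have c2 : continuous (fun t => `|pressure (x + t)| : R) by apply: contnorm; exact: shift_cont.
rewrite /pressure_mass !segint_indic -integZ; last exact: summable1_segment.
apply: integ_norm_le; [exact: summable1_segment|apply: summable1Z; exact: summable1_segment|].
move=> t; rewrite !normrM (ger0_norm k0) [`|\1__ _|]ger0_norm ?indicE//.
rewrite mulrA ler_wpM2r// -mulrA; apply: ler_wpM2l => //.
by rewrite ler_piMr.
Qed.

Lemma phase_difference_le s x : 0 < s ->
  `|T1 (x + s) - T1 x| <= k * pressure_mass s x /\ `|T2 (x + s) - T2 x| <= k * pressure_mass s x.
Proof.
move=> s0; have [-> ->] := phase_difference x s0; split; first exact: kpT.
have E t : - (k * pressure (x + t) * T1 (x + t)) = k * pressure (x + t) * (- T1 (x + t)) by ring.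
rewrite (_ : (fun t => _) = (fun t => k * pressure (x + t) * (fun y => - T1 y) (x + t))); last first.
  by apply/funext => t; rewrite E.
by apply: (@kpT (fun y => - T1 y)) => // [|y]; [exact: contN|rewrite normrN].
Qed.

Let cosE s x : 1 - (T1 (x + s) * T1 x + T2 (x + s) * T2 x) =
  ((T1 (x + s) - T1 x) ^+ 2 + (T2 (x + s) - T2 x) ^+ 2) / 2.
Proof.
have h1 := T1E x; have h2 := T1E (x + s).
have -> : ((T1 (x + s) - T1 x) ^+ 2 + (T2 (x + s) - T2 x) ^+ 2) / 2 =
   ((T1 (x + s) ^+ 2 + T2 (x + s) ^+ 2) + (T1 x ^+ 2 + T2 x ^+ 2)) / 2 -
   (T1 (x + s) * T1 x + T2 (x + s) * T2 x) by field.
by rewrite h1 h2; field.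
Qed.

(** For unit vectors [1 - cos] is half the squared distance ([cosE]), so it is of second order in
    the phase increment. *)
Lemma phase_cos_le s x : 0 < s ->
  0 <= 1 - (T1 (x + s) * T1 x + T2 (x + s) * T2 x) <= k ^+ 2 * pressure_mass s x ^+ 2.
Proof.
move=> s0; rewrite cosE divr_ge0 ?addr_ge0 ?sqr_ge0//=.
have [h1 h2] := phase_difference_le x s0.
have sq (a b : R) : `|a| <= b -> a ^+ 2 <= b ^+ 2.
  by move=> ab; rewrite -(real_normK (num_real a)) lerXn2r ?nnegrE// (le_trans _ ab).
have := sq _ _ h1; have := sq _ _ h2; rewrite exprMn; lra.
Qed.

Let ratio_le x y : 0 <= r y / r x + r x / r y <= 2 * (K / m).
Proof.
have H u v : 0 <= r u / r v <= K / m.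
  rewrite divr_ge0 ?(ltW (r0 _))//=; apply: ler_pM; rewrite ?(ltW (r0 _))//.
  by rewrite invr_ge0 ltW.
have /andP[? ?] := H x y; have /andP[? ?] := H y x; apply/andP; split; lra.
Qed.

(** [Re Q] is [(r (x + s) - r x) ^+ 2 / (r x * r (x + s))] less a term due to the rotation of the
    phase, of second order by [phase_cos_le]. Solving for the increment of [r] leaves quantities
    whose integrals are [O(s ^ 2)]. *)
Lemma modulus_difference_le s x : 0 < s ->
  (r (x + s) - r x) ^+ 2 <=
    K ^+ 2 * (re_quotient s x + 2 * (K / m) * (k ^+ 2 * pressure_mass s x ^+ 2)).
Proof.
move=> s0; have /andP[c1 c2] := phase_cos_le x s0; have /andP[q1 q2] := ratio_le x (x + s).
have E : (r (x + s) - r x) ^+ 2 = r (x + s) * r x * (re_quotient s x +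
   (1 - (T1 (x + s) * T1 x + T2 (x + s) * T2 x)) * (r (x + s) / r x + r x / r (x + s))).
  by rewrite /re_quotient; field; rewrite !rn.
set V := re_quotient s x + _ in E.
have V0 : 0 <= V.
  have : 0 <= r (x + s) * r x * V by rewrite -E sqr_ge0.
  by rewrite pmulr_rge0// mulr_gt0.
rewrite E; apply: (@le_trans _ _ (K ^+ 2 * V)).
  by rewrite ler_wpM2r// expr2; apply: ler_pM => //; exact: ltW.
rewrite ler_wpM2l ?sqr_ge0// /V lerD2l [leRHS]mulrC.
by apply: ler_pM.
Qed.

Hypothesis Q1 : forall s, 0 < s ->
  summable1 (re_quotient s) /\ integ (re_quotient s) <= C * s ^+ 2.

Let C1 := K ^+ 2 * (C + 2 * (K / m) * (k ^+ 2 * integ (fun x => pressure x ^+ 2))).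

Let Ip : 0 <= integ (fun x => pressure x ^+ 2).
Proof. by apply: integ_ge0 => x; exact: sqr_ge0. Qed.

Let C10 : 0 <= C1.
Proof.
have Km : 0 <= K / m by rewrite divr_ge0// ltW.
apply: mulr_ge0; first exact: sqr_ge0.
apply: addr_ge0 => //; apply: mulr_ge0; first exact: mulr_ge0.
by apply: mulr_ge0 => //; exact: sqr_ge0.
Qed.

Lemma modulus_difference_L2 s : 0 <= s -> square_summable (fun x => r (x + s) - r x) /\
  integ (fun x => (r (x + s) - r x) ^+ 2) <= C1 * s ^+ 2.
Proof.
have cd : continuous (fun x => r (x + s) - r x : R) by apply: contB => //; exact: continuous_shiftR.
(* The value [s = 0] is included because [modulus_mass_L2] integrates over all steps from 0 to
   [s]. *)
rewrite le_eqVlt => /predU1P[<-|s0].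
  rewrite (_ : (fun x => r (x + 0) - r x) = (fun=> 0)); last by apply/funext => x; rewrite addr0 subrr.
  rewrite (_ : (fun x => (r (x + 0) - r x) ^+ 2) = (fun=> 0)); last first.
    by apply/funext => x; rewrite addr0 subrr expr0n.
  rewrite integ0 expr0n mulr0; split=> //; split; first exact: measurable_cst.
  by rewrite expr0n; exact: summable1_cst0.
have [sq iq] := Q1 s0; have [[_ sA] iA] := pressure_mass_L2 s0.
pose c := 2 * (K / m) * k ^+ 2.
have sB : summable1 (fun x => K ^+ 2 * (re_quotient s x + c * pressure_mass s x ^+ 2)).
  by apply: summable1Z; apply: summable1D => //; exact: summable1Z.
have le x : (r (x + s) - r x) ^+ 2 <= K ^+ 2 * (re_quotient s x + c * pressure_mass s x ^+ 2).
  by rewrite /c -mulrA; exact: modulus_difference_le.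
have sS : summable1 (fun x => (r (x + s) - r x) ^+ 2).
  apply: summable1_le sB _; first by apply: measurable_contR; exact: contX.
  by move=> x; rewrite ger0_norm ?sqr_ge0.
split; first by split => //; exact: measurable_contR.
apply: le_trans (integ_le sS sB le) _.
rewrite integZ; last by apply: summable1D => //; exact: summable1Z.
rewrite integD//; last exact: summable1Z.
rewrite integZ// /C1 -mulrA ler_wpM2l ?sqr_ge0// mulrDl; apply: lerD => //.
have -> : 2 * (K / m) * (k ^+ 2 * integ (fun x => pressure x ^+ 2)) * s ^+ 2 =
   c * (s ^+ 2 * integ (fun x => pressure x ^+ 2)) by rewrite /c; ring.
by apply: ler_wpM2l => //; rewrite /c !mulr_ge0 ?sqr_ge0// ?invr_ge0 ltW.
Qed.

Lemma modulus_mass_L2 s : 0 < s -> square_summable (modulus_mass s) /\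
  integ (fun x => modulus_mass s x ^+ 2) <= s ^+ 2 * (C1 * s ^+ 2).
Proof.
move=> s0; apply: (segint_minkowski s0).
- apply: (measurableT_comp mnorm); apply: measurable_funB; first exact: mshift.
  by apply: (measurableT_comp (f := r)) => //; exact: measurable_contR.
- by move=> x t; exact: normr_ge0.
- by move=> x; apply: contnorm; apply: contB; [exact: shift_cont|exact: contcst].
move=> t /andP[t0 ts]; have [[_ h1] h2] := modulus_difference_L2 t0.
have E x : (r (x + t) - r x) ^+ 2 = `|r (x + t) - r x| ^+ 2 by rewrite real_normK ?num_real.
split; first exact: eq_summable1 E h1.
rewrite -(eq_integ E); apply: (le_trans h2).
by rewrite ler_wpM2l// lerXn2r ?nnegrE// (le_trans t0).
Qed.

(** A symmetric mean that stands for half the pressure, chosen so that the chain rule is exact for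
    finite increments: [(r (x + s) / r x - r x / r (x + s)) * X s x] is the increment of
    [r + 1 / r]. *)
Let X s x : R := (r x * r (x + s) - 1) / (r x + r (x + s)).

Let L1 := 1 + m^-1 ^+ 2.
Let L2 := (K ^+ 2 + 1) / (m * (m + m)).

Let pressure_lip x y : `|pressure x - pressure y| <= L1 * `|r x - r y|.
Proof.
have -> : pressure x - pressure y = (1 + (r x)^-1 * (r y)^-1) * (r x - r y).
  by rewrite /pressure; field; rewrite !rn.
rewrite normrM ler_wpM2r// ger0_norm; last by rewrite addr_ge0// mulr_ge0// ltW.
by rewrite lerD2l expr2; apply: ler_pM => //; exact: ltW.
Qed.

Let pressure_mean s x : `|2 * X s x - pressure x| <= L2 * `|r (x + s) - r x|.
Proof.
have rr y : 0 < r x + r y by rewrite addr_gt0.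
have -> : 2 * X s x - pressure x = (r x ^+ 2 + 1) / (r x * (r x + r (x + s))) * (r (x + s) - r x).
  by rewrite /X /pressure; field; rewrite rn gt_eqF.
rewrite normrM ler_wpM2r// ger0_norm; last first.
  by rewrite divr_ge0 ?addr_ge0 ?sqr_ge0// mulr_ge0// ltW.
apply: ler_pM.
- by rewrite addr_ge0// sqr_ge0.
- by rewrite invr_ge0 mulr_ge0// ltW.
- by rewrite lerD2r lerXn2r ?nnegrE// ltW.
rewrite lef_pV2 ?posrE ?mulr_gt0// ?addr_gt0//.
by apply: ler_pM; rewrite ?(ltW m0)// ?addr_ge0 ?(ltW m0)// lerD.
Qed.

(** The cost of three replacements: of the pressure at [x] by [2 * X s x], of the pressure at
    [x + t] by the one at [x], and of the cosine of the phase increment by 1. *)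
Definition phase_error s x : R :=
  s * (L2 * `|r (x + s) - r x|) + L1 * modulus_mass s x + k ^+ 2 * P ^+ 2 * s * pressure_mass s x.

Let P0 : 0 <= P. Proof. by rewrite addr_ge0// ?invr_ge0 ltW. Qed.

Let pressure_mass_le s x : 0 < s -> 0 <= pressure_mass s x <= P * s.
Proof.
move=> s0; rewrite /pressure_mass; apply/andP; split.
  by rewrite segint_indic; apply: integ_ge0 => t; rewrite mulr_ge0// indicE.
have -> : P * s = segint (fun=> P) 0 s by rewrite segint_cst// subr0.
apply: segint_le; [by apply: contnorm; exact: shift_cont|exact: contcst|].
by move=> t _; exact: pP.
Qed.

(** The sine of the phase increment is the integral of [- k] times the pressure times [w t], the
    cosine of the increment reached so far. Replacing the integrand by the constant
    [- 2 * k * X s x] costs at most [k * phase_error s x]. *)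
Lemma sin_asymptotics s x : 0 < s <= 1 ->
  `|T2 (x + s) * T1 x - T1 (x + s) * T2 x + 2 * k * s * X s x| <= k * phase_error s x.
Proof.
move=> /andP[s0 s1]; have [D1 D2] := phase_difference x s0.
pose w t := T1 x * T1 (x + t) + T2 x * T2 (x + t).
have cw : continuous (w : R -> R).
  by apply: contD; apply: contM; by [exact: contcst|exact: shift_cont].
have cpx : continuous (fun t => pressure (x + t) : R) by exact: shift_cont.
have si f : continuous (f : R -> R) -> summable1 (fun t => f t * \1_(`[0, s]%classic) t).
  exact: summable1_segment.
have SE : T2 (x + s) * T1 x - T1 (x + s) * T2 x =
   segint (fun t => - k * (pressure (x + t) * w t)) 0 s.
  have -> : T2 (x + s) * T1 x - T1 (x + s) * T2 x =
    T1 x * (T2 (x + s) - T2 x) - T2 x * (T1 (x + s) - T1 x) by ring.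
  have c1 : continuous (fun t => k * pressure (x + t) * T2 (x + t) : R).
    by apply: contM; [apply: contM => //; exact: contcst|exact: shift_cont].
  have c2 : continuous (fun t => - (k * pressure (x + t) * T1 (x + t)) : R).
    by apply: contN; apply: contM; [apply: contM => //; exact: contcst|exact: shift_cont].
  rewrite D1 D2 !segint_indic -!integZ ?si// -integB; [|exact/summable1Z/si..].
  by apply: eq_integ => t; rewrite /w; ring.
have XE : 2 * k * s * X s x = segint (fun t => k * (2 * X s x)) 0 s.
  by rewrite segint_cst// subr0; ring.
pose e t := L2 * `|r (x + s) - r x| + L1 * `|r (x + t) - r x| + k ^+ 2 * P ^+ 2 * s * `|pressure (x + t)|.
have crx : continuous (fun t => `|r (x + t) - r x| : R).
  by apply: contnorm; apply: contB; [exact: shift_cont|exact: contcst].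
have cpn : continuous (fun t => `|pressure (x + t)| : R) by apply: contnorm.
have ce : continuous (e : R -> R).
  apply: contD; last by apply: contM => //; exact: contcst.
  by apply: contD; [exact: contcst|apply: contM => //; exact: contcst].
have errE : k * phase_error s x = segint (fun t => k * e t) 0 s.
  rewrite segintZ// /e segintD; last by apply: contM => //; exact: contcst.
    rewrite segintD; [|exact: contcst|by apply: contM => //; exact: contcst].
    by rewrite segint_cst// !segintZ// /phase_error subr0; congr (_ * (_ + _ + _)); rewrite mulrC.
  by apply: contD; [exact: contcst|apply: contM => //; exact: contcst].
rewrite SE XE errE !segint_indic -integD; [|apply: si..]; last 2 first.
- by apply: contM; [exact: contcst|exact: contM].
- exact: contcst.
apply: integ_norm_le.
- apply: summable1D; apply: si; last exact: contcst.
  by apply: contM; [exact: contcst|exact: contM].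
- by apply: si; apply: contM => //; exact: contcst.
move=> t; rewrite -mulrDl normrM [`|\1__ _|]ger0_norm ?indicE//.
case: (boolP (t \in _)) => [|_]; last by rewrite !mulr0.
rewrite inE/= in_itv/= => /andP[t0 ts]; rewrite !mulr1.
have -> : - k * (pressure (x + t) * w t) + k * (2 * X s x) =
  k * ((2 * X s x - pressure x) + (pressure x - pressure (x + t)) + pressure (x + t) * (1 - w t)) by ring.
rewrite normrM (ger0_norm k0) ler_wpM2l//.
apply: (le_trans (ler_normD _ _)); apply: lerD.
  apply: (le_trans (ler_normD _ _)); apply: lerD; first exact: pressure_mean.
  by rewrite (distrC (r _)); exact: pressure_lip.
rewrite normrM mulrC ler_wpM2r//.
move: t0; rewrite le_eqVlt => /predU1P[<-|t0].
  rewrite /w addr0 -!expr2 T1E subrr normr0 !mulr_ge0 ?sqr_ge0// ltW//.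
have := phase_cos_le x t0; have -> : 1 - (T1 (x + t) * T1 x + T2 (x + t) * T2 x) = 1 - w t.
  by rewrite /w; ring.
move=> /andP[w0 w1]; rewrite ger0_norm//; apply: (le_trans w1); rewrite -[leRHS]mulrA ler_wpM2l ?sqr_ge0//.
have /andP[a0 a1] := pressure_mass_le x t0.
apply: (@le_trans _ _ ((P * t) ^+ 2)); first by rewrite lerXn2r ?nnegrE ?mulr_ge0// ltW.
rewrite exprMn ler_wpM2l ?sqr_ge0//.
apply: (@le_trans _ _ (s ^+ 2)); first by rewrite lerXn2r ?nnegrE// ltW.
by rewrite expr2 ler_piMr// ltW.
Qed.

Let phase_error_ge0 s x : 0 < s -> 0 <= phase_error s x.
Proof.
move=> s0; have /andP[a0 _] := pressure_mass_le x s0.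
have b0 : 0 <= modulus_mass s x.
  by rewrite /modulus_mass segint_indic; apply: integ_ge0 => t; rewrite mulr_ge0// indicE.
have l1 : 0 <= L1 by rewrite addr_ge0// sqr_ge0.
have l2 : 0 <= L2 by rewrite divr_ge0 ?addr_ge0 ?sqr_ge0// mulr_ge0 ?addr_ge0// ltW.
rewrite /phase_error; apply: addr_ge0; first apply: addr_ge0.
- exact: mulr_ge0 (ltW s0) (mulr_ge0 l2 (normr_ge0 _)).
- exact: mulr_ge0.
- exact: mulr_ge0 (mulr_ge0 (mulr_ge0 (sqr_ge0 _) (sqr_ge0 _)) (ltW s0)) a0.
Qed.

Let C3 := 4 * (L2 ^+ 2 * C1) + 4 * (L1 ^+ 2 * C1) +
  2 * ((k ^+ 2 * P ^+ 2) ^+ 2 * integ (fun x => pressure x ^+ 2)).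

Let C30 : 0 <= C3.
Proof.
have H (a b c : R) : 0 <= a -> 0 <= c -> 0 <= a * (b ^+ 2 * c).
  by move=> a0 c0; rewrite mulr_ge0// mulr_ge0// sqr_ge0.
by rewrite /C3; apply: addr_ge0; [apply: addr_ge0|]; apply: H.
Qed.

(** Each of the three terms has one factor of size [s] from the step or the length of the segment,
    and a second one from an increment of [r] or from the pressure mass; hence [s ^+ 4] for the
    squared norm. *)
Lemma phase_error_L2 s : 0 < s -> square_summable (phase_error s) /\
  integ (fun x => phase_error s x ^+ 2) <= C3 * s ^+ 4.
Proof.
move=> s0; have [Ld Id] := modulus_difference_L2 (ltW s0).
have [Lm Im] := modulus_mass_L2 s0; have [La Ia] := pressure_mass_L2 s0.
pose u1 x := s * L2 * `|r (x + s) - r x|.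
pose u2 x := L1 * modulus_mass s x.
pose u3 x := k ^+ 2 * P ^+ 2 * s * pressure_mass s x.
have Lu1 : square_summable u1 by apply: square_summableZ; exact: square_summable_norm.
have Lu2 : square_summable u2 by exact: square_summableZ.
have Lu3 : square_summable u3 by exact: square_summableZ.
have -> : phase_error s = (fun x => (u1 x + u2 x) + u3 x).
  by apply/funext => x; rewrite /phase_error /u1 /u2 /u3; ring.
split; first by apply: square_summableD => //; exact: square_summableD.
have I1 : integ (fun x => u1 x ^+ 2) <= L2 ^+ 2 * C1 * s ^+ 4.
  have E x : (s * L2) ^+ 2 * (r (x + s) - r x) ^+ 2 = u1 x ^+ 2.
    by rewrite /u1 [RHS]exprMn real_normK ?num_real.
  rewrite -(eq_integ E) integZ; last by case: Ld.
  have -> : L2 ^+ 2 * C1 * s ^+ 4 = (s * L2) ^+ 2 * (C1 * s ^+ 2) by ring.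
  by rewrite ler_wpM2l ?sqr_ge0.
have I2 : integ (fun x => u2 x ^+ 2) <= L1 ^+ 2 * C1 * s ^+ 4.
  have E x : L1 ^+ 2 * modulus_mass s x ^+ 2 = u2 x ^+ 2 by rewrite /u2 exprMn.
  rewrite -(eq_integ E) integZ; last by case: Lm.
  have -> : L1 ^+ 2 * C1 * s ^+ 4 = L1 ^+ 2 * (s ^+ 2 * (C1 * s ^+ 2)) by ring.
  by rewrite ler_wpM2l ?sqr_ge0.
have I3 : integ (fun x => u3 x ^+ 2) <=
    (k ^+ 2 * P ^+ 2) ^+ 2 * integ (fun x => pressure x ^+ 2) * s ^+ 4.
  have E x : (k ^+ 2 * P ^+ 2 * s) ^+ 2 * pressure_mass s x ^+ 2 = u3 x ^+ 2 by rewrite /u3 [RHS]exprMn.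
  rewrite -(eq_integ E) integZ; last by case: La.
  have -> : (k ^+ 2 * P ^+ 2) ^+ 2 * integ (fun x => pressure x ^+ 2) * s ^+ 4 =
    (k ^+ 2 * P ^+ 2 * s) ^+ 2 * (s ^+ 2 * integ (fun x => pressure x ^+ 2)) by ring.
  by rewrite ler_wpM2l ?sqr_ge0.
have J1 := integ_sqrD Lu1 Lu2; have J2 := integ_sqrD (square_summableD Lu1 Lu2) Lu3.
apply: (le_trans J2); rewrite /C3; move: I1 I2 I3 J1.
move: (integ _) (integ _) (integ _) (integ _) => i1 i2 i3 i4 I1 I2 I3 J1.
lra.
Qed.

(** * The weighted energy estimate *)

Section Weighted.
Variables (phi slope : R -> R).
Hypotheses (cphi : continuous (phi : R -> R)) (phi1 : forall x, `|phi x| <= 1).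
Hypotheses (cslope : continuous (slope : R -> R)) (slope0 : forall x, 0 < slope x).
Hypothesis slope_le : forall s x, 0 < s <= 1 -> s * slope x <= phi x - phi (x - s).
Hypothesis Q2 : forall s, 0 < s -> summable1 (fun x => phi x * im_quotient s x) /\
  integ (fun x => phi x * im_quotient s x) <= 0.
Hypothesis k_gt0 : 0 < k.

Let g x : R := r x + (r x)^-1 - 2.

Let gE x : g x = (r x)^-1 * (r x - 1) ^+ 2.
Proof. by rewrite /g; field. Qed.

Let g0 x : 0 <= g x.
Proof. by rewrite gE mulr_ge0 ?sqr_ge0// ltW. Qed.

Let cg : continuous (g : R -> R).
Proof. by apply: contB; [apply: contD => //; exact: contV|exact: contcst]. Qed.

Let sg : summable1 g.
Proof.
have [_ s2] := Lr; apply: (summable1_le _ (summable1Z m^-1 s2)).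
  by apply: measurable_contR; exact: cg.
by move=> x; rewrite ger0_norm// gE ler_wpM2r// sqr_ge0.
Qed.

Let sgM (f : R -> R) : continuous (f : R -> R) -> (forall x, `|f x| <= 1) ->
  summable1 (fun x => f x * g x).
Proof.
move=> cf f1; apply: eq_summable1 (summable1M (measurable_contR cf) f1 sg) => x.
by rewrite mulrC.
Qed.

Let cphis s : continuous (fun x => phi (x - s) : R).
Proof. exact: (@continuous_shiftR _ phi (- s)). Qed.

Let ssg : summable1 (fun x => slope x * g x).
Proof.
have s1 : summable1 (fun x => phi x * g x - phi (x - 1) * g x).
  by apply: summable1B; apply: sgM.
apply: (summable1_le _ s1); first by apply: measurable_contR; exact: contM.
move=> x; rewrite ger0_norm ?mulr_ge0 ?(ltW (slope0 x))// -mulrBl ler_wpM2r//.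
by have := @slope_le 1 x; rewrite mul1r; apply; rewrite ltr01 lexx.
Qed.

(** The leading term of [phi * Im Q] is [2 * k * s * G], and translation by [s] moves the difference
    from [g] to [phi], where [slope_le] bounds it below. The error is controlled by the product of
    an increment of [r] and [phase_error], hence is [O(s ^ 3)] by Cauchy-Schwarz. *)
Lemma weighted_energy s : 0 < s <= 1 ->
  2 * k * s * (s * integ (fun x => slope x * g x)) <=
  2 * (K / m ^+ 2) * k * (2 * ((C1 + 1) * s * ((C3 + 1) * s ^+ 2))).
Proof.
move=> s01; have /andP[s0 s1] := s01.
have [Ld Id] := modulus_difference_L2 (ltW s0); have [Le Ie] := phase_error_L2 s0.
have [sQ iQ] := Q2 s0.
pose M := 2 * (K / m ^+ 2) * k.
have M0 : 0 <= M by rewrite /M !mulr_ge0 ?invr_ge0 ?sqr_ge0// ltW.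
pose G x := phi x * g x - phi x * g (x + s).
have sG' : summable1 (fun x => phi x * g (x + s)).
  apply: eq_summable1 (@summable1_shift _ (fun x => phi (x - s) * g x) s _ _) => [x||].
  - by rewrite addrK.
  - by apply: contM.
  - exact: sgM.
have sG : summable1 G by apply: summable1B => //; exact: sgM.
have iG : integ G = integ (fun x => phi x * g x - phi (x - s) * g x).
  rewrite /G !integB//; try exact: sgM; congr (_ - _).
  rewrite -(@integ_shift _ (fun x => phi (x - s) * g x) s); [|exact: contM|exact: sgM].
  by apply: eq_integ => x; rewrite addrK.
have lower : s * integ (fun x => slope x * g x) <= integ G.
  rewrite iG -integZ//; apply: integ_le; first exact: summable1Z.
    by apply: summable1B; exact: sgM.
  by move=> x; rewrite mulrA -mulrBl ler_wpM2r//; exact: slope_le.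
have pt x : 2 * k * s * G x <= phi x * im_quotient s x +
    M * `|(r (x + s) - r x) * phase_error s x|.
  pose D := r (x + s) / r x - r x / r (x + s).
  pose S := T2 (x + s) * T1 x - T1 (x + s) * T2 x.
  have rr : 0 < r x + r (x + s) by rewrite addr_gt0.
  have DX : D * X s x = g (x + s) - g x.
    by rewrite /D /X /g; field; rewrite !rn gt_eqF.
  have E : 2 * k * s * G x = phi x * im_quotient s x - phi x * (D * (S + 2 * k * s * X s x)).
    have -> : im_quotient s x = S * D by [].
    have -> : G x = - phi x * (D * X s x) by rewrite DX /G; ring.
    by ring.
  rewrite E lerD2l; apply: (le_trans (ler_norm _)); rewrite normrN normrM.
  apply: (@le_trans _ _ (1 * `|D * (S + 2 * k * s * X s x)|)); first by rewrite ler_wpM2r.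
  rewrite mul1r normrM.
  have DE : D = (r (x + s) + r x) / (r x * r (x + s)) * (r (x + s) - r x).
    by rewrite /D; field; rewrite !rn.
  have Dle : `|D| <= 2 * (K / m ^+ 2) * `|r (x + s) - r x|.
    rewrite DE normrM ler_wpM2r// ger0_norm; last first.
      by rewrite divr_ge0 ?addr_ge0 ?mulr_ge0// ltW.
    rewrite mulrA; apply: ler_pM.
    - by rewrite addr_ge0// ltW.
    - by rewrite invr_ge0 mulr_ge0// ltW.
    - by have := rK x; have := rK (x + s); lra.
    rewrite lef_pV2 ?posrE ?exprn_gt0 ?mulr_gt0// expr2.
    by apply: ler_pM => //; exact: ltW.
  have Sle := sin_asymptotics x s01; rewrite -/S in Sle.
  apply: (@le_trans _ _ (2 * (K / m ^+ 2) * `|r (x + s) - r x| * (k * phase_error s x))).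
    by apply: ler_pM.
  rewrite normrM [`|phase_error _ _|]ger0_norm; last exact: phase_error_ge0.
  by rewrite /M le_eqVlt; apply/orP; left; apply/eqP; ring.
have c1 : 0 <= (C1 + 1) * s by rewrite mulr_ge0 ?addr_ge0// ltW.
have c3 : 0 < (C3 + 1) * s ^+ 2 by exact: mulr_gt0 (ltr_wpDl C30 ltr01) (exprn_gt0 _ s0).
(* This avoids square roots: [integ_mul_sqrt] wants squared norms bounded by squares, and [C1], [C3]
   are at most the squares of [C1 + 1], [C3 + 1]. *)
have sq (a : R) : 0 <= a -> a <= (a + 1) ^+ 2.
  move=> a0; have -> : (a + 1) ^+ 2 = a + (a ^+ 2 + a + 1) by ring.
  by rewrite lerDl !addr_ge0// sqr_ge0.
have mul := integ_mul_sqrt Ld Le c1 c3.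
have {}mul := mul (le_trans Id _) (le_trans Ie _).
have sDe : summable1 (fun x => `|(r (x + s) - r x) * phase_error s x|).
  by apply: summable1_norm; exact: square_summableM.
have tot := integ_le (summable1Z (2 * k * s) sG) (summable1D sQ (summable1Z M sDe)) pt.
rewrite integZ// integD// in tot; last exact: summable1Z.
rewrite integZ// in tot.
apply: (@le_trans _ _ (2 * k * s * integ G)).
  by rewrite ler_wpM2l// !mulr_ge0// ltW.
apply: (le_trans tot); rewrite -[leRHS]add0r; apply: lerD => //.
rewrite -/M ler_wpM2l//; apply: mul; rewrite exprMn.
  by rewrite ler_wpM2r ?sqr_ge0//; exact: sq.
by rewrite -exprM ler_wpM2r ?exprn_ge0 ?(ltW s0)//; exact: sq.
Qed.

(** Division of [weighted_energy] by [2 * k * s ^+ 2] leaves [I <= Z * s] for all small [s], while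
    the integrand of [I] is non-negative and vanishes only where [r = 1]. *)
Lemma weighted_rigidity x : r x = 1.
Proof.
pose I := integ (fun x => slope x * g x).
pose Z := 2 * (K / m ^+ 2) * ((C1 + 1) * (C3 + 1)).
have Z0 : 0 <= Z.
  apply: mulr_ge0; last exact: mulr_ge0 (addr_ge0 C10 ler01) (addr_ge0 C30 ler01).
  by apply: mulr_ge0 => //; exact: divr_ge0 (ltW K0) (sqr_ge0 m).
have I_le s : 0 < s <= 1 -> I <= Z * s.
  move=> s01; have /andP[s0 s1] := s01; have := weighted_energy s01; rewrite -/I.
  have -> : 2 * k * s * (s * I) = 2 * k * s ^+ 2 * I by ring.
  have -> : 2 * (K / m ^+ 2) * k * (2 * ((C1 + 1) * s * ((C3 + 1) * s ^+ 2))) =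
    2 * k * s ^+ 2 * (Z * s) by rewrite /Z; ring.
  by rewrite ler_pM2l// !mulr_gt0// exprn_gt0.
have I0 : I <= 0.
  apply/ler_addgt0Pl => e e0; rewrite addr0.
  pose s := Num.min 1 (e / (Z + 1)).
  have z1 : 0 < Z + 1 by rewrite ltr_wpDl.
  have s0 : 0 < s by rewrite lt_min ltr01 divr_gt0.
  have := I_le s; rewrite s0 ge_min lexx => /(_ isT) H; apply: (le_trans H).
  apply: (@le_trans _ _ (Z * (e / (Z + 1)))); first by rewrite ler_wpM2l// ge_min lexx orbT.
  rewrite mulrCA ler_piMr ?(ltW e0)// ler_pdivrMr// mul1r; by rewrite lerDl.
have := integ_eq0_continuous (contM cslope cg) ssg (fun x => mulr_ge0 (ltW (slope0 x)) (g0 x)) I0 x.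
move/eqP; rewrite mulf_eq0 gt_eqF//= gE mulf_eq0 invr_eq0 (negbTE (rn x))/= sqrf_eq0 subr_eq0.
by move/eqP.
Qed.

End Weighted.

(** Without rotation of the phase, [Re Q] is a positive multiple of the squared increment of [r].
    Its integral being non-positive, [r] is constant, and square summability of [r - 1] fixes the
    constant. *)
Lemma unweighted_rigidity : k = 0 -> (forall s, 0 < s -> integ (re_quotient s) <= 0) ->
  forall x, r x = 1.
Proof.
move=> kE Q0.
have E s x : 0 < s -> re_quotient s x = (r (x + s) - r x) ^+ 2 / (r x * r (x + s)).
  move=> s0; have := phase_cos_le x s0; rewrite kE expr0n mul0r => c0.
  have c1 : T1 (x + s) * T1 x + T2 (x + s) * T2 x = 1.
    by apply/eqP; rewrite eq_sym -subr_eq0 eq_le andbC.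
  by rewrite /re_quotient c1; field; rewrite !rn.
have eq_r x s : 0 < s -> r (x + s) = r x.
  move=> s0; have [sQ _] := Q1 s0.
  have cq : continuous (re_quotient s : R -> R).
    have -> : re_quotient s = (fun x => (r (x + s) - r x) ^+ 2 * (r x * r (x + s))^-1).
      by apply/funext => y; exact: E.
    have crs := @continuous_shiftR _ r s cr.
    apply: contM; first by apply: contX; exact: contB.
    by apply: contV; [exact: contM|move=> y; rewrite mulf_neq0].
  have q0 y : 0 <= re_quotient s y by rewrite E// divr_ge0 ?sqr_ge0// mulr_ge0// ltW.
  have := integ_eq0_continuous cq sQ q0 (Q0 s s0) x; rewrite E//.
  have nz : r x * r (x + s) != 0 by rewrite mulf_neq0.
  by move/eqP; rewrite mulf_eq0 invr_eq0 (negbTE nz) orbF sqrf_eq0 subr_eq0 => /eqP.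
have rc x y : r x = r y.
  case: (ltgtP x y) => [xy|yx|->//].
    by have := eq_r x (y - x); rewrite subr_gt0 subrKC => /(_ xy).
  by have := eq_r y (x - y); rewrite subr_gt0 subrKC => /(_ yx).
move=> x; have Lc : square_summable (fun _ : R => r x - 1).
  have -> : (fun _ : R => r x - 1) = (fun y => r y - 1) by apply/funext => y; rewrite (rc y x).
  exact: Lr.
by apply/eqP; rewrite -subr_eq0 (square_summable_cst Lc).
Qed.

End TopLine.
(** * Difference quotients of the extension *)

Section DifferenceQuotient.
Variable R : realType.
Local Notation mu := (@lebesgue_measure R).
Local Notation Re := complex.Re.
Local Notation Im := complex.Im.
Implicit Types (x y s t e b : R) (f : R[i] -> R[i]) (z w : R[i]).

(** Translates between estimates with real radii and complex limits, so that continuity of products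
    and quotients on the closed strip comes from the algebra of limits. *)
Lemma closed_strip_cvgP h f z :
  (forall e, 0 < e -> exists2 eta, 0 < eta & forall w, closed_strip h w ->
    Normc.normc (z - w) < eta -> Normc.normc (f z - f w) < e) <->
  ((f : R[i]^o -> R[i]^o) @ within (closed_strip h) (nbhs (z : R[i]^o)) --> (f z : R[i]^o)).
Proof.
have real_pos (e : R[i]) : 0 < e -> exists2 e', 0 < e' & e = e'%:C.
  case: e => a b; rewrite ltcE/= => /andP[/eqP -> a0]; by exists a.
split=> H.
  apply/cvgrPdist_lt => _ /real_pos[e e0 ->]; have [eta eta0 He] := H e e0.
  rewrite near_withinE; exists eta%:C; first by rewrite /= ltcR.
  by move=> w; rewrite /ball/= ltc_normP => zw hw; rewrite ltc_normP; exact: He.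
move=> e e0; move/cvgrPdist_lt : H => /(_ e%:C); rewrite ltcR => /(_ e0).
rewrite near_withinE => -[/= _ /real_pos[eta eta0 ->] H]; exists eta => // w hw zw.
by rewrite -ltc_normP; apply: H => //; rewrite /ball/= ltc_normP.
Qed.

Section ComplexLimits.
Variables (T : Type) (G : set_system T).
Hypothesis FG : Filter G.
Implicit Types (u v : T -> R[i]) (c d : R[i]).

Lemma ccvgM u v c d : u @ G --> (c : R[i]^o) -> v @ G --> (d : R[i]^o) ->
  (fun t : T => u t * v t) @ G --> (c * d : R[i]^o).
Proof. exact: (@cvgM (R[i] : numFieldType) T G FG u v c d). Qed.

Lemma ccvgV u c : c != 0 -> u @ G --> (c : R[i]^o) ->
  (fun t : T => (u t)^-1) @ G --> (c^-1 : R[i]^o).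
Proof. exact: (@cvgV (R[i] : numFieldType) T G FG u c). Qed.

Lemma ccvgD u v c d : u @ G --> (c : R[i]^o) -> v @ G --> (d : R[i]^o) ->
  (fun t : T => u t + v t) @ G --> (c + d : R[i]^o).
Proof. exact: (@cvgD (R[i] : numFieldType) (R[i]^o) T G FG u v c d). Qed.

Lemma ccvgB u v c d : u @ G --> (c : R[i]^o) -> v @ G --> (d : R[i]^o) ->
  (fun t : T => u t - v t) @ G --> (c - d : R[i]^o).
Proof. exact: (@cvgB (R[i] : numFieldType) (R[i]^o) T G FG u v c d). Qed.

End ComplexLimits.

Lemma normc_dist_le (u v : R[i]) : `|Normc.normc u - Normc.normc v| <= Normc.normc (u - v).
Proof.
have H (a b : R[i]) : Normc.normc a - Normc.normc b <= Normc.normc (a - b).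
  by rewrite lerBlDr; apply: le_trans (le_normcD _ _); rewrite subrK.
rewrite ler_norml; apply/andP; split; last exact: H.
by rewrite lerNl opprB; apply: le_trans (H v u) _; rewrite -normcN opprB.
Qed.

(** Meant for the bottom, where [F] is real without zeros: the numerator of [Q] is a square, so the
    sign of [Q] is that of the product of two values of [F]. *)
Lemma same_sign (f : R -> R) : continuous (f : R -> R) -> (forall x, f x != 0) ->
  forall x y, 0 < f x * f y.
Proof.
move=> cf f0.
have H x y : x <= y -> 0 < f x * f y.
  move=> xy; rewrite ltNge; apply/negP => fxy.
  have [||c _ fc] := @IVT _ f x y 0 xy.
  - exact: continuous_subspaceT.
  - case: (ltgtP (f x) 0) (f0 x) => // fx _.
      have fy : 0 <= f y by rewrite -(nmulr_rle0 _ fx).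
      by rewrite /Num.min /Num.max (lt_le_trans fx fy) (ltW fx) fy.
    have fy : f y <= 0 by rewrite -(pmulr_rle0 _ fx).
    have nfy : (f x < f y) = false by apply/negbTE; rewrite -leNgt (le_trans fy (ltW fx)).
    by rewrite /Num.min /Num.max nfy fy (ltW fx).
  by move: (f0 c); rewrite fc eqxx.
move=> x y; case: (leP x y) => [/H//|/ltW/H]; by rewrite mulrC.
Qed.

Section Quotient.
Variables (h m K C : R) (F : R[i] -> R[i]).
Hypotheses (h0 : 0 < h) (m0 : 0 < m) (C0 : 0 <= C).
Hypothesis holF : forall z, strip h z -> derivable (F : R[i]^o -> R[i]^o) z 1.
Hypothesis contF : forall z, closed_strip h z -> forall e, 0 < e ->
  exists2 eta, 0 < eta & forall w, closed_strip h w ->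
    Normc.normc (z - w) < eta -> Normc.normc (F z - F w) < e.
Hypothesis lowF : forall z, closed_strip h z -> m <= Normc.normc (F z).
Hypothesis upF : forall z, closed_strip h z -> Normc.normc (F z) <= K.
Hypothesis decayF : forall e, 0 < e ->
  exists M, forall x b, - h <= b <= 0 -> M <= `|x| -> Normc.normc (F (x +i* b) - 1) <= e.
Hypothesis realF : forall x, Im (F (x +i* - h)) = 0.
Hypothesis topL2 : square_summable (fun x => Re (F (x +i* 0)) - 1) /\
  square_summable (fun x => Im (F (x +i* 0))).
Hypothesis botL2 : forall s,
  square_summable (fun x => Re (F ((x + s) +i* - h)) - Re (F (x +i* - h))) /\
  integ (fun x => (Re (F ((x + s) +i* - h)) - Re (F (x +i* - h))) ^+ 2) <= C * s ^+ 2.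

(** The squared increment divided by the two values of [F], expanded; [difference_quotientE] returns
    to the square. The expanded form shows the polar components on the top, the square shows size
    and sign. *)
Definition difference_quotient s z : R[i] := F (z + s%:C) / F z + F z / F (z + s%:C) - 2.

Local Notation Q := difference_quotient.

Lemma closed_strip_shift z s : closed_strip h z -> closed_strip h (z + s%:C).
Proof. by case: z => x b; rewrite /closed_strip/= addr0. Qed.

Lemma F_neq0 z : closed_strip h z -> F z != 0.
Proof.
move=> /lowF H; apply/negP => /eqP F0; move: H; rewrite F0 Normc.normc0; have := m0; lra.
Qed.

Let hb0 : - h <= 0 <= (0 : R). Proof. by rewrite lexx andbT oppr_le0 ltW. Qed.
Let hbh : - h <= - h <= (0 : R). Proof. by rewrite lexx oppr_le0 ltW. Qed.

Let shiftE x b s : (x +i* b) + s%:C = (x + s) +i* b.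
Proof. by apply/eqP; rewrite eq_complex/= addr0 !eqxx. Qed.

Lemma difference_quotientE s z : closed_strip h z ->
  Q s z = (F (z + s%:C) - F z) ^+ 2 / (F z * F (z + s%:C)).
Proof.
move=> hz; have := F_neq0 hz; have := F_neq0 (closed_strip_shift s hz).
by rewrite /Q; move: (F _) (F _) => a b a0 b0; field; rewrite a0 b0.
Qed.

Lemma normc_difference_quotient s z : closed_strip h z ->
  Normc.normc (Q s z) <= Normc.normc (F (z + s%:C) - F z) ^+ 2 / m ^+ 2.
Proof.
move=> hz; have l1 := lowF hz; have l2 := lowF (closed_strip_shift s hz).
rewrite difference_quotientE// expr2 Normc.normcM Normc.normcV !Normc.normcM -expr2.
rewrite ler_wpM2l ?sqr_ge0// lef_pV2 ?posrE ?exprn_gt0// ?mulr_gt0//; last 2 first.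
- exact: lt_le_trans m0 l1.
- exact: lt_le_trans m0 l2.
by rewrite expr2; apply: ler_pM => //; exact: ltW.
Qed.

Let K0 : 0 <= K.
Proof. by apply: le_trans (upF (z := 0 +i* 0) hb0); exact: normc_ge0. Qed.

Lemma difference_quotient_bounded s z : closed_strip h z ->
  Normc.normc (Q s z) <= (K + K) ^+ 2 / m ^+ 2.
Proof.
move=> hz; apply: (le_trans (normc_difference_quotient s hz)).
rewrite ler_wpM2r// ?invr_ge0 ?sqr_ge0// lerXn2r ?nnegrE ?normc_ge0// ?addr_ge0//.
apply: (le_trans (le_normcD _ _)); rewrite normcN.
by apply: lerD; apply: upF => //; exact: closed_strip_shift.
Qed.

Lemma difference_quotient_decay s e : 0 < e ->
  exists M, forall x b, - h <= b <= 0 -> M <= `|x| -> Normc.normc (Q s (x +i* b)) <= e.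
Proof.
(* With [F] within [d] of 1 at both points the increment is at most [2 * d], and
   [4 * d ^+ 2 <= 4 * d <= e * m ^+ 2] because [d <= 1]. *)
move=> e0; pose d := Num.min 1 (e * m ^+ 2 / 4).
have d0 : 0 < d by rewrite lt_min ltr01 divr_gt0// mulr_gt0// exprn_gt0.
have [M HM] := decayF d0; exists (M + `|s|) => x b hb xM.
have hz : closed_strip h (x +i* b) by exact: hb.
apply: (le_trans (normc_difference_quotient s hz)).
rewrite ler_pdivrMr ?exprn_gt0// shiftE.
have h1 : Normc.normc (F (x +i* b) - 1) <= d.
  by apply: HM => //; apply: le_trans xM; rewrite lerDl.
have h2 : Normc.normc (F ((x + s) +i* b) - 1) <= d.
  apply: HM => //; have := ler_normB (x + s) s; rewrite addrK; lra.
have h3 : Normc.normc (F ((x + s) +i* b) - F (x +i* b)) <= d + d.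
  have -> : F ((x + s) +i* b) - F (x +i* b) = (F ((x + s) +i* b) - 1) - (F (x +i* b) - 1) by ring.
  apply: (le_trans (le_normcD _ _)); rewrite normcN; exact: lerD.
have dd : d ^+ 2 <= d by rewrite expr2 ler_piMr ?(ltW d0)// ge_min lexx.
have de : d <= e * m ^+ 2 / 4 by rewrite ge_min lexx orbT.
apply: (@le_trans _ _ ((d + d) ^+ 2)).
  by rewrite lerXn2r ?nnegrE ?normc_ge0// addr_ge0// ltW.
have -> : (d + d) ^+ 2 = 4 * d ^+ 2 by ring.
lra.
Qed.

Lemma difference_quotient_derivable s z : strip h z ->
  derivable (Q s : R[i]^o -> R[i]^o) z 1.
Proof.
move=> hz; have hs : strip h (z + s%:C) by case: z hz => x b; rewrite /strip/= addr0.
have cl w : strip h w -> closed_strip h w.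
  by rewrite /strip /closed_strip/= => /andP[/ltW -> /ltW ->].
have dF := holF hz.
have dFs : derivable ((fun z => F (z + s%:C)) : R[i]^o -> R[i]^o) z 1.
  have [d Hd] := derivable_expansion (holF hs).
  by apply: (@expansion_derivable _ _ _ d) => e /Hd[eta eta0 H]; exists eta => // w /H; rewrite addrA.
have n0 := F_neq0 (cl _ hz); have n1 := F_neq0 (cl _ hs).
have v0 := @cderivableV _ F z n0 dF.
have v1 := @cderivableV _ (fun z => F (z + s%:C)) z n1 dFs.
exact: (cderivableB (cderivableD (cderivableM dFs v0) (cderivableM dF v1)) (@cderivable_cst _ 2 z)).
Qed.

Lemma difference_quotient_continuous s z : closed_strip h z -> forall e, 0 < e ->
  exists2 eta, 0 < eta & forall w, closed_strip h w ->
    Normc.normc (z - w) < eta -> Normc.normc (Q s z - Q s w) < e.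
Proof.
move=> hz; apply/closed_strip_cvgP; have hs := closed_strip_shift s hz.
have cF := (closed_strip_cvgP h F z).1 (contF hz).
have cFs : (fun z => F (z + s%:C) : R[i]^o) @ within (closed_strip h) (nbhs (z : R[i]^o)) -->
    (F (z + s%:C) : R[i]^o).
  apply/(closed_strip_cvgP h (fun z => F (z + s%:C)) z) => e /(contF hs)[eta eta0 H]; exists eta => // w hw zw.
  by apply: H; [exact: closed_strip_shift|rewrite opprD addrACA subrr addr0].
have n0 := F_neq0 hz; have n1 := F_neq0 hs.
have FG : Filter (within (closed_strip h) (nbhs (z : R[i]^o))) by exact: within_filter.
have c1 := ccvgM FG cFs (ccvgV FG n0 cF); have c2 := ccvgM FG cF (ccvgV FG n1 cFs).
have c3 : (fun _ : R[i]^o => 2 : R[i]^o) @ within (closed_strip h) (nbhs (z : R[i]^o)) -->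
    (2 : R[i]^o) by exact: cvg_cst.
exact: (ccvgB FG (ccvgD FG c1 c2) c3).
Qed.

Let cQRe s b : - h <= b <= 0 -> continuous (fun x => Re (Q s (x +i* b)) : R).
Proof. by move=> hb; apply: (holomorphic_cont_Re (@difference_quotient_continuous s)). Qed.

Let cQIm s b : - h <= b <= 0 -> continuous (fun x => Im (Q s (x +i* b)) : R).
Proof. by move=> hb; apply: (holomorphic_cont_Im (@difference_quotient_continuous s)). Qed.

Let cFRe b : - h <= b <= 0 -> continuous (fun x => Re (F (x +i* b)) : R).
Proof. by move=> hb; exact: (holomorphic_cont_Re contF). Qed.

Let cFIm b : - h <= b <= 0 -> continuous (fun x => Im (F (x +i* b)) : R).
Proof. by move=> hb; exact: (holomorphic_cont_Im contF). Qed.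

Lemma top_difference_L2 s :
  square_summable (fun x => Re (F ((x + s) +i* 0)) - Re (F (x +i* 0))) /\
  square_summable (fun x => Im (F ((x + s) +i* 0)) - Im (F (x +i* 0))).
Proof.
have [Lr Li] := topL2; split; last first.
  by apply: square_summableB => //; apply: (square_summable_shift s _ Li); exact: cFIm.
have cr : continuous (fun x => Re (F (x +i* 0)) - 1 : R).
  by apply: contB; [exact: cFRe|exact: contcst].
have := square_summableB (square_summable_shift s cr Lr) Lr.
by congr square_summable; apply/funext => x; ring.
Qed.

Let normQ_top s : summable1 (fun x => Normc.normc (F ((x + s) +i* 0) - F (x +i* 0)) ^+ 2 / m ^+ 2).
Proof.
have [[_ h1] [_ h2]] := top_difference_L2 s.
apply: eq_summable1 (summable1Z (m ^+ 2)^-1 (summable1D h1 h2)) => x.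
by rewrite normc_sqr mulrC !raddfB.
Qed.

Lemma difference_quotient_top_summable s :
  summable1 (fun x => Re (Q s (x +i* 0))) /\ summable1 (fun x => Im (Q s (x +i* 0))).
Proof.
have le x : Normc.normc (Q s (x +i* 0)) <= Normc.normc (F ((x + s) +i* 0) - F (x +i* 0)) ^+ 2 / m ^+ 2.
  by rewrite -shiftE; exact: normc_difference_quotient.
split; apply: summable1_le (normQ_top s) _.
- by apply: measurable_contR; exact: cQRe.
- by move=> x; apply: le_trans (normc_ge_Re _) (le x).
- by apply: measurable_contR; exact: cQIm.
- by move=> x; apply: le_trans (normc_ge_Im _) (le x).
Qed.

Lemma difference_quotient_bottom s x :
  [/\ Im (Q s (x +i* - h)) = 0, 0 <= Re (Q s (x +i* - h)),
   Re (Q s (x +i* - h)) <= (Re (F ((x + s) +i* - h)) - Re (F (x +i* - h))) ^+ 2 / m ^+ 2 &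
   Re (Q s (x +i* - h)) = 0 -> F ((x + s) +i* - h) = F (x +i* - h)].
Proof.
have re y : F (y +i* - h) = (Re (F (y +i* - h)))%:C.
  by apply/eqP; rewrite eq_complex/= realF !eqxx.
have n0 y : Re (F (y +i* - h)) != 0.
  have := @F_neq0 (y +i* - h) hbh; rewrite re; apply: contra => /eqP /= ->; exact: eqxx.
have sg := same_sign (cFRe hbh) n0 (x + s) x.
have lw y : m <= `|Re (F (y +i* - h))|.
  by have := @lowF (y +i* - h) hbh; rewrite re /= expr0n/= addr0 sqrtr_sqr.
have E : Q s (x +i* - h) = ((Re (F ((x + s) +i* - h)) - Re (F (x +i* - h))) ^+ 2 /
    (Re (F ((x + s) +i* - h)) * Re (F (x +i* - h))))%:C.
  rewrite difference_quotientE// shiftE; move: (re (x + s)) (re x).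
  move: (F _) (F _) => [a a'] [b b'] [->] [->] /=.
  change (((b%:C - a%:C) ^+ 2 / (a%:C * b%:C)) = ((b - a) ^+ 2 / (b * a))%:C).
  by rewrite fmorph_div rmorphXn rmorphB rmorphM /= [a%:C * _]mulrC.
have lw2 : m ^+ 2 <= Re (F ((x + s) +i* - h)) * Re (F (x +i* - h)).
  by rewrite -(gtr0_norm sg) normrM expr2; apply: ler_pM => //; exact: ltW.
rewrite E /=; split=> //.
- by rewrite divr_ge0 ?sqr_ge0// ltW.
- by rewrite ler_wpM2l ?sqr_ge0// lef_pV2// posrE// exprn_gt0.
move/eqP; rewrite mulf_eq0 invr_eq0 (gt_eqF sg) orbF sqrf_eq0 subr_eq0 => /eqP H.
by rewrite re H -re.
Qed.

Lemma difference_quotient_bottom_summable s :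
  summable1 (fun x => Re (Q s (x +i* - h))) /\
  integ (fun x => Re (Q s (x +i* - h))) <= C / m ^+ 2 * s ^+ 2.
Proof.
have [[_ b1] b2] := botL2 s.
have sb := summable1Z (m ^+ 2)^-1 b1.
have sQ : summable1 (fun x => Re (Q s (x +i* - h))).
  apply: summable1_le sb _; first by apply: measurable_contR; exact: cQRe.
  by move=> x; have [_ q0 q1 _] := difference_quotient_bottom s x; rewrite ger0_norm// mulrC.
split=> //.
apply: (@le_trans _ _ ((m ^+ 2)^-1 * (C * s ^+ 2))); last by rewrite le_eqVlt; apply/orP; left; apply/eqP; ring.
apply: (@le_trans _ _ ((m ^+ 2)^-1 * integ (fun x => (Re (F ((x + s) +i* - h)) - Re (F (x +i* - h))) ^+ 2))).
  rewrite -integZ//; apply: integ_le => // x.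
  by have [_ _ q1 _] := difference_quotient_bottom s x; rewrite mulrC.
by rewrite ler_wpM2l// invr_ge0 sqr_ge0.
Qed.

Lemma cauchy_difference_quotient s :
  integ (fun x => Re (Q s (x +i* 0))) = integ (fun x => Re (Q s (x +i* - h))).
Proof.
have [tr _] := difference_quotient_top_summable s; have [br _] := difference_quotient_bottom_summable s.
apply: (cauchy_strip_Re h0 _ _ _ _ tr br).
- exact: difference_quotient_derivable.
- exact: difference_quotient_continuous.
- exact: difference_quotient_bounded.
- exact: difference_quotient_decay.
Qed.

(** The imaginary part of [weight * Q] reduces to a single product on each boundary: the weight is
    real on the top and [Q] is real on the bottom. *)
Lemma cauchy_weighted_difference_quotient s :
  integ (fun x => Re (weight h (x +i* 0)) * Im (Q s (x +i* 0))) =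
  integ (fun x => Im (weight h (x +i* - h)) * Re (Q s (x +i* - h))) /\
  summable1 (fun x => Re (weight h (x +i* 0)) * Im (Q s (x +i* 0))) /\
  summable1 (fun x => Im (weight h (x +i* - h)) * Re (Q s (x +i* - h))).
Proof.
have [_ ti] := difference_quotient_top_summable s; have [br _] := difference_quotient_bottom_summable s.
have contW z (hz : closed_strip h z) : forall e, 0 < e -> exists2 eta, 0 < eta &
   forall w, closed_strip h w -> Normc.normc (z - w) < eta -> Normc.normc (weight h z - weight h w) < e.
  by move=> e /(derivable_eps (weight_derivable h0 hz))[eta eta0 H]; exists eta => // w _; exact: H.
have cw b : - h <= b <= 0 -> continuous (fun x => Re (weight h (x +i* b)) : R) /\
   continuous (fun x => Im (weight h (x +i* b)) : R).
  by move=> hb; split; [exact: (holomorphic_cont_Re contW)|exact: (holomorphic_cont_Im contW)].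
have st : summable1 (fun x => Re (weight h (x +i* 0)) * Im (Q s (x +i* 0))).
  apply: eq_summable1 (@summable1M _ _ (fun x => Re (weight h (x +i* 0))) 1 _ _ ti) => [x||x].
  - by rewrite mulrC.
  - by apply: measurable_contR; have [] := cw 0 hb0.
  - by apply: le_trans (normc_ge_Re _) (weight_le1 h0 (z := x +i* 0) hb0).
have sb : summable1 (fun x => Im (weight h (x +i* - h)) * Re (Q s (x +i* - h))).
  apply: eq_summable1 (@summable1M _ _ (fun x => Im (weight h (x +i* - h))) 1 _ _ br) => [x||x].
  - by rewrite mulrC.
  - by apply: measurable_contR; have [] := cw (- h) hbh.
  - by apply: le_trans (normc_ge_Im _) (weight_le1 h0 (z := x +i* - h) hbh).
split=> //.
have Et x : Im (weight h (x +i* 0) * Q s (x +i* 0)) = Re (weight h (x +i* 0)) * Im (Q s (x +i* 0)).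
  by rewrite weight_top//; case: (Q _ _) => u v /=; rewrite mul0r addr0.
have Eb x : Im (weight h (x +i* - h) * Q s (x +i* - h)) = Im (weight h (x +i* - h)) * Re (Q s (x +i* - h)).
  have [q0 _ _ _] := difference_quotient_bottom s x; move: q0.
  by case: (Q _ _) => u v /= ->; case: (weight h (x +i* - h)) => a b /=; rewrite mulr0 add0r.
rewrite -(eq_integ Et) -(eq_integ Eb).
apply: (@cauchy_strip_Im _ h (fun z => weight h z * Q s z) ((K + K) ^+ 2 / m ^+ 2) h0).
- move=> z hz; have hz' : closed_strip h z by move: hz; rewrite /strip /closed_strip/= => /andP[/ltW -> /ltW ->].
  have dW := weight_derivable h0 hz'; have dQ := @difference_quotient_derivable s z hz.
  exact: (cderivableM dW dQ).
- move=> z hz; apply/(closed_strip_cvgP h (fun z => weight h z * Q s z) z).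
  have c1 := (closed_strip_cvgP h (weight h) z).1 (contW z hz).
  have c2 := (closed_strip_cvgP h (Q s) z).1 (@difference_quotient_continuous s z hz).
  by apply: (ccvgM _ c1 c2); exact: within_filter.
- move=> z hz; rewrite Normc.normcM -[leRHS]mul1r; apply: ler_pM; rewrite ?normc_ge0//.
    exact: weight_le1.
  exact: difference_quotient_bounded.
- move=> e e0; have [M HM] := difference_quotient_decay s e0; exists M => x b hb xM.
  rewrite Normc.normcM -[leRHS]mul1r; apply: ler_pM; rewrite ?normc_ge0//.
    exact: (weight_le1 h0 (z := x +i* b) hb).
  exact: HM.
- by rewrite (eq_summable1 (fun x => esym (Et x))).
- by rewrite (eq_summable1 (fun x => esym (Eb x))).
Qed.

Section Rigidity.
Variable k : R.

Let r x : R := Normc.normc (F (x +i* 0)).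
Let T1 x : R := Re (F (x +i* 0)) / r x.
Let T2 x : R := Im (F (x +i* 0)) / r x.

Hypothesis k0 : 0 <= k.
Hypothesis dT1 : forall x, is_derive x 1 T1 (k * pressure r x * T2 x).
Hypothesis dT2 : forall x, is_derive x 1 T2 (- (k * pressure r x * T1 x)).

Let rm x : m <= r x. Proof. exact: (lowF (z := x +i* 0) hb0). Qed.
Let rK x : r x <= K. Proof. exact: (upF (z := x +i* 0) hb0). Qed.
Let rn x : r x != 0. Proof. by rewrite gt_eqF// (lt_le_trans m0 (rm x)). Qed.

Let cr : continuous (r : R -> R).
Proof.
have -> : r = (fun x => Num.sqrt (Re (F (x +i* 0)) ^+ 2 + Im (F (x +i* 0)) ^+ 2)).
  by apply/funext => x; rewrite /r /Normc.normc; case: (F _).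
apply: contcomp; last exact: sqrt_continuous.
by apply: contD; apply: contX; [exact: cFRe|exact: cFIm].
Qed.

Let rE x : Re (F (x +i* 0)) ^+ 2 + Im (F (x +i* 0)) ^+ 2 = r x ^+ 2.
Proof. by rewrite /r normc_sqr. Qed.

Let T1E x : T1 x ^+ 2 + T2 x ^+ 2 = 1.
Proof. by rewrite /T1 /T2 !expr_div_n -mulrDl rE divff// expf_neq0. Qed.

Let FE x : F (x +i* 0) = (r x * T1 x) +i* (r x * T2 x).
Proof.
rewrite /T1 /T2 ![_ * (_ / _)]mulrC !mulfVK//.
by case: (F _).
Qed.

Let Lr : square_summable (fun x => r x - 1).
Proof.
have [La Lb] := topL2.
have L := square_summableD (square_summable_norm La) (square_summable_norm Lb).
apply: square_summable_le L _.
  by apply: measurable_contR; apply: contB => //; exact: contcst.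
move=> x; rewrite [leRHS]ger0_norm ?addr_ge0//.
have := normc_dist_le (F (x +i* 0)) 1; rewrite Normc.normc1 => /le_trans; apply.
apply: (le_trans (normc_le_l1 _)).
by case: (F _) => u v /=; rewrite subr0.
Qed.

Let quotient_top s x : Re (Q s (x +i* 0)) = re_quotient r T1 T2 s x /\
  Im (Q s (x +i* 0)) = im_quotient r T1 T2 s x.
Proof.
rewrite /difference_quotient shiftE !FE /re_quotient /im_quotient.
have := T1E x; have := T1E (x + s); have := rn x; have := rn (x + s).
move: (r x) (r (x + s)) (T1 x) (T1 (x + s)) (T2 x) (T2 (x + s)) => p q u u' v v' q0 p0 E' E.
have N (t c d : R) : c ^+ 2 + d ^+ 2 = 1 -> (t * c) ^+ 2 + (t * d) ^+ 2 = t ^+ 2.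
  by move=> H; rewrite !exprMn -mulrDr H mulr1.
by rewrite /= !N//; split; field; rewrite p0 q0.
Qed.

Let Q1 s : summable1 (re_quotient r T1 T2 s) /\
  integ (re_quotient r T1 T2 s) = integ (fun x => Re (Q s (x +i* - h))).
Proof.
have -> : re_quotient r T1 T2 s = (fun x => Re (Q s (x +i* 0))).
  by apply/funext => x; case: (quotient_top s x).
by split; [have [] := difference_quotient_top_summable s|exact: cauchy_difference_quotient].
Qed.

Let Q1' s : 0 < s -> summable1 (re_quotient r T1 T2 s) /\
  integ (re_quotient r T1 T2 s) <= C / m ^+ 2 * s ^+ 2.
Proof.
by have [s1 ->] := Q1 s; split=> //; have [] := difference_quotient_bottom_summable s.
Qed.

Let Q2 s : [/\ summable1 (fun x => Re (weight h (x +i* 0)) * im_quotient r T1 T2 s x),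
  summable1 (fun x => Im (weight h (x +i* - h)) * Re (Q s (x +i* - h))) &
  integ (fun x => Re (weight h (x +i* 0)) * im_quotient r T1 T2 s x) =
  integ (fun x => Im (weight h (x +i* - h)) * Re (Q s (x +i* - h)))].
Proof.
have -> : im_quotient r T1 T2 s = (fun x => Im (Q s (x +i* 0))).
  by apply/funext => x; case: (quotient_top s x).
by have [? [? ?]] := cauchy_weighted_difference_quotient s.
Qed.

Let cW b : - h <= b <= 0 -> continuous (fun x => Re (weight h (x +i* b)) : R) /\
   continuous (fun x => Im (weight h (x +i* b)) : R).
Proof.
have contW z (hz : closed_strip h z) : forall e, 0 < e -> exists2 eta, 0 < eta &
   forall w, closed_strip h w -> Normc.normc (z - w) < eta -> Normc.normc (weight h z - weight h w) < e.
  by move=> e /(derivable_eps (weight_derivable h0 hz))[eta eta0 H]; exists eta => // w _; exact: H.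
by move=> hb; split; [exact: (holomorphic_cont_Re contW)|exact: (holomorphic_cont_Im contW)].
Qed.

Let bottom_le0 s x : Im (weight h (x +i* - h)) * Re (Q s (x +i* - h)) <= 0.
Proof.
have [_ q0 _ _] := difference_quotient_bottom s x.
by rewrite mulr_le0_ge0// ltW// weight_bottom.
Qed.

(** [weighted_rigidity] divides by [k], so [k = 0] is treated apart; there the strict negativity of
    the imaginary part of the weight on the bottom lets [Q] be recovered from the weighted
    product. *)
Let modulus_one x : r x = 1.
Proof.
have Cm : 0 <= C / m ^+ 2 by rewrite divr_ge0// sqr_ge0.
move: (k0); rewrite le_eqVlt => /predU1P[kE|k_gt0]; last first.
  apply: (weighted_rigidity k0 m0 Cm rm rK cr T1E dT1 dT2 Lr Q1'
    (phi := fun x => Re (weight h (x +i* 0))) (slope := weight_slope h)) => //.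
  - by have [] := cW hb0.
  - by move=> y; apply: le_trans (normc_ge_Re _) (weight_le1 h0 (z := y +i* 0) hb0).
  - exact: cont_weight_slope.
  - by move=> y; exact: weight_slope_gt0.
  - by move=> s y; exact: weight_slope_le.
  move=> s _; have [s1 s2 ->] := Q2 s; split=> //.
  by rewrite -(integ0 R); apply: integ_le => //; exact: summable1_cst0.
apply: (unweighted_rigidity k0 m0 rm cr T1E dT1 dT2 Lr Q1') => // s s0.
have [_ s2 E] := Q2 s; have [_ ->] := Q1 s.
have im0 y : im_quotient r T1 T2 s y = 0.
  have [] := phase_difference_le k0 m0 rm cr T1E dT1 dT2 y s0.
  rewrite -kE mul0r !normr_le0 !subr_eq0 => /eqP e1 /eqP e2.
  by rewrite /im_quotient e1 e2; ring.
have z : integ (fun y => Im (weight h (y +i* - h)) * Re (Q s (y +i* - h))) = 0.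
  by rewrite -E -[RHS](integ0 R); apply: eq_integ => y; rewrite im0 mulr0.
have q0 y : Re (Q s (y +i* - h)) = 0.
  have := @integ_eq0_continuous _ (fun y => - (Im (weight h (y +i* - h)) * Re (Q s (y +i* - h)))) _
    (summable1N s2) _ _ y.
  have cc : continuous (fun y => - (Im (weight h (y +i* - h)) * Re (Q s (y +i* - h))) : R).
    by apply: contN; apply: contM; [have [] := cW hbh|exact: cQRe].
  move=> /(_ cc) H; have : - (Im (weight h (y +i* - h)) * Re (Q s (y +i* - h))) = 0.
    by apply: H => [t|]; [rewrite oppr_ge0|rewrite integN// z oppr0].
  move/eqP; rewrite oppr_eq0 mulf_eq0 lt_eqF ?weight_bottom//= => /eqP; exact.
by rewrite -(integ0 R) (eq_integ q0).
Qed.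

(** Modulus 1 makes the pressure vanish, so the phase is constant, and square summability of [F - 1]
    fixes its value. *)
Lemma strip_rigidity x : F (x +i* 0) = 1.
Proof.
have p0 y : pressure r y = 0 by rewrite /pressure modulus_one invr1 subrr.
have const (f : R -> R) (c : R) : (forall y, is_derive y 1 f 0) ->
    square_summable (fun y => f y - c) -> f x = c.
  move=> fd Lf; have E : (fun y => f y - c) = (fun _ : R => f x - c).
    by apply/funext => y; rewrite (is_derive_0_is_cst y x fd).
  by apply/eqP; rewrite -subr_eq0; apply/eqP/square_summable_cst; rewrite -E.
have [La Lb] := topL2.
have Re1 y : Re (F (y +i* 0)) = T1 y by rewrite /T1 modulus_one divr1.
have Im1 y : Im (F (y +i* 0)) = T2 y by rewrite /T2 modulus_one divr1.
have t1 : T1 x = 1.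
  apply: const => [y|]; first by have := dT1 y; rewrite p0 mulr0 mul0r.
  by move: La; congr square_summable; apply/funext => y; rewrite Re1.
have t2 : T2 x = 0.
  apply: const => [y|]; first by have := dT2 y; rewrite p0 mulr0 mul0r oppr0.
  by move: Lb; congr square_summable; apply/funext => y; rewrite Im1 subr0.
by apply/eqP; rewrite eq_complex/= Re1 Im1 t1 t2 !eqxx.
Qed.

End Rigidity.

End Quotient.

End DifferenceQuotient.
(** * The solitary wave *)

Section SolitaryWave.
Variable R : realType.
Local Notation mu := (@lebesgue_measure R).
Local Notation Re := complex.Re.
Local Notation Im := complex.Im.
Implicit Types (x y b e h : R) (W : R -> R[i]) (F : R[i] -> R[i]).

(** Decay keeps [|F|] above [1 / 2] outside a compact rectangle, and inside it the modulus attains a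
    minimum, which is not zero. The estimates of [Q] use such a bound on the whole closed strip. *)
Lemma strip_lower_bound h F : 0 < h ->
  (forall z, closed_strip h z -> forall e, 0 < e ->
    exists2 eta, 0 < eta & forall w, closed_strip h w ->
      Normc.normc (z - w) < eta -> Normc.normc (F z - F w) < e) ->
  (forall e, 0 < e -> exists M, forall x b, - h <= b <= 0 -> M <= `|x| ->
    Normc.normc (F (x +i* b) - 1) <= e) ->
  (forall z, closed_strip h z -> F z <> 0) ->
  exists2 m, 0 < m & forall z, closed_strip h z -> m <= Normc.normc (F z).
Proof.
move=> h0 contF decayF F0.
have half0 : 0 < 2^-1 :> R by rewrite invr_gt0.
have [M HM] := decayF _ half0.
have far x b : - h <= b <= 0 -> M <= `|x| -> 2^-1 <= Normc.normc (F (x +i* b)).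
  move=> hb xM; have := le_trans (normc_dist_le (F (x +i* b)) 1) (HM x b hb xM).
  by rewrite Normc.normc1 ler_norml => /andP[+ _]; lra.
pose A : set (R * R) := `[- `|M|, `|M|]%classic `*` `[- h, 0]%classic.
pose f (p : R * R) : R := Normc.normc (F (p.1 +i* p.2)).
have A0 : A !=set0.
  exists (0, 0); split; rewrite /= in_itv/=; first by rewrite oppr_le0 normr_ge0.
  by rewrite lexx andbT oppr_le0 ltW.
have cA : compact A by apply: compact_setX; exact: segment_compact.
have cf : {within A, continuous f}.
  apply/subspace_continuousP => -[x b] [/= _]; rewrite in_itv/= => hb.
  apply/cvgrPdist_lt => e e0; have [eta eta0 H] := contF (x +i* b) hb e e0.
  have e2 : 0 < eta / 2 by rewrite divr_gt0.
  rewrite near_withinE; exists (ball x (eta / 2), ball b (eta / 2)) => /=.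
    by split; exact: nbhsx_ballx.
  move=> [y c] /= [xy bc] [_]; rewrite /= in_itv/= => hc.
  apply: (le_lt_trans (normc_dist_le _ _)); apply: H => //.
  apply: (le_lt_trans (normc_le_l1 _)) => /=.
  by rewrite [eta]splitr; apply: ltrD.
have [[x0 b0] + Hmin] := compact_EVT_min A0 cA cf.
rewrite inE => -[/= _]; rewrite in_itv/= => hb0.
have f0 : 0 < f (x0, b0).
  rewrite /f /= lt_def normc_ge0 andbT; apply/negP => /eqP/Normc.eq0_normc.
  exact: (F0 (x0 +i* b0) hb0).
exists (Num.min 2^-1 (f (x0, b0))); first by rewrite lt_min half0.
move=> [x b] hb; rewrite ge_min; case: (leP `|M| `|x|) => xM.
  by rewrite (far x b hb)// (le_trans (ler_norm _) xM).
apply/orP; right; apply: (Hmin (x, b)); rewrite inE; split => /=; rewrite in_itv//=.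
by rewrite -ler_norml ltW.
Qed.

Lemma summable1_compact_support (f : R -> R) (M : R) : continuous (f : R -> R) ->
  (forall x, M <= `|x| -> f x = 0) -> summable1 f.
Proof.
move=> cf f0; apply: eq_summable1 (summable1_segment (- M) M cf) => x.
rewrite indicE; case: (boolP (_ \in _)) => [_|]; first by rewrite mulr1.
move=> /negP H; rewrite mulr0 f0//; rewrite leNgt; apply/negP => xM; apply: H.
by rewrite inE/= in_itv/= -ler_norml ltW.
Qed.

Section PhaseEquation.
Variables (sigma c m : R) (W : R -> R[i]) (chi : R -> R).
Hypotheses (sigma0 : 0 < sigma) (m0 : 0 < m) (chi_lp : lp_cutoff chi).
Hypothesis W_eq : solitary_wave_eq sigma c W.
Hypothesis lowW : forall x, m <= Normc.normc (1 + W x).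

Let r x : R := Normc.normc (1 + W x).
Let T1 x : R := Re (1 + W x) / r x.
Let T2 x : R := Im (1 + W x) / r x.
Let k : R := c ^+ 2 / (2 * sigma).

Hypotheses (cr : continuous (r : R -> R)) (cT1 : continuous (T1 : R -> R))
  (cT2 : continuous (T2 : R -> R)).
Variable P : R.
Hypothesis pressureP : forall x, `|pressure r x| <= P.

Let r0 x : 0 < r x. Proof. exact: lt_le_trans m0 (lowW x). Qed.
Let rn x : r x != 0. Proof. by rewrite gt_eqF. Qed.

Let k0 : 0 <= k. Proof. by rewrite divr_ge0 ?sqr_ge0// mulr_ge0// ltW. Qed.

Let rE x : Re (1 + W x) ^+ 2 + Im (1 + W x) ^+ 2 = r x ^+ 2.
Proof. by rewrite /r normc_sqr. Qed.

Let T1E x : T1 x ^+ 2 + T2 x ^+ 2 = 1.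
Proof. by rewrite /T1 /T2 !expr_div_n -mulrDl rE divff// expf_neq0. Qed.

Let cp : continuous (pressure r : R -> R).
Proof. by apply: contB => //; exact: contV. Qed.

(** The numerator is [|1 + W| ^ 2 - 1 = r ^+ 2 - 1], and the inverse of the conjugate of [1 + W] is
    [(1 + W) / r ^+ 2]; the quotient is the pressure times the unit vector. *)
Let rhsE x : (W x + conjc (W x) + W x * conjc (W x)) / (1 + conjc (W x)) =
  (pressure r x * T1 x) +i* (pressure r x * T2 x).
Proof.
have := rn x; have := rE x; rewrite /T1 /T2 /pressure; move: (r x) => q.
case: (W x) => a b /=; rewrite !add0r => E q0.
have -> : 1 + conjc (a +i* b) = (1 + a) +i* - b.
  by apply/eqP; rewrite eq_complex/= add0r !eqxx.
have c0 : (1 + a) +i* - b != 0 :> R[i].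
  apply/negP => /eqP[a1 /eqP]; rewrite oppr_eq0 => /eqP b1.
  move: E; rewrite a1 b1 expr0n addr0 => /esym/eqP.
  by rewrite expf_eq0 (negbTE q0).
apply: (mulIf c0); rewrite mulfVK//.
have E' : a ^+ 2 = q ^+ 2 - b ^+ 2 - 1 - 2 * a by rewrite -E; ring.
apply/eqP; rewrite eq_complex/=; apply/andP; split; apply/eqP.
  transitivity (q ^+ 2 - 1); first by rewrite -E; ring.
  transitivity ((q - q^-1) / q * ((1 + a) ^+ 2 + b ^+ 2)); first by rewrite E; field.
  by field.
by field.
Qed.

(** The components of the weak equation say that [T1] and [T2] have continuous weak derivatives,
    which the lemma of du Bois-Reymond makes classical. The factor [i] of the equation exchanges the
    components, hence the rotation. *)
Lemma phase_equation x :
  is_derive x 1 T1 (k * pressure r x * T2 x) /\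
  is_derive x 1 T2 (- (k * pressure r x * T1 x)).
Proof.
have Tle y : `|T1 y| <= 1 /\ `|T2 y| <= 1.
  split; rewrite -ler_sqr ?nnegrE// real_normK ?num_real// expr1n -(T1E y).
    by rewrite lerDl sqr_ge0.
  by rewrite lerDr sqr_ge0.
have weak phi : test_function phi ->
   integ (fun t => T1 t * phi^`()%classic t) = - integ (fun t => k * pressure r t * T2 t * phi t) /\
   integ (fun t => T2 t * phi^`()%classic t) = - integ (fun t => - (k * pressure r t * T1 t) * phi t).
  move=> tphi; have [sphi [M HM]] := tphi; have cphi := smooth_continuous sphi.
  have sc (f : R -> R) : continuous (f : R -> R) -> summable1 (fun t => pressure r t * f t * phi t).
    move=> cf; apply: (@summable1_compact_support _ M).
      by apply: contM => //; exact: contM.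
    by move=> t /HM ->; rewrite mulr0.
  have := W_eq tphi; rewrite /dist_derive /cintegral -!/(integ _) => E.
  have e1 : (fun t => Re ((1 + W t) / (Normc.normc (1 + W t))%:C * (phi^`()%classic t)%:C)) =
      (fun t => T1 t * phi^`()%classic t).
    apply/funext => t; rewrite /T1 /r -fmorphV; case: (1 + W t) => u v /=.
    by rewrite !mulr0 !subr0.
  have e2 : (fun t => Im ((1 + W t) / (Normc.normc (1 + W t))%:C * (phi^`()%classic t)%:C)) =
      (fun t => T2 t * phi^`()%classic t).
    apply/funext => t; rewrite /T2 /r -fmorphV; case: (1 + W t) => u v /=.
    by rewrite !mulr0 !add0r.
  have e3 : (fun t => Re ((c ^+ 2 / 2)%:C * ((W t + conjc (W t) + W t * conjc (W t)) / (1 + conjc (W t))) * (phi t)%:C))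
      = (fun t => c ^+ 2 / 2 * (pressure r t * T1 t * phi t)).
    by apply/funext => t; rewrite rhsE /=; ring.
  have e4 : (fun t => Im ((c ^+ 2 / 2)%:C * ((W t + conjc (W t) + W t * conjc (W t)) / (1 + conjc (W t))) * (phi t)%:C))
      = (fun t => c ^+ 2 / 2 * (pressure r t * T2 t * phi t)).
    by apply/funext => t; rewrite rhsE /=; ring.
  rewrite e1 e2 e3 e4 !integZ in E; [|exact: sc..].
  have -> : integ (fun t => k * pressure r t * T2 t * phi t) = k * integ (fun t => pressure r t * T2 t * phi t).
    by rewrite -integZ; [apply: eq_integ => t; ring|exact: sc].
  have -> : integ (fun t => - (k * pressure r t * T1 t) * phi t) = - k * integ (fun t => pressure r t * T1 t * phi t).
    by rewrite -integZ; [apply: eq_integ => t; ring|exact: sc].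
  move: E.
  move: (integ _) (integ _) (integ _) (integ _) => j2 j1 i2 i1 /eqP.
  rewrite eq_complex/= => /andP[/eqP E1 /eqP E2].
  have sn : sigma != 0 by rewrite gt_eqF.
  split; apply: (mulfI sn); rewrite /k.
    transitivity (- (c ^+ 2 / 2 * j2)); last by field.
    by rewrite -E2; ring.
  transitivity (c ^+ 2 / 2 * j1); last by field.
  by rewrite -E1; ring.
have ckp (f : R -> R) : continuous (f : R -> R) -> continuous (fun y => k * pressure r y * f y : R).
  by move=> cf; apply: contM => //; apply: contM => //; exact: contcst.
have bnd (f : R -> R) y : `|f y| <= 1 -> `|k * pressure r y * f y| <= k * P.
  move=> f1; rewrite normrM [`|k * _|]normrM [`|k|](ger0_norm k0) -mulrA ler_wpM2l//.
  by rewrite -[leRHS]mulr1; apply: ler_pM.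
split.
  apply: (@primitive_is_derive _ T1 (fun y => k * pressure r y * T2 y)); first exact: ckp.
  move=> y z yz; apply: (du_bois_reymond (V := k * P) chi_lp cT1 (ckp _ cT2)) => //.
    by move=> t; apply: bnd; have [] := Tle t.
  by move=> phi /weak[].
apply: (@primitive_is_derive _ T2 (fun y => - (k * pressure r y * T1 y))).
  by apply: contN; exact: ckp.
move=> y z yz; apply: (du_bois_reymond (V := k * P) chi_lp cT2 (contN (ckp _ cT1))) => //.
  by move=> t; rewrite normrN; apply: bnd; have [] := Tle t.
by move=> phi /weak[].
Qed.

End PhaseEquation.

End SolitaryWave.
Theorem theorem4p1 (R : realType) (h sigma c : R)
    (h_gt0 : 0 < h) (sigma_gt0 : 0 < sigma)
    (chi : R -> R) (chi_lp : lp_cutoff chi)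
    (W : R -> R[i]) (W_besov : besov_half chi W)
    (W_hol : tilbert_holomorphic h W)
    (E : R[i] -> R[i]) (E_ext : holomorphic_extension h W E)
    (W_eq : solitary_wave_eq sigma c W)
    (delta : R) (delta_gt0 : 0 < delta)
    (W_bnd : forall a : R, delta < Normc.normc (1 + W a))
    (E_nz : forall z : R[i], closed_strip h z -> 1 + E z <> 0) :
  forall a : R, W a = 0.
Proof.
have [A [B [sA sB LA LB rep]]] := strip_representation h_gt0 chi_lp W_besov E_ext.
(* The multiplier clause contains square summability of [E] on each horizontal line, from which its
   decay is derived. *)
have L2line b : - h <= b <= 0 -> square_summable (fun x => complex.Re (E (x +i* b))) /\
    square_summable (fun x => complex.Im (E (x +i* b))).
  by move=> /(extension_multiplier E_ext)[U _ [LE _ _]]; exact/in_L2P.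
pose F z := 1 + E z.
have hb0 : - h <= 0 <= (0 : R) by rewrite lexx andbT oppr_le0 ltW.
have hbh : - h <= - h <= (0 : R) by rewrite lexx oppr_le0 ltW.
have contF z : closed_strip h z -> forall e, 0 < e ->
    exists2 eta, 0 < eta & forall w, closed_strip h w ->
      Normc.normc (z - w) < eta -> Normc.normc (F z - F w) < e.
  move=> hz e e0.
  have [eta eta0 H] := closed_strip_continuousP (extension_continuous E_ext) hz e0.
  by exists eta => // w hw /(H w hw); rewrite /F opprD addrACA subrr add0r.
have decayF e : 0 < e -> exists M, forall x b, - h <= b <= 0 -> M <= `|x| ->
    Normc.normc (F (x +i* b) - 1) <= e.
  move=> e0; have e2 : 0 < e / 2 by rewrite divr_gt0.
  have [M HM] := strip_decay h_gt0 sA sB rep e2 L2line; exists M => x b hb xM.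
  have [r i] := HM b x hb xM; rewrite /F addrAC subrr add0r.
  by apply: (le_trans (normc_le_l1 _)); rewrite [leRHS]splitr lerD.
have [m m0 lowF] := strip_lower_bound h_gt0 contF decayF E_nz.
have [K0 K00 HK] := strip_bounded sA sB rep.
have upF z : closed_strip h z -> Normc.normc (F z) <= 1 + (K0 + K0).
  case: z => x b hb; have [r i] := HK b x hb.
  apply: (le_trans (le_normcD _ _)); rewrite Normc.normc1 lerD2l.
  by apply: (le_trans (normc_le_l1 _)); exact: lerD.
have [C C0 botE] := bottom_difference_bound h_gt0 sA sB LA LB rep.
have holF z : strip h z -> derivable (F : R[i]^o -> R[i]^o) z 1.
  by move=> hz; exact: (cderivableD (@cderivable_cst _ 1 z) (extension_holomorphic E_ext hz)).
have realF x : complex.Im (F (x +i* - h)) = 0.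
  by have := extension_bottom E_ext x; rewrite /F; case: (E _) => u v /= ->; rewrite addr0.
have topL2 : square_summable (fun x => complex.Re (F (x +i* 0)) - 1) /\
    square_summable (fun x => complex.Im (F (x +i* 0))).
  have [Lr Li] := L2line 0 hb0; split.
    move: Lr; congr square_summable; apply/funext => x; rewrite /F.
    by case: (E _) => u v /=; rewrite addrAC subrr add0r.
  move: Li; congr square_summable; apply/funext => x; rewrite /F.
  by case: (E _) => u v /=; rewrite add0r.
have botL2 s : square_summable (fun x => complex.Re (F ((x + s) +i* - h)) - complex.Re (F (x +i* - h))) /\
    integ (fun x => (complex.Re (F ((x + s) +i* - h)) - complex.Re (F (x +i* - h))) ^+ 2) <= C * s ^+ 2.
  have d x : complex.Re (F ((x + s) +i* - h)) - complex.Re (F (x +i* - h)) =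
      complex.Re (E ((x + s) +i* - h)) - complex.Re (E (x +i* - h)).
    by rewrite /F; case: (E _) => u v; case: (E _) => u' v' /=; rewrite opprD addrACA subrr add0r.
  have [b1 b2] := botE s; split.
    by move: b1; congr square_summable; apply/funext => x; rewrite d.
  by move: b2; congr (_ <= _); apply: eq_integ => x; rewrite d.
have FW x : F (x +i* 0) = 1 + W x by rewrite /F -(extension_trace E_ext x).
have cRe : continuous (fun x => complex.Re (1 + W x) : R).
  by under eq_fun do rewrite -FW; exact: (holomorphic_cont_Re contF).
have cIm : continuous (fun x => complex.Im (1 + W x) : R).
  by under eq_fun do rewrite -FW; exact: (holomorphic_cont_Im contF).
have lowW x : m <= Normc.normc (1 + W x) by rewrite -FW; exact: (lowF (x +i* 0) hb0).
have cr : continuous (fun x => Normc.normc (1 + W x) : R).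
  have -> : (fun x => Normc.normc (1 + W x)) =
      (fun x => Num.sqrt (complex.Re (1 + W x) ^+ 2 + complex.Im (1 + W x) ^+ 2)).
    by apply/funext => x; rewrite /Normc.normc; case: (1 + W x).
  by apply: contcomp; [apply: contD; exact: contX|exact: sqrt_continuous].
have rn x : Normc.normc (1 + W x) != 0 by rewrite gt_eqF// (lt_le_trans m0 (lowW x)).
have pP x : `|pressure (fun x => Normc.normc (1 + W x)) x| <= 1 + (K0 + K0) + m^-1.
  rewrite /pressure; apply: (le_trans (ler_normB _ _)).
  rewrite ger0_norm ?normc_ge0// ger0_norm ?invr_ge0 ?normc_ge0//; apply: lerD.
    by rewrite -FW; exact: (upF (x +i* 0) hb0).
  by rewrite lef_pV2 ?posrE// (lt_le_trans m0 (lowW x)).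
have ode x := phase_equation sigma_gt0 m0 chi_lp W_eq lowW cr (contM cRe (contV cr rn))
  (contM cIm (contV cr rn)) pP x.
have k0 : 0 <= c ^+ 2 / (2 * sigma) by rewrite divr_ge0 ?sqr_ge0// mulr_ge0// ltW.
have fr : (fun x => Normc.normc (F (x +i* 0))) = (fun x => Normc.normc (1 + W x)).
  by apply/funext => x; rewrite FW.
have f1 : (fun x => complex.Re (F (x +i* 0)) / Normc.normc (F (x +i* 0))) =
    (fun x => complex.Re (1 + W x) / Normc.normc (1 + W x)).
  by apply/funext => x; rewrite FW.
have f2 : (fun x => complex.Im (F (x +i* 0)) / Normc.normc (F (x +i* 0))) =
    (fun x => complex.Im (1 + W x) / Normc.normc (1 + W x)).
  by apply/funext => x; rewrite FW.
have d1 (x : R) : is_derive x 1 (fun x : R => complex.Re (F (x +i* 0)) / Normc.normc (F (x +i* 0)))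
    (c ^+ 2 / (2 * sigma) * pressure (fun x => Normc.normc (F (x +i* 0))) x *
     (complex.Im (F (x +i* 0)) / Normc.normc (F (x +i* 0)))).
  by rewrite fr f1 FW; have [] := ode x.
have d2 (x : R) : is_derive x 1 (fun x : R => complex.Im (F (x +i* 0)) / Normc.normc (F (x +i* 0)))
    (- (c ^+ 2 / (2 * sigma) * pressure (fun x => Normc.normc (F (x +i* 0))) x *
     (complex.Re (F (x +i* 0)) / Normc.normc (F (x +i* 0))))).
  by rewrite fr f2 FW; have [] := ode x.
move=> a.
have := strip_rigidity h_gt0 m0 C0 holF contF lowF upF decayF realF topL2 botL2 k0 d1 d2 a.
by rewrite FW => /eqP; rewrite -subr_eq0 addrAC subrr add0r => /eqP.
Qed.
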